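(* Let $m,n\in\mathbb{N}\setminus\{0\}$ and $p\in(\mathbb{N}\setminus\{0\})\cup\{\infty\}$ with $p\ge m\ge 1$. For $i\in\{1,\ldots,n\}$ let $f_i\colon\mathbb{R}^m\to\mathbb{R}$ be continuous and piecewise-$C^p$ with representation $(\{P_i^j\}_{j=1}^{J_i},\{f_i^j\}_{j=1}^{J_i})$ and piecewise gradient $\widetilde\nabla f_i$ with respect to this representation. Let $f=\frac1n\sum_{i=1}^n f_i$, assume that $f$ is bounded below, and let $D_f$ be the closure-active gradient map of $f$ built from the common-refinement representation of $f$. Let $(i_k)_{k\in\mathbb{N}}$ be the i.i.d. random indices, uniformly distributed on $\{1,\ldots,n\}$, on the probability space $(\Omega,\mathcal F,\mathbb P)$ described in the context. Let $x_0\in\mathbb{R}^m$, and let $(\alpha_k)_{k\in\mathbb{N}}$ be positive real numbers with $\alpha_k=o(1/\log k)$ as $k\to\infty$ and $\sum_{k=0}^\infty\alpha_k=\infty$. Assume that the iterates generated by $$x_{k+1}=x_k-\alpha_k\widetilde\nabla f_{i_k}(x_k),\qquad k\in\mathbb{N},$$ are bounded $\mathbb P$-almost surely. Then, $\mathbb P$-almost surely, $$\lim_{k\to\infty}\operatorname{dist}\bigl(x_k,\{x\in\mathbb{R}^m:0\in\operatorname{conv}D_f(x)\}\bigr)=0,$$ and the sequence of function values $(f(x_k))_{k\in\mathbb{N}}$ converges. Moreover, the set of limit points of $(x_k)_{k\in\mathbb{N}}$ is connected ($\mathbb P$-almost surely).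
   Context: A continuous function $g\colon\mathbb{R}^m\to\mathbb{R}$ is piecewise-$C^p$ if there exist a finite Borel partition $\mathbb{R}^m=\bigsqcup_{j=1}^J P^j$ (nonempty, pairwise disjoint Borel sets) and $C^p$ functions $g^1,\ldots,g^J\colon\mathbb{R}^m\to\mathbb{R}$ with $g(x)=g^j(x)$ whenever $x\in P^j$; the pair $(\{P^j\},\{g^j\})$ is a representation of $g$. The piecewise gradient of $g$ with respect to this representation is $\widetilde\nabla g(x)=\nabla g^j(x)$ for $x\in P^j$. Common-refinement representation of $f=\frac1n\sum_i f_i$: for $\mathbf j=(j_1,\ldots,j_n)\in\prod_{i=1}^n\{1,\ldots,J_i\}$ put $P^{\mathbf j}=\bigcap_{i=1}^n P_i^{j_i}$ and $f^{\mathbf j}=\frac1n\sum_{i=1}^n f_i^{j_i}$; the nonempty sets $P^{\mathbf j}$ together with the functions $f^{\mathbf j}$ form a representation of $f$. The closure-active gradient map is $D_f(x)=\{\nabla f^{\mathbf j}(x): x\in\operatorname{cl}P^{\mathbf j}\}$. Probability setting: $(\Omega_0,\mathcal F_0,\mathbb P^0)$ is a probability space with a random variable $\iota\colon\Omega_0\to\{1,\ldots,n\}$ satisfying $\mathbb P^0(\iota=\ell)=1/n$ for each $\ell$. Set $\Omega=\Omega_0^{\mathbb N}$, $\mathcal F=\mathcal F_0^{\otimes\mathbb N}$, $\mathbb P=(\mathbb P^0)^{\otimes\mathbb N}$, and $i_k(\omega)=\iota(\omega_k)$ for $\omega=(\omega_0,\omega_1,\ldots)$; thus the $i_k$ are i.i.d.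 uniform on $\{1,\ldots,n\}$. $\operatorname{dist}(x,S)=\inf\{\|x-y\|:y\in S\}$, with $\operatorname{dist}(x,\varnothing)=\infty$. $\operatorname{conv}$ is the convex hull, $\operatorname{cl}$ the closure. A limit point of $(x_k)$ is a limit of a convergent subsequence. *)

(* Defs.v *)
From HB Require Import structures.
From mathcomp Require Import all_boot all_order all_algebra.
From mathcomp Require Import all_classical all_reals all_analysis.

Set Implicit Arguments.
Unset Strict Implicit.
Unset Printing Implicit Defensive.

Import Order.TTheory GRing.Theory Num.Theory.
Import numFieldNormedType.Exports.

Local Open Scope classical_set_scope.
Local Open Scope ring_scope.

Variant smoothness := Cfin of nat | Cinfty.

Definition le_smoothness (k : nat) (p : smoothness) : bool :=
  if p is Cfin q then (k <= q)%N else true.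

Section EuclideanSpace.
Context {R : realType} {m : nat}.
Implicit Types (g : 'rV[R]_m -> R) (x : 'rV[R]_m) (S : set 'rV[R]_m).

(* The library norm on 'rV[R]_m is the sup norm. *)
Definition enorm x : R := Num.sqrt (\sum_(i < m) x ord0 i ^+ 2).

(* [ereal_inf set0 = +oo], hence [edist_set x set0 = +oo]. *)
Definition edist_set x S : \bar R :=
  ereal_inf [set (enorm (x - y))%:E | y in S].

Definition gradient g x : 'rV[R]_m := \row_(i < m) 'D_(delta_mx ord0 i) g x.

(* C^(k+1): Frechet differentiable everywhere with a C^k gradient. *)
Fixpoint is_Ck (k : nat) g : Prop :=
  if k is k'.+1 then
    (forall x, differentiable g x) /\
    (forall i : 'I_m, is_Ck k' (fun x => gradient g x ord0 i))
  else continuous g.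

Definition is_Cp (p : smoothness) g : Prop :=
  if p is Cfin k then is_Ck k g else forall k, is_Ck k g.

Definition borel_set S : Prop := <<s open >> S.

Definition convex_hull S : set 'rV[R]_m := smallest (@convex_set R 'rV[R]_m) S.

Definition limit_points (u : nat -> 'rV[R]_m) : set 'rV[R]_m :=
  [set y | exists2 phi : nat -> nat,
     {homo phi : a b / (a < b)%N} & u (phi k) @[k --> \oo] --> y].

Record is_representation (p : smoothness) g (J : nat)
    (P : 'I_J -> set 'rV[R]_m) (gs : 'I_J -> 'rV[R]_m -> R) : Prop := {
  repr_partition : partition setT P setT ;
  repr_borel : forall j, borel_set (P j) ;
  repr_smooth : forall j, is_Cp p (gs j) ;
  repr_eq : forall j x, P j x -> g x = gs j x }.

(* The value 0 is never reached when the [P j] cover the space. *)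
Definition piecewise_gradient (J : nat) (P : 'I_J -> set 'rV[R]_m)
    (gs : 'I_J -> 'rV[R]_m -> R) x : 'rV[R]_m :=
  if [pick j | x \in P j] is Some j then gradient (gs j) x else 0.

Section Average.
Context {n : nat}.

Definition average (f : 'I_n -> 'rV[R]_m -> R) x : R :=
  n%:R^-1 * \sum_(i < n) f i x.

Context {J : 'I_n -> nat}.
Variables (P : forall i, 'I_(J i) -> set 'rV[R]_m)
  (fs : forall i, 'I_(J i) -> 'rV[R]_m -> R).

Definition refined_piece (j : forall i, 'I_(J i)) : set 'rV[R]_m :=
  \bigcap_(i : 'I_n) P (j i).

Definition refined_branch (j : forall i, 'I_(J i)) : 'rV[R]_m -> R :=
  average (fun i => fs (j i)).

(* Empty refined pieces contribute nothing: their closure is empty. *)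
Definition closure_active_gradient x : set 'rV[R]_m :=
  [set gradient (refined_branch j) x
     | j in [set j | closure (refined_piece j) x]].

Fixpoint iterates (G : 'I_n -> 'rV[R]_m -> 'rV[R]_m) (alpha : nat -> R)
    (x0 : 'rV[R]_m) (i : nat -> 'I_n) (k : nat) : 'rV[R]_m :=
  if k is k'.+1 then
    let x := iterates G alpha x0 i k' in x - alpha k' *: G (i k') x
  else x0.

End Average.
End EuclideanSpace.

Section ProductSpace.
Context {d : measure_display} (T : measurableType d).

Definition coordinate_cylinders : set (set (nat -> T)) :=
  \bigcup_k preimage_set_system setT (fun w : nat -> T => w k) measurable.

(* nat -> T with the product sigma-algebra. *)
Definition seq_space := g_sigma_algebraType coordinate_cylinders.

HB.instance Definition _ := Measurable.on seq_space.

(* P is the product measure P0^(nat), the unique probability measure with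
   these values on the measurable boxes. *)
Definition is_product_probability (R : realType) (P0 : probability T R)
    (P : probability seq_space R) : Prop :=
  forall (N : nat) (A : nat -> set T), (forall k, measurable (A k)) ->
    P [set w : seq_space | forall k, (k < N)%N -> A k (w k)]
      = (\prod_(k < N) P0 (A k))%E.

End ProductSpace.

(* Main.v *)
Require Import Defs.
From HB Require Import structures.
From mathcomp Require Import all_boot all_order all_algebra.
From mathcomp Require Import all_classical all_reals all_analysis.
From mathcomp Require Import ring lra.
From mathcomp Require ordered_qelim qe_rcf.

(**
  Write the recursion as [x_{k+1} = x_k - alpha_k (v_k + xi_k)], where [v_k] is
  the gradient of the branch of [f] active at [x_k] and [xi_k] is a martingale
  noise.  Exponential supermartingales and Borel-Cantelli, with
  [alpha_k = o(1 / log k)], show that almost surely the accumulated noise is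
  negligible over bounded stretches of the time scale [\sum_{j < k} alpha_j].

  Near a point whose active gradients have a convex hull at distance [c > 0]
  from the origin, [f] decreases along such a path at rate about [c^2]: on the
  pieces visited [f] agrees with each branch, so if all pieces are visited near
  both ends of a time interval the increment of [f] is the average of the
  increments of the branches with weights the occupation times, and the average
  velocity is minus the same average of the gradients; otherwise recurse on the
  number of pieces.

  Critical values contain no interval.  Following Yomdin, Taylor polynomials on
  cells of side [eps] reduce this to polynomial families, where quantifier
  elimination bounds the number of sign changes, hence the variation of a
  lexicographically minimal choice of near-critical points; this limits the
  number of near-critical values on a fine grid, and summing over the
  [eps^(-m)] cells needs exactly [p >= m].

  If [f(x_k)] oscillated, it would cross a regular level upwards infinitely
  often, against the local descent.  So [f(x_k)] converges, all limit points
  are critical, and the limit set is connected because the steps tend to [0].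
*)

Set Implicit Arguments.
Unset Strict Implicit.
Unset Printing Implicit Defensive.

Import Order.TTheory GRing.Theory Num.Theory.
Import numFieldNormedType.Exports.

Local Open Scope classical_set_scope.
Local Open Scope ring_scope.

(** The pieces are arbitrary Borel sets, so neither a stratification nor a chain rule along
    trajectories is available. What survives is that [f] equals a branch on the closure of its
    piece; comparing [f] at two times spent in the same piece, however far apart, replaces the chain
    rule. The same obstacle shapes the Sard argument: the locus where several branches coincide need
    not be a manifold. The common value [v] is therefore an independent variable, with each
    [v - Q j] small. For a definable choice of near-critical points, an increment of [v] splits with
    the convex weights into increments of [v - Q j], of total variation O(eta1), and of [Q j],
    controlled by eta2 times the displacement. Taylor remainders of order [m] make both
    contributions o(eps^m) on a cell. The factor 1/log k in the step sizes lets the exponential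
    parameter grow like log k, so that a deviation over a window starting at [k] has probability at
    most k^(-2). Since the bound on the iterates is random, noise increments are cut off outside a
    fixed ball and the null sets are collected over integer radii. *)

Section RowNorm.
Context {R : realType} {m : nat}.
Implicit Types x : 'rV[R]_m.

Lemma rV_norm_le x (M : R) : 0 <= M -> (forall i, `|x ord0 i| <= M) -> `|x| <= M.
Proof.
move=> M0 h; rewrite /Num.norm /= mx_normrE.
by apply/bigmax_leP; split=> // -[i j] _ /=; rewrite [i]ord1.
Qed.

Lemma rV_coord_le x i : `|x ord0 i| <= `|x|.
Proof.
rewrite [leRHS]/Num.norm /= mx_normrE.
by apply/bigmax_geP; right; exists (ord0, i).
Qed.

Lemma rV_norm_le_sum x : `|x| <= \sum_i `|x ord0 i|.
Proof.
apply: rV_norm_le => [|i]; first exact: sumr_ge0.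
by rewrite (bigD1 i) //= lerDl sumr_ge0.
Qed.

Lemma sum_coord_le x : \sum_i `|x ord0 i| <= m%:R * `|x|.
Proof.
apply: le_trans (_ : \sum_(i < m) `|x| <= _).
  by apply: ler_sum => i _; exact: rV_coord_le.
by rewrite sumr_const card_ord mulr_natl.
Qed.

End RowNorm.

(** * Compactness and uniform estimates on balls *)

Section Compactness.
Context {R : realType} {m : nat}.

(** The near-covering form of compactness, applied with the scale [s] tending to 0 from the right,
    turns local radii into a common one. It yields uniform continuity, a common descent time on a
    level set and a tube around a compact part of the limit set. *)
Lemma compact_uniform_radius (K : set 'rV[R]_m) (Pr : R -> 'rV[R]_m -> Prop) :
  compact K ->
  (forall x, K x -> exists2 r : R, 0 < r &
     forall y s, `|y - x| < r -> 0 < s < r -> Pr s y) ->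
  exists2 r : R, 0 < r & forall y s, K y -> 0 < s < r -> Pr s y.
Proof.
move=> /compact_near_coveringP cK hloc.
have /= := cK R 0^'+ (fun s y => Pr s y) _.
move=> /(_ _)[|r /= r0 hr].
  move=> x /hloc [r r0 hr].
  exists (ball x r, [set s | 0 < s < r]) => /=.
    split; first exact: nbhsx_ballx.
    by near=> s; apply/andP; split; near: s; [exact: nbhs_right_gt|exact: nbhs_right_lt].
  by move=> [y s] /= [h1 h2]; apply: hr => //; rewrite distrC -ball_normE in h1 *.
exists r => // y s Ky /andP[s0 sr]; apply: hr => //=.
by rewrite sub0r normrN gtr0_norm.
Unshelve. all: by end_near. Qed.

Lemma compact_uniform_continuity (K : set 'rV[R]_m) (g : 'rV[R]_m -> R) (e : R) :
  compact K -> continuous g -> 0 < e ->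
  exists2 r : R, 0 < r & forall y y', K y -> `|y' - y| < r -> `|g y' - g y| < e.
Proof.
move=> cK cg e0.
pose Pr (s : R) y := forall y' : 'rV[R]_m, `|y' - y| < s -> `|g y' - g y| < e.
have [|r r0 hr] := @compact_uniform_radius K Pr cK.
  move=> x _.
  have /cvgrPdist_lt /(_ (e / 2)) := cg x.
  rewrite divr_gt0 // => /(_ isT) /nbhs_ballP[r /= r0 hr].
  have hr' y : `|y - x| < r -> `|g x - g y| < e / 2.
    by move=> h; apply: hr; rewrite -ball_normE /= distrC.
  exists (r / 2); first by rewrite divr_gt0.
  move=> y s yx /andP[s0 sr] y' y'y.
  have h1 : `|g x - g y| < e / 2 by apply: hr'; lra.
  have h2 : `|g x - g y'| < e / 2.
    apply: hr'; have := ler_normD (y' - y) (y - x); rewrite addrA subrK; lra.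
  have := ler_normB (g x - g y) (g x - g y').
  have -> : g x - g y - (g x - g y') = g y' - g y by lra.
  lra.
exists (r / 2); first by rewrite divr_gt0.
move=> y y' Ky; apply: (hr y (r / 2)) => //.
by rewrite divr_gt0 //=; lra.
Qed.

End Compactness.

Section CompactBall.
Context {R : realType} {m : nat}.

Lemma compact_norm_le (B : R) : compact [set x : 'rV[R]_m | `|x| <= B].
Proof.
apply: bounded_closed_compact.
  by exists B; split; [exact: num_real|move=> M BM x /= xB; apply: le_trans xB (ltW BM)].
apply: (@closed_comp _ _ (@Num.norm R 'rV[R]_m) [set t | t <= B]) => [x _|]; last exact: closed_le.
exact: norm_continuous.
Qed.

Lemma finite_pos_bound (T : finType) (f : T -> R) : (forall t, 0 < f t) ->
  exists2 h : R, 0 < h & forall t, h <= f t.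
Proof.
move=> f0; exists (\big[Num.min/1]_t f t); first by apply: lt_bigmin => // t _.
by move=> t; exact: bigmin_le_cond.
Qed.

End CompactBall.

Section BallBounds.
Context {R : realType} {m : nat}.

Lemma bounded_on_ball (h : 'rV[R]_m -> R) (M : R) : continuous h ->
  exists B : R, forall y, `|y| <= M -> `|h y| <= B.
Proof.
move=> ch; have [M0|M0] := leP 0 M; last first.
  by exists 0 => y yM; have := le_lt_trans yM M0; rewrite ltNge normr_ge0.
have ne : [set y : 'rV[R]_m | `|y| <= M] !=set0 by exists 0; rewrite /= normr0.
have cn : continuous (fun y => `|h y|).
  by move=> y; apply: continuous_comp; [exact: ch|exact: norm_continuous].
have [c _ hc] := EVT_max_rV ne (@compact_norm_le R m M) (continuous_subspaceT cn).
by exists `|h c| => y yM; apply: hc; rewrite inE.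
Qed.

Lemma segment_ball (x y c : 'rV[R]_m) (r t : R) : 0 <= t <= 1 ->
  `|x - c| <= r -> `|y - c| <= r -> `|x + t *: (y - x) - c| <= r.
Proof.
move=> /andP[t0 t1] hx hy.
have -> : x + t *: (y - x) - c = (1 - t) *: (x - c) + t *: (y - c).
  by apply/rowP => i; rewrite !mxE; ring.
apply: le_trans (ler_normD _ _) _; rewrite !normrZ ger0_norm ?subr_ge0 // ger0_norm //.
have h1 : (1 - t) * `|x - c| <= (1 - t) * r by rewrite ler_wpM2l // subr_ge0.
have h2 : t * `|y - c| <= t * r by rewrite ler_wpM2l.
by apply: le_trans (lerD h1 h2) _; lra.
Qed.

End BallBounds.

(** * Semialgebraic families switch a bounded number of times *)

Section Switches.

Definition switches (b : nat -> bool) (K : nat) : nat :=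
  (\sum_(s < K) (b s != b s.+1))%N.

Lemma leq_switches (b c : nat -> bool) K :
  (forall s, (s < K)%N -> c s = c s.+1 -> b s = b s.+1) ->
  (switches b K <= switches c K)%N.
Proof.
move=> h; apply: leq_sum => s _.
by case: (eqVneq (c s) (c s.+1)) => [/h -> //|_]; [rewrite eqxx | exact: leq_b1].
Qed.

Lemma leq_switches2 (b c d : nat -> bool) K :
  (forall s, (s < K)%N -> c s = c s.+1 -> d s = d s.+1 -> b s = b s.+1) ->
  (switches b K <= switches c K + switches d K)%N.
Proof.
move=> h; rewrite -big_split; apply: leq_sum => s _ /=.
have := h s (ltn_ord s).
by case: (b s) (b s.+1) (c s) (c s.+1) (d s) (d s.+1)
  => [] [] [] [] [] [] //= H; have := H erefl erefl.
Qed.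

Context {R : realType}.

(** A change of the sign of [p] between [v s] and [v s.+1] forces a root in the closed interval
    between them. Adjacent intervals share an endpoint, so indices of each parity are counted
    separately ([half]): within one parity the roots found are distinct, hence at most [size p]. *)
Lemma switches_poly (p : {poly R}) (phi : R -> bool) (v : nat -> R) K :
  {homo v : s t / (s < t)%N >-> s < t} ->
  (switches (fun s => phi (Num.sg p.[v s])) K <= (size p).*2)%N.
Proof.
move=> incv; set b := fun s => _.
have [p00|p0] := eqVneq p 0.
  by rewrite /switches big1 // => s _; rewrite /b p00 !horner0 eqxx.
have rt s : b s != b s.+1 -> exists x, [&& v s <= x, x <= v s.+1 & root p x].
  move=> bs.
  have vs : v s <= v s.+1 by rewrite ltW // incv.
  have [h1|h1] := leP p.[v s] 0; have [h2|h2] := leP p.[v s.+1] 0.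
  - have [h3|h3] := eqVneq p.[v s] 0.
      by exists (v s); rewrite lexx vs; apply/rootP.
    have [h4|h4] := eqVneq p.[v s.+1] 0.
      by exists (v s.+1); rewrite lexx vs; apply/rootP.
    move: bs; rewrite /b !ltr0_sg ?eqxx // lt_neqAle ?h3 ?h4 //.
  - have [//||x /andP[? ?] ?] := @poly_ivt _ p (v s) (v s.+1); first by rewrite h1 ltW.
    by exists x; apply/and3P.
  - have [//||x /andP[? ?]] := @poly_ivt _ (- p) (v s) (v s.+1).
      by rewrite !hornerN oppr_le0 oppr_ge0 ltW.
    by rewrite rootN => ?; exists x; apply/and3P.
  - by move: bs; rewrite /b !gtr0_sg // eqxx.
have half (o : bool) : (\sum_(s < K | odd s == o) (b s != b s.+1) <= size p)%N.
  pose r s := xget 0 [set x | [&& v s <= x, x <= v s.+1 & root p x]].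
  have rP s : b s != b s.+1 -> [&& v s <= r s, r s <= v s.+1 & root p (r s)].
    by move=> /rt [x hx]; rewrite /r; case: xgetP => [y _ //|/(_ x)].
  pose l := [seq s <- iota 0 K | (odd s == o) && (b s != b s.+1)].
  have -> : (\sum_(s < K | odd s == o) (b s != b s.+1) = size l)%N.
    rewrite -(big_mkord (fun s => odd s == o) (fun s => (b s != b s.+1) : nat)).
    rewrite /index_iota subn0 /l size_filter -sum1_count.
    by rewrite big_mkcondr /=; apply: eq_bigr => s _; case: ifP.
  have := @max_poly_roots _ p [seq r s | s <- l] p0.
  rewrite size_map => h; apply/ltnW/h.
    apply/allP => _ /mapP[s + ->]; rewrite mem_filter => /andP[/andP[_ /rP]] .
    by case/and3P.
  rewrite map_inj_in_uniq ?filter_uniq ?iota_uniq // => s t.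
  rewrite !mem_filter => /andP[/andP[/eqP os bs] _] /andP[/andP[/eqP ot bt] _].
  wlog st : s t os ot bs bt / (s <= t)%N.
    by case/orP: (leq_total s t) => st h' e; [exact: h'|apply/esym/h'].
  rewrite leq_eqVlt in st; case/orP: st => [/eqP //|st] e.
  have s2 : (s.+1 < t)%N.
    rewrite ltn_neqAle st andbT; apply/eqP => e'.
    by move: ot; rewrite -e' /= os; case: (o).
  have /and3P[_ h1 _] := rP _ bs; have /and3P[h2 _ _] := rP _ bt.
  have := incv _ _ s2; rewrite ltNge; case/negP.
  by rewrite (le_trans h2) // -e.
rewrite /switches (bigID (fun s : 'I_K => odd s == true)) /= -addnn leq_add //.
rewrite (eq_bigl (fun s : 'I_K => odd s == false)); first exact: half.
by move=> s /=; case: (odd s).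
Qed.

End Switches.

Import ordered_qelim.

(** * Definability over the ordered field and quantifier elimination *)

Section Definable.
Context {R : realType}.

Section OneEnvironment.
Context {V : finType}.
Implicit Types (e : V -> R) (A B : (V -> R) -> Prop) (T U : (V -> R) -> R).

Definition upd e x t : V -> R := fun y => if y == x then t else e y.

(** Variables are named by a finite type, and formulas read an environment as the list [codom e].
    The term stays existentially hidden, so that definability is proved by closure rules only;
    [rterm] excludes inverses, hence these are the polynomials. *)
Definition polyfun T :=
  exists2 t : GRing.term R, GRing.rterm t & forall e, GRing.eval (codom e) t = T e.

Definition definable A :=
  exists f : ord.formula R, forall e, ord.holds (codom e) f <-> A e.

Lemma polyfun_ext T U : (forall e, T e = U e) -> polyfun T -> polyfun U.
Proof. by move=> h [t rt tP]; exists t => // e; rewrite tP. Qed.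

Lemma polyfun_const (c : R) : polyfun (fun=> c).
Proof. by exists (GRing.Const c). Qed.

Lemma polyfun_var x : polyfun (fun e => e x).
Proof. by exists (GRing.Var _ (enum_rank x)) => // e /=; rewrite nth_codom enum_rankK. Qed.

Lemma polyfunD T U : polyfun T -> polyfun U -> polyfun (fun e => T e + U e).
Proof.
by move=> [t rt tP] [u ru uP]; exists (GRing.Add t u) => [|e] /=; rewrite ?rt // tP uP.
Qed.

Lemma polyfunM T U : polyfun T -> polyfun U -> polyfun (fun e => T e * U e).
Proof.
by move=> [t rt tP] [u ru uP]; exists (GRing.Mul t u) => [|e] /=; rewrite ?rt // tP uP.
Qed.

Lemma polyfunN T : polyfun T -> polyfun (fun e => - T e).
Proof. by move=> [t rt tP]; exists (GRing.Opp t) => [|e] /=; rewrite ?rt // tP. Qed.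

Lemma polyfunB T U : polyfun T -> polyfun U -> polyfun (fun e => T e - U e).
Proof. by move=> hT hU; apply: polyfunD => //; exact: polyfunN. Qed.

Lemma polyfun_sum (I : Type) (r : seq I) (F : I -> (V -> R) -> R) :
  (forall i, polyfun (F i)) -> polyfun (fun e => \sum_(i <- r) F i e).
Proof.
move=> h; elim: r => [|i r IH].
  by apply: polyfun_ext (polyfun_const 0) => e; rewrite big_nil.
by apply: polyfun_ext (polyfunD (h i) IH) => e; rewrite big_cons.
Qed.

Lemma definable_ext A B : (forall e, A e <-> B e) -> definable A -> definable B.
Proof. by move=> h [f fP]; exists f => e; rewrite fP. Qed.

Lemma definable_le T U : polyfun T -> polyfun U -> definable (fun e => T e <= U e).
Proof. by move=> [t _ tP] [u _ uP]; exists (ord.Le t u) => e /=; rewrite tP uP. Qed.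

Lemma definable_lt T U : polyfun T -> polyfun U -> definable (fun e => T e < U e).
Proof. by move=> [t _ tP] [u _ uP]; exists (ord.Lt t u) => e /=; rewrite tP uP. Qed.

Lemma definable_eq T U : polyfun T -> polyfun U -> definable (fun e => T e = U e).
Proof. by move=> [t _ tP] [u _ uP]; exists (ord.Equal t u) => e /=; rewrite tP uP. Qed.

Lemma definable_and A B :
  definable A -> definable B -> definable (fun e => A e /\ B e).
Proof. by move=> [f fP] [g gP]; exists (ord.And f g) => e /=; rewrite fP gP. Qed.

Lemma definable_or A B :
  definable A -> definable B -> definable (fun e => A e \/ B e).
Proof. by move=> [f fP] [g gP]; exists (ord.Or f g) => e /=; rewrite fP gP. Qed.

Lemma definable_imp A B :
  definable A -> definable B -> definable (fun e => A e -> B e).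
Proof. by move=> [f fP] [g gP]; exists (ord.Implies f g) => e /=; rewrite fP gP. Qed.

Lemma definable_not A : definable A -> definable (fun e => ~ A e).
Proof. by move=> [f fP]; exists (ord.Not f) => e /=; rewrite fP. Qed.

Lemma definable_forall_fin (I : finType) (A : I -> (V -> R) -> Prop) :
  (forall i, definable (A i)) -> definable (fun e => forall i, A i e).
Proof.
move=> h; suff : definable (fun e => forall i, i \in enum I -> A i e).
  by apply: definable_ext => e; split=> H i; [apply/H; rewrite mem_enum | move=> _].
elim: (enum I) => [|i r IH].
  by exists (ord.Bool true) => e; split.
apply: definable_ext (definable_and (h i) IH) => e; split.
  by move=> [Ai Ar] j; rewrite inE => /orP[/eqP ->//|/Ar].
by move=> H; split=> [|j jr]; apply: H; rewrite inE ?eqxx // jr orbT.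
Qed.

Lemma definable_exists_fin (I : finType) (A : I -> (V -> R) -> Prop) :
  (forall i, definable (A i)) -> definable (fun e => exists i, A i e).
Proof.
move=> h.
have := definable_not (definable_forall_fin (fun i => definable_not (h i))).
apply: definable_ext => e; split=> [H|[i Ai] H]; last exact: H i Ai.
by apply: contrapT => N; apply: H => i Ai; apply: N; exists i.
Qed.

Lemma codom_upd e x t : codom (upd e x t) = set_nth 0 (codom e) (enum_rank x) t.
Proof.
apply: (@eq_from_nth _ 0) => [|i]; rewrite ?size_set_nth !size_codom.
  by rewrite (maxn_idPr _).
move=> iV; rewrite nth_set_nth /=.
have -> : i = enum_rank (enum_val (Ordinal iV)) by rewrite enum_valK.
rewrite !nth_codom !enum_rankK /upd.
by rewrite (inj_eq val_inj) (inj_eq enum_rank_inj).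
Qed.

Lemma definable_ex A x : definable A -> definable (fun e => exists t, A (upd e x t)).
Proof.
move=> [f fP]; exists (ord.Exists (enum_rank x) f) => e /=.
by split=> -[t h]; exists t; move: h; rewrite -codom_upd fP.
Qed.

Lemma definable_ex_block A (l : seq V) : definable A ->
  definable (fun e => exists z : V -> R, A (fun x => if x \in l then z x else e x)).
Proof.
elim: l A => [|x l IH] A hA.
  by apply: definable_ext hA => e; split=> [?|[z//]]; exists e.
apply: definable_ext (definable_ex x (IH A hA)) => e; split.
  move=> [t [z h]]; exists (fun y => if y \in l then z y else t).
  by apply: eq_ind h _ _; apply/funext => y; rewrite inE /upd; case: eqVneq => //=; case: ifP.
move=> [z h]; exists (z x), z.
by apply: eq_ind h _ _; apply/funext => y; rewrite inE /upd; case: eqVneq => [->|] //=; case: ifP.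
Qed.

Lemma definable_qf A : definable A ->
  exists f : ord.formula R, [/\ ord.qf_form f, ord.rformula f &
    forall e, ord.qf_eval (codom e) f <-> A e].
Proof.
move=> [f fP].
pose g := ord.quantifier_elim (fun i bc => qe_rcf.qfr_to_formula (qe_rcf.wproj i bc)) (ord.to_rform f).
have /andP[h1 h2] := ord.quantifier_elim_wf (@qe_rcf.wf_QE_wproj R) (ord.to_rform_rformula f).
exists g; split=> // e; rewrite -fP.
by split=> /(qe_rcf.rcf_satP _ f).
Qed.

(** Abstracting the variable [x] makes the term a polynomial whose formal length does not depend on
    the values of the other variables; this is why [N] is uniform in [e]. *)
Lemma switches_term (t : GRing.term R) (phi : R -> bool) (x : nat) : GRing.rterm t ->
  exists N, forall (e : seq R) (v : nat -> R) K, {homo v : s t / (s < t)%N >-> s < t} ->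
   (switches (fun s => phi (Num.sg (GRing.eval (set_nth 0%R e x (v s)) t))) K <= N)%N.
Proof.
move=> rt; pose q := qe_rcf.abstrX x (qe_rcf.to_rterm t).
exists (size q).*2 => e v K incv.
apply: leq_trans (_ : _ <= (size (qe_rcf.eval_poly e q)).*2)%N _; last first.
  by rewrite leq_double qe_rcf.eval_polyP (leq_trans (size_Poly _)) // size_map.
apply: leq_trans (switches_poly (qe_rcf.eval_poly e q) phi K incv).
apply: leq_switches => s _.
by rewrite !qe_rcf.abstrXP !qe_rcf.evalE !qe_rcf.to_rtermE.
Qed.

Lemma switches_qf (f : ord.formula R) (x : nat) : ord.qf_form f -> ord.rformula f ->
  exists N, forall (e : seq R) (v : nat -> R) K, {homo v : s t / (s < t)%N >-> s < t} ->
   (switches (fun s => ord.qf_eval (set_nth 0%R e x (v s)) f) K <= N)%N.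
Proof.
(* Equality, [<] and [<=] are all functions of the sign of the difference. *)
have atom (t u : GRing.term R) (phi : R -> bool) (b : R -> R -> bool) :
    (forall a c, b a c = phi (Num.sg (a - c))) -> GRing.rterm t -> GRing.rterm u ->
    exists N, forall (e : seq R) (v : nat -> R) K, {homo v : s t / (s < t)%N >-> s < t} ->
    (switches (fun s => b (GRing.eval (set_nth 0%R e x (v s)) t)
                          (GRing.eval (set_nth 0%R e x (v s)) u)) K <= N)%N.
  move=> bE rt ru.
  have [|N NP] := @switches_term (GRing.Add t (GRing.Opp u)) phi x; first by rewrite /= rt ru.
  exists N => e v K incv; apply: leq_trans (NP e v K incv).
  by apply: leq_switches => s _; rewrite !bE.
elim: f => //=.
- by move=> b _ _; exists 0%N => e v K _; rewrite /switches big1 // => s _; rewrite eqxx.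
- move=> t u _ /andP[rt ru]; apply: (atom t u (fun s => s == 0)) => // a c.
  by rewrite sgr_eq0 subr_eq0.
- move=> t u _ /andP[rt ru]; apply: (atom t u (fun s => s < 0)) => // a c.
  by rewrite sgr_lt0 subr_lt0.
- move=> t u _ /andP[rt ru]; apply: (atom t u (fun s => s <= 0)) => // a c.
  by rewrite sgr_le0 subr_le0.
- move=> f IHf g IHg /andP[/IHf hf /IHg hg] /andP[/hf[M MP] /hg[N NP]].
  exists (M + N)%N => e v K incv.
  apply: leq_trans (leq_add (MP e v K incv) (NP e v K incv)).
  by apply: leq_switches2 => s _ -> ->.
- move=> f IHf g IHg /andP[/IHf hf /IHg hg] /andP[/hf[M MP] /hg[N NP]].
  exists (M + N)%N => e v K incv.
  apply: leq_trans (leq_add (MP e v K incv) (NP e v K incv)).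
  by apply: leq_switches2 => s _ -> ->.
- move=> f IHf g IHg /andP[/IHf hf /IHg hg] /andP[/hf[M MP] /hg[N NP]].
  exists (M + N)%N => e v K incv.
  apply: leq_trans (leq_add (MP e v K incv) (NP e v K incv)).
  by apply: leq_switches2 => s _ -> ->.
- move=> f IHf /IHf hf /hf[M MP]; exists M => e v K incv.
  by apply: leq_trans (MP e v K incv); apply: leq_switches => s _ ->.
Qed.

(** Uniform finiteness along one variable: [N] depends neither on the other variables nor on the
    number [K] of sample points. Quantifier elimination enters the Sard argument through this bound
    only. *)
Lemma definable_switches A x : definable A -> exists N, forall e (v : nat -> R) K,
  {homo v : s t / (s < t)%N >-> s < t} ->
  (switches (fun s => `[< A (upd e x (v s)) >]) K <= N)%N.
Proof.
move=> /definable_qf [f [qf rf fP]].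
have [N NP] := switches_qf (enum_rank x) qf rf; exists N => e v K incv.
apply: leq_trans (NP (codom e) v K incv); apply: leq_switches => s _ h.
have E t : `[< A (upd e x t) >] = ord.qf_eval (set_nth 0 (codom e) (enum_rank x) t) f.
  by rewrite -codom_upd; apply/asboolP/idP => /fP.
by rewrite !E.
Qed.

Lemma polyfun_comp_exp T k : polyfun T -> polyfun (fun e => T e ^+ k).
Proof. by move=> [t rt tP]; exists (GRing.Exp t k) => [|e] /=; rewrite ?rt // tP. Qed.

End OneEnvironment.

Section Substitution.
Context {V W : finType} (S : V -> (W -> R) -> R).
Hypothesis polyS : forall x, polyfun (S x).

Lemma polyfun_subst (T : (V -> R) -> R) : polyfun T -> polyfun (fun e => T (fun x => S x e)).
Proof.
move=> [t rt tP].
suff : polyfun (fun e => GRing.eval (codom (fun x => S x e)) t).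
  by apply: polyfun_ext => e; rewrite tP.
elim: t rt {T tP} => //=.
- move=> i _; have [iV|iV] := ltnP i #|V|.
    apply: polyfun_ext (polyS (enum_val (Ordinal iV))) => e.
    by rewrite -[i in RHS]/(nat_of_ord (Ordinal iV)) nth_codom.
  apply: polyfun_ext (polyfun_const 0) => e.
  by rewrite nth_default // size_codom.
- by move=> c _; exact: polyfun_const.
- by move=> c _; exact: polyfun_const.
- by move=> t IHt u IHu /andP[/IHt ? /IHu ?]; exact: polyfunD.
- by move=> t IHt /IHt ?; exact: polyfunN.
- move=> t IHt k /IHt ht; apply: polyfun_ext (polyfunM ht (polyfun_const k%:R)) => e.
  by rewrite mulr_natr.
- by move=> t IHt u IHu /andP[/IHt ? /IHu ?]; exact: polyfunM.
- by move=> t IHt k /IHt ht; exact: polyfun_comp_exp.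
Qed.

End Substitution.
End Definable.

(** * Variation of semialgebraic selections *)

Section Variation.
Context {R : realType}.

(** Integral, from [d] to the last point of [ds], of the step function with value [w d] on the
    interval from [d] to the next point. On the grid of the values taken, integrals over levels
    become finite sums. *)
Fixpoint gap_sum (w : R -> R) (d : R) (ds : seq R) : R :=
  if ds is d' :: ds' then (d' - d) * w d + gap_sum w d' ds' else 0.

Lemma gap_sum_id (x d : R) (ds : seq R) : path <%R d ds -> x \in d :: ds ->
  gap_sum (fun c => (c < x)%R%:R) d ds = x - d.
Proof.
elim: ds d => [|d' ds IH] d /=; first by rewrite inE => _ /eqP ->; rewrite subrr.
move=> /andP[dd' p]; rewrite inE => /orP[/eqP ->|xds].
  rewrite ltxx mulr0 add0r subrr.
  have : all (fun c => d <= c) (d' :: ds).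
    rewrite /= (ltW dd') /=; apply/allP => c cds.
    by apply/ltW/(lt_trans dd'); move/(order_path_min lt_trans)/allP: p; apply.
  elim: ds d' {IH p dd'} => [//|d2 ds IH] d' /= /andP[h1 h2].
  by rewrite ltNge h1 mulr0 add0r IH.
rewrite IH //.
have -> : d < x.
  move: xds; rewrite inE => /orP[/eqP -> //|xds].
  by apply: lt_trans dd' _; move/(order_path_min lt_trans)/allP: p; apply.
by rewrite mulr1; lra.
Qed.

Lemma gap_sum_le (w : R -> R) (N d : R) (ds : seq R) : path <%R d ds ->
  (forall c, w c <= N) -> gap_sum w d ds <= N * (last d ds - d).
Proof.
move=> + h; elim: ds d => [|d' ds IH] d /=; first by rewrite subrr mulr0.
move=> /andP[dd' /IH]; set l := last _ _ => H.
have : (d' - d) * w d <= (d' - d) * N by rewrite ler_wpM2l // subr_ge0 ltW.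
lra.
Qed.

Lemma gap_sum_split (I : Type) (r : seq I) (w : I -> R -> R) d ds :
  \sum_(i <- r) gap_sum (w i) d ds = gap_sum (fun c => \sum_(i <- r) w i c) d ds.
Proof.
elim: ds d => [|d' ds IH] d /=; first by rewrite big1.
by rewrite big_split /= IH -mulr_sumr.
Qed.

Lemma gap_sum_dist (x y d : R) (ds : seq R) : path <%R d ds ->
  x \in d :: ds -> y \in d :: ds ->
  `|y - x| = gap_sum (fun c => ((x <= c) != (y <= c))%R%:R) d ds.
Proof.
move=> p; wlog xy : x y / x <= y => [H hx hy|xds yds].
  have [xy|yx] := leP x y; first exact: H.
  rewrite distrC (H _ _ (ltW yx)) //; congr gap_sum; apply/funext => c.
  by rewrite eq_sym.
rewrite ger0_norm ?subr_ge0 //.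
have -> : y - x = (y - d) - (x - d) by lra.
rewrite -(gap_sum_id p xds) -(gap_sum_id p yds).
elim: ds d {p xds yds} => [|d' ds IH] d /=; first by rewrite subrr.
rewrite -IH; set A := gap_sum _ _ _; set B := gap_sum _ _ _.
rewrite !ltNge.
have [h1|h1] := leP x d; have [h2|h2] := leP y d => /=; first by lra.
- by lra.
- by move: (lt_le_trans h1 (le_trans xy h2)); rewrite ltxx.
- by lra.
Qed.

(* Banach's indicatrix: the variation is the integral over all levels [c] of
   the number of crossings of [c]. *)
Lemma variation_le (u : nat -> R) (K N : nat) (a b : R) :
  (forall c, (switches (fun s => u s <= c)%R K <= N)%N) ->
  (forall s, (s <= K)%N -> a <= u s <= b) ->
  \sum_(s < K) `|u s.+1 - u s| <= N%:R * (b - a).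
Proof.
move=> hN hab.
pose l := sort <=%R (undup [seq u s | s <- iota 0 K.+1]).
have ml s : (s <= K)%N -> u s \in l.
  by move=> sK; rewrite mem_sort mem_undup; apply/map_f; rewrite mem_iota.
have lm x : x \in l -> a <= x <= b.
  rewrite mem_sort mem_undup => /mapP[s]; rewrite mem_iota => /andP[_ sK] ->.
  exact: hab.
have : sorted <%R l.
  by rewrite lt_sorted_uniq_le sort_uniq undup_uniq sort_sorted //; exact: le_total.
case: l ml lm => [|d ds] ml lm; first by have := ml 0%N isT.
rewrite [sorted _ _]/= => p.
rewrite (eq_bigr (fun s : 'I_K => gap_sum (fun c => ((u s <= c) != (u s.+1 <= c))%R%:R) d ds)); last first.
  by move=> s _; rewrite (@gap_sum_dist _ _ d ds) ?ml // ltnW.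
rewrite gap_sum_split; apply: le_trans (@gap_sum_le _ N%:R _ _ p _) _.
  by move=> c; rewrite -natr_sum ler_nat; apply: leq_trans (hN c).
rewrite ler_wpM2l //.
have /andP[_ h1] := lm _ (mem_last d ds); have /andP[h2 _] := lm _ (mem_head d ds); lra.
Qed.

End Variation.

(** * Lexicographic minima as definable selections *)

Section LexMin.
Context {R : realType} {q : nat}.
Implicit Types z : 'rV[R]_q.

Definition lexle z z' : Prop := (forall i, z ord0 i = z' ord0 i) \/
  exists i : 'I_q, (forall k : 'I_q, (k < i)%N -> z ord0 k = z' ord0 k) /\ z ord0 i < z' ord0 i.

Lemma lexle_anti z z' : lexle z z' -> lexle z' z -> z = z'.
Proof.
move=> [h _|[i [h1 h2]]]; first by apply/rowP.
move=> [h|[j [h3 h4]]]; first by rewrite h ltxx in h2.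
have [ij|ij|ij] := ltngtP i j.
- by rewrite h3 // ltxx in h2.
- by rewrite h1 // ltxx in h4.
- move/val_inj: ij => ij; rewrite ij in h2.
  by move: (lt_trans h2 h4); rewrite ltxx.
Qed.

(** The coordinates are minimised in turn: [Sr] is the compact set of points that are minimal for
    the first [r] coordinates. The fourth invariant, that [Sr] contains every point of [S] sharing
    its first [r] coordinates with a member, lets the next coordinate be minimised over [Sr]
    alone. *)
Lemma lexmin_exists (S : set 'rV[R]_q) : compact S -> S !=set0 ->
  exists2 z, S z & forall z', S z' -> lexle z z'.
Proof.
move=> cS S0.
suff : forall r, (r <= q)%N -> exists Sr : set 'rV[R]_q, [/\ compact Sr, Sr !=set0, Sr `<=` S,
    forall z z', Sr z -> S z' -> (forall k : 'I_q, (k < r)%N -> z ord0 k = z' ord0 k) -> Sr z' &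
    forall z z', Sr z -> S z' -> (forall k : 'I_q, (k < r)%N -> z ord0 k = z' ord0 k) \/
     exists i : 'I_q, (forall k : 'I_q, (k < i)%N -> z ord0 k = z' ord0 k) /\ z ord0 i < z' ord0 i].
  move=> /(_ q (leqnn _)) [Sr [_ [z Sz] sub _ h]].
  exists z => [|z' Sz']; first exact: sub.
  by have [H|H] := h _ _ Sz Sz'; [left => i; apply: H | right].
elim=> [_|r IH rq]; first by exists S; split => // z z' _ _; left.
have [Sr [cSr Sr0 sub ag h]] := IH (ltnW rq).
pose i := Ordinal rq.
have ci : continuous (fun z : 'rV[R]_q => z ord0 i) by exact: coord_continuous.
have [c cSr' cmin] : exists2 c, c \in Sr & forall t, t \in Sr -> c ord0 i <= t ord0 i.
  by apply: (@EVT_min_rV _ _ (fun z : 'rV[R]_q => z ord0 i)) => //; exact: continuous_subspaceT.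
exists [set z | Sr z /\ z ord0 i = c ord0 i]; split.
- apply: (@compact_closedI _ Sr [set z : 'rV[R]_q | z ord0 i = c ord0 i]) => //.
  by apply: (@closed_comp _ _ (fun z : 'rV[R]_q => z ord0 i) [set x | x = c ord0 i]) => [z _|]; [exact: ci|exact: closed_eq].
- by exists c; split=> //; exact: set_mem.
- by move=> z [/sub].
- move=> z z' [Sz zc] Sz' H; split.
    by apply: ag Sz Sz' _ => k kr; apply: H; rewrite ltnS ltnW.
  by rewrite -zc H //=.
- move=> z z' [Sz zc] Sz'; have [H|H] := h _ _ Sz Sz'; last by right.
  have [e|e] := eqVneq (z ord0 i) (z' ord0 i).
    left=> k; rewrite ltnS leq_eqVlt => /orP[/eqP kr|/H //].
    by have -> : k = i by apply: val_inj.
  right; exists i; split=> //; rewrite lt_neqAle e zc cmin //.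
  by rewrite inE; apply: ag Sz Sz' H.
Qed.

End LexMin.

Section Selection.
Context {R : realType}.

Lemma polyfun_continuous (V : finType) (T : (V -> R) -> R) (X : topologicalType)
    (g : X -> V -> R) :
  polyfun T -> (forall x, continuous (g ^~ x)) -> continuous (fun z => T (g z)).
Proof.
move=> [t rt tP] cg.
have -> : (fun z => T (g z)) = (fun z => GRing.eval (codom (g z)) t).
  by apply/funext => z; rewrite tP.
elim: t rt {T tP} => //=.
- move=> i _; have [iV|iV] := ltnP i #|V|.
    have -> : (fun z => (codom (g z))`_i) = g ^~ (enum_val (Ordinal iV)).
      by apply/funext => z; rewrite -[i]/(nat_of_ord (Ordinal iV)) nth_codom.
    exact: cg.
  have -> : (fun z => (codom (g z))`_i) = cst 0.
    by apply/funext => z; rewrite nth_default // size_codom.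
  by move=> ?; exact: cvg_cst.
- by move=> c _ ?; exact: cvg_cst.
- by move=> c _ ?; exact: cvg_cst.
- by move=> t IHt u IHu /andP[/IHt ht /IHu hu] z; apply: cvgD; [exact: ht|exact: hu].
- by move=> t IHt /IHt ht z; apply: cvgN; exact: ht.
- move=> t IHt k /IHt ht.
  have -> : (fun z => GRing.eval (codom (g z)) t *+ k) =
            (fun z => GRing.eval (codom (g z)) t * k%:R).
    by apply/funext => z; rewrite mulr_natr.
  by move=> z; apply: cvgM; [exact: ht|exact: cvg_cst].
- by move=> t IHt u IHu /andP[/IHt ht /IHu hu] z; apply: cvgM; [exact: ht|exact: hu].
- move=> t IHt k /IHt ht; elim: k => [|k IHk] z.
    by rewrite (_ : (fun=> _) = cst 1)//; exact: cvg_cst.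
  rewrite (_ : (fun=> _) = fun z => GRing.eval (codom (g z)) t * GRing.eval (codom (g z)) t ^+ k).
    by apply: cvgM; [exact: ht|exact: IHk].
  by apply/funext => y; rewrite exprS.
Qed.

Context {C Kx : finType} {q : nat}.

Definition fiber_env (p : C -> R) (v : R) (z : 'rV[R]_q) : C + unit + 'I_q -> R :=
  fun x => match x with
  | inl (inl c) => p c | inl (inr _) => v | inr i => z ord0 i end.

Definition point_env (p : C -> R) (z : 'rV[R]_q) : C + 'I_q -> R :=
  fun x => match x with inl c => p c | inr i => z ord0 i end.

Variable P : Kx -> (C + unit + 'I_q -> R) -> R.
Hypothesis polyP : forall k, polyfun (P k).

(** Non-strict inequalities keep the fibres closed; being bounded as well they are compact, and a
    lexicographic minimum exists. *)
Definition fiber (p : C -> R) (v : R) : set 'rV[R]_q :=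
  [set z | forall k, P k (fiber_env p v z) <= 0].

Hypothesis bounded_fiber : forall p v, bounded_set (fiber p v).

(** A choice in the fibre that is first-order definable from [p] and [v]. The default value 0 is
    reached only on empty fibres. *)
Definition fiber_lexmin (p : C -> R) (v : R) : 'rV[R]_q :=
  xget 0 [set z | fiber p v z /\ forall z', fiber p v z' -> lexle z z'].

Lemma compact_fiber p v : compact (fiber p v).
Proof.
apply: bounded_closed_compact => //.
have -> : fiber p v = \bigcap_(k in [set: Kx]) (fun z => P k (fiber_env p v z)) @^-1` [set x | x <= 0].
  by apply/seteqP; split => z h k; [move=> _|]; exact: h.
apply: closed_bigI => k _; apply: closed_comp; last exact: closed_le.
move=> z _; apply: polyfun_continuous => // -[[c|u]|i].
- exact: cst_continuous.
- exact: cst_continuous.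
- exact: coord_continuous.
Qed.

Lemma fiber_lexminP p v : fiber p v !=set0 ->
  fiber p v (fiber_lexmin p v) /\ forall z', fiber p v z' -> lexle (fiber_lexmin p v) z'.
Proof.
move=> /(lexmin_exists (@compact_fiber p v)) [z z1 z2].
by rewrite /fiber_lexmin; case: xgetP => [y _ //|/(_ z)] []; split.
Qed.

(** Variables of the formulas: the parameters, the value [v] (tag [true]), a level [c] (tag
    [false]), a candidate point and its competitor. *)
Let V : finType := (C + bool + ('I_q + 'I_q))%type.
Let pe (e : V -> R) c := e (inl (inl c)).
Let ve (e : V -> R) := e (inl (inr true)).
Let ce (e : V -> R) := e (inl (inr false)).
Let ze (e : V -> R) : 'rV[R]_q := \row_i e (inr (inl i)).
Let ze' (e : V -> R) : 'rV[R]_q := \row_i e (inr (inr i)).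

Let definable_fiber : definable (fun e => fiber (pe e) (ve e) (ze e)).
Proof.
apply: definable_forall_fin => k; apply: definable_le; last exact: polyfun_const.
pose S (x : C + unit + 'I_q) : V := match x with
  | inl (inl c) => inl (inl c) | inl (inr _) => inl (inr true) | inr i => inr (inl i) end.
have := @polyfun_subst _ _ _ (fun x (e : V -> R) => e (S x)) (fun x => polyfun_var (S x)) _ (polyP k).
apply: polyfun_ext => e; congr (P k _); apply/funext => -[[c|u]|i] //=.
by rewrite /ze mxE.
Qed.

Let definable_fiber' : definable (fun e => fiber (pe e) (ve e) (ze' e)).
Proof.
apply: definable_forall_fin => k; apply: definable_le; last exact: polyfun_const.
pose S (x : C + unit + 'I_q) : V := match x with
  | inl (inl c) => inl (inl c) | inl (inr _) => inl (inr true) | inr i => inr (inr i) end.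
have := @polyfun_subst _ _ _ (fun x (e : V -> R) => e (S x)) (fun x => polyfun_var (S x)) _ (polyP k).
apply: polyfun_ext => e; congr (P k _); apply/funext => -[[c|u]|i] //=.
by rewrite /ze' mxE.
Qed.

Let definable_lexle : definable (fun e => lexle (ze e) (ze' e)).
Proof.
have pz i : polyfun (fun e => ze e ord0 i).
  by apply: polyfun_ext (polyfun_var (inr (inl i))) => e; rewrite /ze mxE.
have pz' i : polyfun (fun e => ze' e ord0 i).
  by apply: polyfun_ext (polyfun_var (inr (inr i))) => e; rewrite /ze' mxE.
apply: definable_or.
  by apply: definable_forall_fin => i; exact: definable_eq.
apply: definable_exists_fin => i; apply: definable_and; last exact: definable_lt.
apply: definable_forall_fin => k; apply: definable_imp; last exact: definable_eq.
by exists (ordered_qelim.ord.Bool (k < i)%N) => e /=.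
Qed.

Let definable_lexmin :
  definable (fun e => forall z', fiber (pe e) (ve e) z' -> lexle (ze e) z').
Proof.
pose l : seq V := [seq inr (inr i) | i <- enum 'I_q].
have h := definable_not (definable_imp definable_fiber' definable_lexle).
apply: definable_ext (definable_not (definable_ex_block l h)) => e; split.
  move=> H z' fz'; apply: contrapT => N; apply: H.
  pose z (x : V) : R := if x is inr (inr i) then z' ord0 i else 0.
  exists z; set e' := fun x => _.
  have Ez : ze e' = ze e.
    apply/rowP => i; rewrite !mxE /e' ifF //.
    by apply/negbTE/mapP => -[].
  have Ez' : ze' e' = z'.
    apply/rowP => i; rewrite !mxE /e' ifT //.
    by apply/map_f; rewrite mem_enum.
  have Ep : pe e' = pe e.
    by apply/funext => c; rewrite /pe /e' ifF //; apply/negbTE/mapP => -[].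
  have Ev : ve e' = ve e.
    by rewrite /ve /e' ifF //; apply/negbTE/mapP => -[].
  by rewrite Ez Ez' Ep Ev => /(_ fz').
move=> H [z]; set e' := fun x => _.
have Ez : ze e' = ze e.
  apply/rowP => i; rewrite !mxE /e' ifF //.
  by apply/negbTE/mapP => -[].
have Ep : pe e' = pe e.
  by apply/funext => c; rewrite /pe /e' ifF //; apply/negbTE/mapP => -[].
have Ev : ve e' = ve e.
  by rewrite /ve /e' ifF //; apply/negbTE/mapP => -[].
by rewrite Ez Ep Ev; apply => fz; exact: H.
Qed.

Lemma fiber_switches : exists N, forall p (v : nat -> R) K,
  {homo v : s t / (s < t)%N >-> s < t} ->
  (switches (fun s => `[< fiber p (v s) !=set0 >]) K <= N)%N.
Proof.
pose l : seq V := [seq inr (inl i) | i <- enum 'I_q].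
have [N NP] := definable_switches (inl (inr true)) (definable_ex_block l definable_fiber).
exists N => p v K incv.
pose e : V -> R := fun x => if x is inl (inl c) then p c else 0.
apply: leq_trans (NP e v K incv); apply: leq_switches => s _.
suff E t : fiber p t !=set0 <-> exists z : V -> R,
    let e' := fun x => if x \in l then z x else upd e (inl (inr true)) t x in
    fiber (pe e') (ve e') (ze e').
  by move=> H; rewrite !(asbool_equiv_eq (E _)); exact: H.
have Ez (z : V -> R) (e' := fun x => if x \in l then z x else upd e (inl (inr true)) t x) :
    [/\ pe e' = p, ve e' = t & ze e' = \row_i z (inr (inl i))].
  split.
  - by apply/funext => c; rewrite /pe /e' ifF //; apply/negbTE/mapP => -[].
  - by rewrite /ve /e' ifF //; apply/negbTE/mapP => -[].
  - apply/rowP => i; rewrite !mxE /e' ifT //.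
    by apply/map_f; rewrite mem_enum.
split=> [[z fz]|[z]]; cbv zeta.
  pose z' (x : V) : R := if x is inr (inl i) then z ord0 i else 0.
  exists z'; cbv zeta; have [-> -> ->] := Ez z'.
  by rewrite (_ : \row_i _ = z) //; apply/rowP => i; rewrite mxE.
by have [-> -> ->] := Ez z; eexists; eassumption.
Qed.

Variable Phi : (C + unit + 'I_q -> R) -> R.
Hypothesis polyPhi : polyfun Phi.

Let definable_level : definable (fun e => exists z,
  [/\ fiber (pe e) (ve e) z, forall z', fiber (pe e) (ve e) z' -> lexle z z' &
      Phi (fiber_env (pe e) (ve e) z) <= ce e]).
Proof.
pose l : seq V := [seq inr (inl i) | i <- enum 'I_q].
have dPhi : definable (fun e => Phi (fiber_env (pe e) (ve e) (ze e)) <= ce e).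
  apply: definable_le; last exact: polyfun_var.
  pose S (x : C + unit + 'I_q) : V := match x with
    | inl (inl c) => inl (inl c) | inl (inr _) => inl (inr true) | inr i => inr (inl i) end.
  have := @polyfun_subst _ _ _ (fun x (e : V -> R) => e (S x)) (fun x => polyfun_var (S x)) _ polyPhi.
  apply: polyfun_ext => e; congr Phi; apply/funext => -[[c|u]|i] //=.
  by rewrite /ze mxE.
have h := definable_and definable_fiber (definable_and definable_lexmin dPhi).
apply: definable_ext (definable_ex_block l h) => e.
have E z (e' := fun x : V => if x \in l then z x else e x) :
    [/\ pe e' = pe e, ve e' = ve e, ce e' = ce e & ze e' = \row_i z (inr (inl i))].
  split.
  - by apply/funext => c; rewrite /pe /e' ifF //; apply/negbTE/mapP => -[].
  - by rewrite /ve /e' ifF //; apply/negbTE/mapP => -[].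
  - by rewrite /ce /e' ifF //; apply/negbTE/mapP => -[].
  - apply/rowP => i; rewrite !mxE /e' ifT //.
    by apply/map_f; rewrite mem_enum.
split=> [[z]|[z0]].
  by have [-> -> -> ->] := E z; move=> [h1 [h2 h3]]; eexists; split; eassumption.
pose z (x : V) : R := if x is inr (inl i) then z0 ord0 i else 0.
move=> [h1 h2 h3]; exists z; have [-> -> -> ->] := E z.
by rewrite (_ : \row_i _ = z0) //; apply/rowP => i; rewrite mxE.
Qed.

(** For each level [c], the property that [Phi] at the selected point is at most [c] is definable in
    [v], so its number of switches is bounded uniformly in [p] and [c]; [variation_le] integrates
    over [c]. *)
Lemma lexmin_variation : exists N : nat, forall p (v : nat -> R) K a b,
  {homo v : s t / (s < t)%N >-> s < t} ->
  (forall s, (s <= K)%N -> fiber p (v s) !=set0) ->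
  (forall s, (s <= K)%N -> a <= Phi (fiber_env p (v s) (fiber_lexmin p (v s))) <= b) ->
  \sum_(s < K) `|Phi (fiber_env p (v s.+1) (fiber_lexmin p (v s.+1))) -
                 Phi (fiber_env p (v s) (fiber_lexmin p (v s)))| <= N%:R * (b - a).
Proof.
have [N NP] := definable_switches (inl (inr true)) definable_level.
exists N => p v K a b incv ne hab.
apply: (@variation_le _ (fun s => Phi (fiber_env p (v s) (fiber_lexmin p (v s))))) => // c.
pose e : V -> R := fun x => match x with
  | inl (inl c) => p c | inl (inr true) => 0 | inl (inr false) => c | inr _ => 0 end.
apply: leq_trans (NP e v K incv).
have E s : (s <= K)%N -> (Phi (fiber_env p (v s) (fiber_lexmin p (v s))) <= c) =
    `[< exists z, [/\ fiber (pe (upd e (inl (inr true)) (v s))) (ve (upd e (inl (inr true)) (v s))) z,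
       forall z', fiber (pe (upd e (inl (inr true)) (v s))) (ve (upd e (inl (inr true)) (v s))) z' -> lexle z z' &
      Phi (fiber_env (pe (upd e (inl (inr true)) (v s))) (ve (upd e (inl (inr true)) (v s))) z) <= ce (upd e (inl (inr true)) (v s))] >].
  move=> /ne /fiber_lexminP [h1 h2].
  rewrite /pe /ve /ce /upd /=; apply/idP/asboolP => [h|[z [z1 z2 z3]]].
    by exists (fiber_lexmin p (v s)).
  by rewrite (lexle_anti (h2 _ z1) (z2 _ h1)).
by apply: leq_switches => s sK; rewrite -!E // ltnW.
Qed.

End Selection.

(** There are at most [(switches b S).+1] maximal runs of [true], and a run spanning at most [L]
    steps has at most [L.+1] entries. The auxiliary [cur s] is the length of the run ending at
    [s]. *)
Lemma count_runs (b : nat -> bool) (S L : nat) :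
  (forall s K, (s + K <= S)%N -> (forall t, (t <= K)%N -> b (s + t)%N) -> (K <= L)%N) ->
  (\sum_(s < S.+1) b s <= (switches b S).+1 * L.+1)%N.
Proof.
move=> hL.
pose cur := fix cur s := (if b s then (if s is s'.+1 then (cur s').+1 else 1) else 0)%N.
have curP s : (s <= S)%N -> (cur s <= L.+1)%N.
  move=> sS; have [c0|c0] := posnP (cur s); first by rewrite c0.
  have curle t : (cur t <= t.+1)%N.
    by elim: t => [|t IH] /=; case: (b _).
  have curb t : forall r, (r < cur t)%N -> b (t - r)%N.
    elim: t => [|t IH] r; rewrite /=.
      by case: ifP => // bt _; rewrite sub0n.
    case: ifP => // bt; case: r => [|r]; first by rewrite subn0.
    by rewrite ltnS subSS; exact: IH.
  rewrite -(prednK c0) ltnS; apply: (hL (s - (cur s).-1)%N).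
    by rewrite subnK // -ltnS prednK.
  move=> t tK.
  have -> : (s - (cur s).-1 + t = s - ((cur s).-1 - t))%N.
    by rewrite subnBA // addnC addnBA; [rewrite addnC | rewrite -ltnS prednK].
  by apply: curb; apply: leq_ltn_trans (leq_subr _ _) _; rewrite prednK.
suff H s : (s <= S)%N -> (\sum_(i < s.+1) b i <= switches b s * L.+1 + cur s)%N.
  by apply: leq_trans (H S (leqnn _)) _; rewrite mulSn addnC leq_add2r curP.
elim: s => [_|s IH sS].
  by rewrite big_ord_recl big_ord0 /switches big_ord0 /=; case: (b 0%N).
rewrite big_ord_recr /=.
apply: leq_trans (leq_add (IH (ltnW sS)) (leqnn _)) _.
have := curP s (ltnW sS).
rewrite /switches big_ord_recr /= -/(switches b s).
have c0 : ~~ b s -> cur s = 0%N by case: (s) => [|s'] /=; case: (b _).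
case: (boolP (b s)) => [_|/c0 ->]; case: (b s.+1) => //= h.
- by rewrite addn0 -addnA addn1.
- by rewrite !addn0 mulnDl mul1n leq_add2l.
- by rewrite addn0 mulnDl mul1n -addnA leq_add2l addn1.
- by rewrite !addn0.
Qed.

(** * Near-critical values of polynomial families *)

Section PolynomialSard.
Context {R : realType} {C : finType} {m N : nat}.
Variables (Q : 'I_N -> (C + 'I_m -> R) -> R) (Gr : 'I_N -> 'I_m -> (C + 'I_m -> R) -> R).
Hypothesis polyQ : forall j, polyfun (Q j).
Hypothesis polyGr : forall j i, polyfun (Gr j i).

(** Uniform differentiability of all [Q j] on the cube of half-side [eps]: the threshold [theta]
    does not depend on the points. This is the relation between [Q] and [Gr] on which the counting
    argument rests. *)
Definition gradient_at (p : C -> R) : Prop := forall eps kappa : R, 0 < kappa ->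
  exists2 theta : R, 0 < theta & forall j (y y' : 'rV[R]_m),
    (forall i, `|y ord0 i| <= eps) -> (forall i, `|y' ord0 i| <= eps) ->
    \sum_i `|y' ord0 i - y ord0 i| <= theta ->
    `|Q j (point_env p y') - Q j (point_env p y)
      - \sum_i Gr j i (point_env p y) * (y' ord0 i - y ord0 i)|
    <= kappa * \sum_i `|y' ord0 i - y ord0 i|.

(** Approximate critical configuration: [eta1] and [eta2] absorb the Taylor errors on values and
    gradients, and [y] is the position relative to the centre of a cell. *)
Definition near_critical_value (p : C -> R) (eps eta1 eta2 v : R) : Prop :=
  exists (y : 'rV[R]_m) (lam : 'I_N -> R),
   [/\ forall i, `|y ord0 i| <= eps,
       forall j, `|v - Q j (point_env p y)| <= eta1,
       forall i, `|\sum_j lam j * Gr j i (point_env p y)| <= eta2,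
       forall j, 0 <= lam j & \sum_j lam j = 1].

(** The tolerances become three extra parameters of the formulas, so that the resulting constant [A]
    does not depend on them. *)
Let C' : finType := (C + 'I_3)%type.
Let eps_ : C' := inr (inord 0).
Let eta1_ : C' := inr (inord 1).
Let eta2_ : C' := inr (inord 2).
Let Kx : finType :=
  (bool * (('I_m + 'I_N) + ('I_m + unit)) + 'I_N)%type.
Let E : finType := (C' + unit + 'I_(m + N))%type.
Let yv (e : E -> R) : C + 'I_m -> R := fun x => match x with
  inl c => e (inl (inl (inl c))) | inr i => e (inr (lshift N i)) end.
Let lamv (e : E -> R) j := e (inr (rshift m j)).
Let sgn (b : bool) : R := (-1) ^+ b.

(** The Boolean [b] runs over the two signs needed for an absolute value, or for the equation on the
    sum of the weights. *)
Let P (k : Kx) (e : E -> R) : R :=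
  match k with
  | inl (b, inl (inl i)) => sgn b * yv e (inr i) - e (inl (inl eps_))
  | inl (b, inl (inr j)) => sgn b * (e (inl (inr tt)) - Q j (yv e)) - e (inl (inl eta1_))
  | inl (b, inr (inl i)) => sgn b * (\sum_j lamv e j * Gr j i (yv e)) - e (inl (inl eta2_))
  | inl (b, inr (inr _)) => sgn b * (\sum_j lamv e j - 1)
  | inr j => - lamv e j
  end.

Let polyfun_yv (T : (C + 'I_m -> R) -> R) : polyfun T -> polyfun (fun e => T (yv e)).
Proof.
move=> hT.
pose S (x : C + 'I_m) : E := match x with
  inl c => inl (inl (inl c)) | inr i => inr (lshift N i) end.
have := @polyfun_subst _ _ _ (fun x (e : E -> R) => e (S x)) (fun x => polyfun_var (S x)) _ hT.
by apply: polyfun_ext => e; congr T; apply/funext => -[].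
Qed.

Let polyP k : polyfun (P k).
Proof.
case: k => [[b [[i|j]|[i|u]]]|j] /=.
- apply: polyfunB; last exact: polyfun_var.
  by apply: polyfunM; [exact: polyfun_const|exact: polyfun_var].
- apply: polyfunB; last exact: polyfun_var.
  apply: polyfunM; first exact: polyfun_const.
  by apply: polyfunB; [exact: polyfun_var|exact: polyfun_yv].
- apply: polyfunB; last exact: polyfun_var.
  apply: polyfunM; first exact: polyfun_const.
  by apply: polyfun_sum => j; apply: polyfunM; [exact: polyfun_var|exact: polyfun_yv].
- apply: polyfunM; first exact: polyfun_const.
  apply: polyfunB; last exact: polyfun_const.
  by apply: polyfun_sum => j; exact: polyfun_var.
- by apply: polyfunN; exact: polyfun_var.
Qed.

Let env' (p : C -> R) (eps eta1 eta2 : R) : C' -> R := fun c => match c with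
  | inl c => p c
  | inr k => if k == inord 0 then eps else if k == inord 1 then eta1 else eta2 end.

Let sgn_norm (x c : R) : (forall b, sgn b * x - c <= 0) <-> `|x| <= c.
Proof.
rewrite ler_norml; split=> [h|/andP[h1 h2] []].
  have := h true; have := h false; rewrite /sgn expr0 expr1 => h1 h2.
  by apply/andP; split; lra.
- by rewrite /sgn expr1; lra.
- by rewrite /sgn expr0; lra.
Qed.

Let inordE : (inord 1 == inord 0 :> 'I_3 = false) /\ (inord 2 == inord 0 :> 'I_3 = false)
  /\ (inord 2 == inord 1 :> 'I_3 = false).
Proof. by rewrite -!val_eqE /= !inordK. Qed.

Let fiberP p eps eta1 eta2 v (z : 'rV[R]_(m + N)) (y := lsubmx z) (lam := fun j => z ord0 (rshift m j)) :
  fiber P (env' p eps eta1 eta2) v z <->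
   [/\ forall i, `|y ord0 i| <= eps,
       forall j, `|v - Q j (point_env p y)| <= eta1,
       forall i, `|\sum_j lam j * Gr j i (point_env p y)| <= eta2,
       forall j, 0 <= lam j & \sum_j lam j = 1].
Proof.
have [i10 [i20 i21]] := inordE.
have yE : yv (fiber_env (env' p eps eta1 eta2) v z) = point_env p y.
  by apply/funext => -[c|i] //=; rewrite /y mxE.
have h0 (x : R) : (forall b, sgn b * x <= 0) <-> x = 0.
  split=> [h|-> b]; last by rewrite mulr0.
  have := h true; have := h false; rewrite /sgn expr0 expr1; lra.
split=> [h|[h1 h2 h3 h4 h5]].
  split.
  - move=> i; apply/sgn_norm => b; have := h (inl (b, inl (inl i))).
    by rewrite /= eqxx /y mxE.
  - move=> j; apply/sgn_norm => b; have := h (inl (b, inl (inr j))).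
    by rewrite /= yE i10 eqxx.
  - move=> i; apply/sgn_norm => b; have := h (inl (b, inr (inl i))).
    by rewrite /= yE i20 i21.
  - by move=> j; have := h (inr j); rewrite /= oppr_le0.
  - apply/eqP; rewrite -subr_eq0; apply/eqP/h0 => b.
    exact: (h (inl (b, inr (inr tt)))).
case=> [[b [[i|j]|[i|u]]]|j] /=.
- by rewrite eqxx; have := (sgn_norm (y ord0 i) eps).2 (h1 i) b; rewrite /y mxE.
- by rewrite i10 eqxx yE; exact: (sgn_norm _ _).2.
- by rewrite i20 i21 yE; exact: (sgn_norm _ _).2.
- by rewrite /lamv /= h5 subrr mulr0.
- by rewrite oppr_le0; exact: h4.
Qed.

Let bounded_P p v : bounded_set (fiber P p v).
Proof.
have -> : p = env' (fun c => p (inl c)) (p eps_) (p eta1_) (p eta2_).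
  apply/funext => -[c|k] //=.
  have [->|k0] := eqVneq k (inord 0); first by [].
  have [->|k1] := eqVneq k (inord 1); first by [].
  congr (p (inr _)); apply/val_inj; move: k0 k1; rewrite -!val_eqE /= !inordK //.
  by case: k => -[|[|[|]]].
exists (Num.max (p eps_) 1); split; first exact: num_real.
move=> M hM z /fiberP [h1 _ _ h4 h5].
have M0 : 0 <= M by apply: le_trans (ltW hM); rewrite le_max ler01 orbT.
apply: rV_norm_le => // j; rewrite -[j]splitK; case: (fintype.split j) => k /=.
  apply: le_trans (ltW hM); rewrite le_max; apply/orP; left.
  by have := h1 k; rewrite mxE.
apply: le_trans (ltW hM); rewrite le_max; apply/orP; right.
rewrite ger0_norm // -h5 (bigD1 k) //= lerDl sumr_ge0 // => ? _; exact: h4.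
Qed.

(** Along a run of near-critical grid values, [h] is the [lam]-average of the increments of [D j]
    plus that of the increments of [Q j]. The former add up to at most the variation of the [D j],
    of order [eta1]; the latter are bounded by [eta2] times the displacement of the selected [y],
    whose total is of order [eps]. First-order remainders go into [kappa]. *)
Lemma near_critical_run : exists2 A : R, 0 <= A & forall p eps eta1 eta2 kappa,
  gradient_at p -> 0 <= eps -> 0 <= eta1 -> 0 <= eta2 -> 0 < kappa ->
  exists2 h0 : R, 0 < h0 & forall h, 0 < h < h0 -> forall a K,
   (forall s : nat, (s <= K)%N -> near_critical_value p eps eta1 eta2 (a + s%:R * h)) ->
   K%:R * h <= A * (eta1 + eta2 * eps) + kappa.
Proof.
have /choice[Ny NyP] : forall i, exists n : nat, forall p (v : nat -> R) K a b,
    {homo v : s t / (s < t)%N >-> s < t} ->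
    (forall s, (s <= K)%N -> fiber P p (v s) !=set0) ->
    (forall s, (s <= K)%N -> a <= lsubmx (fiber_lexmin P p (v s)) ord0 i <= b) ->
    \sum_(s < K) `|lsubmx (fiber_lexmin P p (v s.+1)) ord0 i -
                   lsubmx (fiber_lexmin P p (v s)) ord0 i| <= n%:R * (b - a).
  move=> i.
  have [n nP] := lexmin_variation polyP bounded_P
    (polyfun_var (inr (lshift N i) : C' + unit + 'I_(m + N))).
  exists n => p v K a b iv ne hab.
  under eq_bigr do rewrite !mxE.
  by apply: nP => // s sK; have := hab s sK; rewrite mxE.
pose yz (x : C + 'I_m) : C' + unit + 'I_(m + N) := match x with
  inl c => inl (inl (inl c)) | inr i => inr (lshift N i) end.
have /choice[ND NDP] : forall j, exists n : nat, forall p (v : nat -> R) K a b,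
    {homo v : s t / (s < t)%N >-> s < t} ->
    (forall s, (s <= K)%N -> fiber P p (v s) !=set0) ->
    let D s := let y := point_env (fun c => p (inl c)) (lsubmx (fiber_lexmin P p (v s))) in
      v s - Q j y in
    (forall s, (s <= K)%N -> a <= D s <= b) ->
    \sum_(s < K) `|D s.+1 - D s| <= n%:R * (b - a).
  move=> j.
  have hD : polyfun (fun e : C' + unit + 'I_(m + N) -> R =>
      e (inl (inr tt)) - Q j (fun x => e (yz x))).
    apply: polyfunB; first exact: polyfun_var.
    by apply: (@polyfun_subst _ _ _ (fun x e => e (yz x)) (fun x => polyfun_var (yz x))).
  have [n nP] := lexmin_variation polyP bounded_P hD.
  exists n => p v K a b iv ne D hab.
  have DE s : D s = (fun e : C' + unit + 'I_(m + N) -> R =>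
      e (inl (inr tt)) - Q j (fun x => e (yz x))) (fiber_env p (v s) (fiber_lexmin P p (v s))).
    rewrite /D /=.
    have -> // : (fun x => fiber_env p (v s) (fiber_lexmin P p (v s)) (yz x)) =
      point_env (fun c => p (inl c)) (lsubmx (fiber_lexmin P p (v s))).
    by apply/funext => -[c|i] //=; rewrite mxE.
  under eq_bigr do rewrite !DE.
  by apply: nP => // s sK; have := hab s sK; rewrite DE.
pose Ay : R := \sum_i (Ny i)%:R * 2; pose AD : R := \sum_j (ND j)%:R * 2.
have Ay0 : 0 <= Ay by apply: sumr_ge0 => i _; rewrite mulr_ge0.
have AD0 : 0 <= AD by apply: sumr_ge0 => i _; rewrite mulr_ge0.
exists (Ay + AD) => [|p eps eta1 eta2 kappa Gr_diff eps0 eta10 eta20 kappa0]; first exact: addr_ge0.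
have Aeps : 0 <= Ay * eps by rewrite mulr_ge0.
(* The remainder occurs twice, in [k' * d s] and in [(eta2 + k') * d s]; summed, it costs
   [2 * k' * (Ay * eps)], which is below [kappa]. *)
pose k' := kappa / (2 * (Ay * eps + 1)).
have k'0 : 0 < k' by rewrite divr_gt0 // mulr_gt0 // ltr_wpDl.
have [theta theta0 hth] := Gr_diff eps _ k'0.
(* Below this threshold on [h], a displacement exceeding [theta] already gives [h <= k' * d s], so
   the expansion is needed for small displacements only. *)
exists (k' * theta) => [|h /andP[h0 hh] a K crit]; first exact: mulr_gt0.
pose p' := env' p eps eta1 eta2; pose v (s : nat) := a + s%:R * h.
have incv : {homo v : s t / (s < t)%N >-> s < t}.
  by move=> s t st; rewrite /v ltrD2l ltr_pM2r // ltr_nat.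
have ne s : (s <= K)%N -> fiber P p' (v s) !=set0.
  move=> /crit [y [lam H]]; exists (row_mx y (\row_j lam j)).
  apply/fiberP; rewrite row_mxKl; case: H => h1 h2 h3 h4 h5.
  split=> //.
  - by move=> i; under eq_bigr do rewrite row_mxEr mxE; exact: h3.
  - by move=> j; rewrite row_mxEr mxE.
  - by under eq_bigr do rewrite row_mxEr mxE.
pose z s := fiber_lexmin P p' (v s); pose y s : 'rV[R]_m := lsubmx (z s).
pose lam s j := z s ord0 (rshift m j).
have zP s : (s <= K)%N -> [/\ forall i, `|y s ord0 i| <= eps,
       forall j, `|v s - Q j (point_env p (y s))| <= eta1,
       forall i, `|\sum_j lam s j * Gr j i (point_env p (y s))| <= eta2,
       forall j, 0 <= lam s j & \sum_j lam s j = 1].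
  by move=> /ne /(fiber_lexminP polyP bounded_P) [/fiberP].
pose D j s := v s - Q j (point_env p (y s)).
pose d s := \sum_i `|y s.+1 ord0 i - y s ord0 i|.
have sumd : \sum_(s < K) d s <= Ay * eps.
  rewrite exchange_big /= mulr_suml; apply: ler_sum => i _.
  apply: le_trans (NyP i p' v K (- eps) eps incv ne _) _; last by lra.
  by move=> s /zP[h1 _ _ _ _]; have := h1 i; rewrite ler_norml.
have sumD : \sum_(s < K) \sum_j `|D j s.+1 - D j s| <= AD * eta1.
  rewrite exchange_big /= mulr_suml; apply: ler_sum => j _.
  apply: le_trans (NDP j p' v K (- eta1) eta1 incv ne _) _; last by lra.
  by move=> s /zP[_ h2 _ _ _]; have := h2 j; rewrite ler_norml.
have d0 s : 0 <= d s by apply: sumr_ge0.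
have step s : (s < K)%N ->
    h <= k' * d s + \sum_j `|D j s.+1 - D j s| + (eta2 + k') * d s.
  move=> sK; have [a1 a2 a3 a4 a5] := zP s (ltnW sK).
  have [b1 b2 b3 b4 b5] := zP s.+1 sK.
  have sD0 : 0 <= \sum_j `|D j s.+1 - D j s| by apply: sumr_ge0.
  have [ds|ds] := leP (d s) theta; last first.
    have : h <= k' * d s.
      by apply: le_trans (ltW hh) _; rewrite ler_wpM2l // ltW.
    have : 0 <= (eta2 + k') * d s by rewrite mulr_ge0 // addr_ge0 // ltW.
    lra.
  have hE : h = \sum_j lam s j * (D j s.+1 - D j s) +
     \sum_j lam s j * (Q j (point_env p (y s.+1)) - Q j (point_env p (y s))).
    have -> : h = v s.+1 - v s by rewrite /v -natr1; lra.
    rewrite -big_split /=.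
    rewrite -[LHS]mul1r -a5 mulr_suml; apply: eq_bigr => j _.
    by rewrite -mulrDr; congr (_ * _); rewrite /D; lra.
  have F1 : \sum_j lam s j * (D j s.+1 - D j s) <= \sum_j `|D j s.+1 - D j s|.
    apply: ler_sum => j _.
    have l1 : lam s j <= 1.
      by rewrite -a5 (bigD1 j) //= lerDl sumr_ge0.
    apply: le_trans (ler_norm _) _; rewrite normrM (ger0_norm (a4 j)).
    by rewrite ler_piMl.
  have F2 : \sum_j lam s j * (Q j (point_env p (y s.+1)) - Q j (point_env p (y s)))
     <= k' * d s + \sum_j lam s j * \sum_i Gr j i (point_env p (y s)) * (y s.+1 ord0 i - y s ord0 i).
    rewrite -[k' * d s]mul1r -a5 mulr_suml -big_split /=; apply: ler_sum => j _.
    rewrite -mulrDr ler_wpM2l // -lerBlDr.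
    by apply: le_trans (ler_norm _) _; apply: hth.
  have F3 : \sum_j lam s j * \sum_i Gr j i (point_env p (y s)) * (y s.+1 ord0 i - y s ord0 i)
     <= eta2 * d s.
    under eq_bigr do rewrite mulr_sumr.
    rewrite exchange_big /= mulr_sumr; apply: ler_sum => i _.
    under eq_bigr do rewrite mulrA.
    rewrite -mulr_suml; apply: le_trans (ler_norm _) _; rewrite normrM.
    by rewrite ler_wpM2r.
  have : 0 <= k' * d s by rewrite mulr_ge0 // ltW.
  lra.
have : \sum_(s < K) h <=
    \sum_(s < K) (k' * d s + \sum_j `|D j s.+1 - D j s| + (eta2 + k') * d s).
  by apply: ler_sum => s _; exact: step.
rewrite sumr_const card_ord -mulr_natl !big_split /= -!mulr_sumr => H.
have k'E : k' * (2 * (Ay * eps + 1)) = kappa.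
  by rewrite /k' divfK // mulf_neq0 // ?gt_eqF // ltr_wpDl.
have T1 : k' * (\sum_(s < K) d s) <= k' * (Ay * eps) by rewrite ler_wpM2l // ltW.
have T2 : (eta2 + k') * (\sum_(s < K) d s) <= (eta2 + k') * (Ay * eps).
  by rewrite ler_wpM2l // addr_ge0 // ltW.
have T3 : 0 <= Ay * eta1 by rewrite mulr_ge0.
have T4 : 0 <= AD * (eta2 * eps) by rewrite !mulr_ge0.
nra.
Qed.

(** Non-emptiness of the fibre switches at most [Nf] times, so the near-critical grid values form at
    most [Nf.+1] runs, each bounded by [near_critical_run]. *)
Lemma near_critical_count : exists2 A : R, 0 <= A & forall p eps eta1 eta2 kappa,
  gradient_at p -> 0 <= eps -> 0 <= eta1 -> 0 <= eta2 -> 0 < kappa ->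
  exists2 h0 : R, 0 < h0 & forall h, 0 < h < h0 -> forall a S,
   h * (\sum_(s < S.+1) `[< near_critical_value p eps eta1 eta2 (a + s%:R * h) >])%:R
   <= A * (eta1 + eta2 * eps) + kappa.
Proof.
have [A A0 hA] := near_critical_run; have [Nf NfP] := fiber_switches polyP.
have N1 : 0 < Nf.+1%:R :> R by rewrite ltr0n.
exists (Nf.+1%:R * A) => [|p eps eta1 eta2 kappa Gr_diff eps0 eta10 eta20 kappa0].
  by rewrite mulr_ge0.
(* Each of the [Nf.+1] runs costs two terms [k]: the error in the run bound, and one extra grid
   point, of weight [h < k]. *)
pose k := kappa / (2 * Nf.+1%:R).
have k0 : 0 < k by rewrite divr_gt0 // mulr_gt0.
have kE : kappa = 2 * Nf.+1%:R * k by rewrite /k mulrC divfK // mulf_neq0 // gt_eqF.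
have [h1 h10 h1P] := hA p eps eta1 eta2 k Gr_diff eps0 eta10 eta20 k0.
exists (Num.min h1 k) => [|h /andP[h0]]; first by rewrite lt_min h10.
rewrite lt_min => /andP[hh1 hk] a S.
pose b (s : nat) := `[< near_critical_value p eps eta1 eta2 (a + s%:R * h) >].
rewrite -[X in h * X%:R]/(\sum_(s < S.+1) b s)%N.
set X := eta1 + eta2 * eps; pose B := A * X + k.
have X0 : 0 <= X by rewrite addr_ge0 // mulr_ge0.
have B0 : 0 <= B by rewrite addr_ge0 ?mulr_ge0 // ltW.
pose L := Num.truncn (B / h).
have LB : L%:R * h <= B.
  by rewrite -ler_pdivlMr // truncn_le // divr_ge0 // ltW.
have hc : (\sum_(s < S.+1) b s <= (switches b S).+1 * L.+1)%N.
  apply: count_runs => s K _ hb.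
  have Bh : 0 <= B / h by rewrite divr_ge0 // ltW.
  rewrite truncn_ge_nat // ler_pdivlMr //.
  apply: (h1P h _ (a + s%:R * h)); first by rewrite h0.
  move=> t tK; have /asboolP := hb t tK; rewrite natrD.
  by congr near_critical_value; lra.
have hs : (switches b S <= Nf)%N.
  pose v (s : nat) := a + s%:R * h.
  have incv : {homo v : s t / (s < t)%N >-> s < t}.
    by move=> s t st; rewrite /v ltrD2l ltr_pM2r // ltr_nat.
  apply: leq_trans (NfP (env' p eps eta1 eta2) v S incv).
  suff bE s : b s = `[< fiber P (env' p eps eta1 eta2) (v s) !=set0 >].
    by apply: leq_switches => s _; rewrite !bE.
  apply/asbool_equiv_eq; split=> [[y [lam [c1 c2 c3 c4 c5]]]|[z /fiberP H]].
    exists (row_mx y (\row_j lam j)); apply/fiberP; rewrite row_mxKl.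
    split=> //.
    - by move=> i; under eq_bigr do rewrite row_mxEr mxE; exact: c3.
    - by move=> j; rewrite row_mxEr mxE.
    - by under eq_bigr do rewrite row_mxEr mxE.
  by exists (lsubmx z), (fun j => z ord0 (rshift m j)).
have : (\sum_(s < S.+1) b s)%:R <= Nf.+1%:R * L.+1%:R :> R.
  rewrite -natrM ler_nat; apply: leq_trans hc _.
  by rewrite leq_mul2r ltnS hs orbT.
move=> H; have := ler_wpM2l (ltW h0) H.
rewrite -[L.+1%:R]natr1 => H2.
have H3 : Nf.+1%:R * (L%:R * h) <= Nf.+1%:R * B by rewrite ler_wpM2l // ltW.
have H4 : Nf.+1%:R * h <= Nf.+1%:R * k by rewrite ler_wpM2l // ltW.
rewrite kE; rewrite /B in H3; nra.
Qed.

End PolynomialSard.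

(** * Taylor expansions *)

Section LineCalculus.
Context {R : realType} {m : nat}.
Implicit Types (g : 'rV[R]_m -> R) (x y v : 'rV[R]_m).

Definition partial g (i : 'I_m) x : R := gradient g x ord0 i.

(** Differentiability along straight lines only: enough for the mean value theorem, stable under
    translations and differences, and shared by smooth functions and their Taylor polynomials. *)
Definition line_gradient g (G : 'I_m -> 'rV[R]_m -> R) : Prop :=
  forall x v (t : R), is_derive t 1 (fun s : R => g (x + s *: v))
    (\sum_i v ord0 i * G i (x + t *: v)).

Lemma deriveE_sum g x v : differentiable g x ->
  'D_v g x = \sum_i v ord0 i * partial g i x.
Proof.
move=> dg; rewrite deriveE // {1}[v]row_sum_delta linear_sum.
by apply: eq_bigr => i _; rewrite linearZ /partial /gradient mxE deriveE.
Qed.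

Lemma line_gradient_partial g : (forall x, differentiable g x) ->
  line_gradient g (partial g).
Proof.
move=> dg x v t.
have E : (fun h : R => h^-1 *: (g (x + (h *: (1 : R) + t) *: v) - g (x + t *: v))) =
  (fun h : R => h^-1 *: (g (h *: v + (x + t *: v)) - g (x + t *: v))).
  apply/funext => h; congr (_ *: (g _ - _)).
  by rewrite [h *: 1]mulr1 scalerDl addrCA.
have dv : derivable g (x + t *: v) v by exact: diff_derivable.
apply: DeriveDef.
  by rewrite /derivable E.
by rewrite -(deriveE_sum v (dg (x + t *: v))) /derive E.
Qed.

Lemma line_gradient_mvt g G x y : line_gradient g G ->
  exists2 t : R, 0 <= t <= 1 &
    g y - g x = \sum_i (y ord0 i - x ord0 i) * G i (x + t *: (y - x)).
Proof.
move=> hg; have h t := hg x (y - x) t.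
have := @MVT_segment R (fun s => g (x + s *: (y - x)))
  (fun t => \sum_i (y - x) ord0 i * G i (x + t *: (y - x))) 0 1 ler01 (fun t _ => h t).
case=> [|t].
- apply: derivable_within_continuous => t _.
  by have [] := h t.
- rewrite in_itv /= => t01.
  rewrite scale1r scale0r addr0 [x + _]addrC subrK subr0 mulr1 => ->.
  by exists t => //; apply: eq_bigr => i _; rewrite !mxE.
Qed.

Lemma line_gradient_approx g G x y (a : 'I_m -> R) (k : R) : line_gradient g G ->
  (forall t i, 0 <= t <= 1 -> `|G i (x + t *: (y - x)) - a i| <= k) ->
  `|g y - g x - \sum_i a i * (y ord0 i - x ord0 i)| <=
  k * \sum_i `|y ord0 i - x ord0 i|.
Proof.
move=> hg hk; have [t t01 ->] := line_gradient_mvt x y hg.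
rewrite -sumrB mulr_sumr; apply: le_trans (ler_norm_sum _ _ _) _.
apply: ler_sum => i _.
by rewrite [a i * _]mulrC -mulrBr normrM mulrC ler_wpM2r // hk.
Qed.

Lemma line_gradientB g h G H : line_gradient g G -> line_gradient h H ->
  line_gradient (fun x => g x - h x) (fun i x => G i x - H i x).
Proof.
move=> hg hh x v t.
apply: is_derive_eq (is_deriveB (hg x v t) (hh x v t)) _.
by rewrite -sumrB; apply: eq_bigr => i _; rewrite mulrBr.
Qed.

Lemma line_gradient_shift g G c : line_gradient g G ->
  line_gradient (fun x => g (c + x)) (fun i x => G i (c + x)).
Proof.
move=> hg x v t; have := hg (c + x) v t.
under eq_bigr do rewrite -addrA.
by have -> : (fun s : R => g (c + x + s *: v)) = (fun s => g (c + (x + s *: v)))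
  by apply/funext => s; rewrite addrA.
Qed.

(* Both mixed derivatives are limits of the same second difference quotient. *)
Lemma partialC g i j x : is_Ck 2 g ->
  partial (partial g i) j x = partial (partial g j) i x.
Proof.
move=> [dg c1].
have dd k y : differentiable (partial g k) y by have [] := c1 k.
have cc k l : continuous (partial (partial g k) l) by have [_] := c1 k; apply.
pose e (k : 'I_m) : 'rV[R]_m := delta_mx ord0 k.
have coord k l : e k ord0 l = (l == k)%:R by rewrite /e mxE eqxx.
have sum_e k (F : 'I_m -> R) : \sum_l e k ord0 l * F l = F k.
  rewrite (bigD1 k) //= coord eqxx mul1r big1 ?addr0 // => l lk.
  by rewrite coord (negbTE lk) mul0r.
have line (f : 'rV[R]_m -> R) G y k h : line_gradient f G -> exists2 t, 0 <= t <= 1 &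
    f (y + h *: e k) - f y = h * G k (y + (t * h) *: e k).
  move=> hf; have [t t01 E] := line_gradient_mvt y (y + h *: e k) hf.
  exists t => //; rewrite E addrAC subrr add0r scalerA -(sum_e k (fun i => G i (y + (t * h) *: e k))) mulr_sumr.
  apply: eq_bigr => l _; rewrite mulrA; congr (_ * _).
  have -> : (y + h *: e k) ord0 l = y ord0 l + h * e k ord0 l by rewrite !mxE.
  by rewrite addrAC subrr add0r.
have ne k : `|e k| <= 1.
  by apply: rV_norm_le => // l; rewrite coord; case: eqP; rewrite ?normr1 ?normr0.
have key k l h : 0 < h -> exists2 z, `|z - x| <= 2 * h &
    (g (x + h *: e k + h *: e l) - g (x + h *: e k)) - (g (x + h *: e l) - g x)
    = h ^+ 2 * partial (partial g k) l z.
  move=> h0.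
  have hg := line_gradient_partial dg.
  have hs := line_gradientB (line_gradient_shift (h *: e l) hg) hg.
  have [t /andP[t0 t1] E1] := line _ _ x k h hs.
  have [s /andP[s0 s1] E2] := line _ _ (x + (t * h) *: e k) l h (line_gradient_partial (dd k)).
  exists (x + (t * h) *: e k + (s * h) *: e l).
    rewrite addrAC [x + _ - x]addrAC subrr add0r.
    apply: le_trans (ler_normD _ _) _; rewrite normrZ [X in _ + X]normrZ.
    have A1 : `|t * h| * `|e k| <= h.
      rewrite normrM (ger0_norm t0) (gtr0_norm h0).
      by apply: le_trans (ler_piMr _ (ne k)) _; [rewrite mulr_ge0 // ltW|rewrite ler_piMl // ltW].
    have A2 : `|s * h| * `|e l| <= h.
      rewrite normrM (ger0_norm s0) (gtr0_norm h0).
      by apply: le_trans (ler_piMr _ (ne l)) _; [rewrite mulr_ge0 // ltW|rewrite ler_piMl // ltW].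
    by apply: le_trans (lerD A1 A2) _; lra.
  rewrite expr2 -mulrA -E2.
  have -> : partial g k (x + (t * h) *: e k + h *: e l) =
    partial g k (h *: e l + (x + (t * h) *: e k)) by rewrite addrC.
  by rewrite -E1 [h *: e l + (_ + _)]addrC [h *: e l + x]addrC; lra.
apply/eqP; rewrite -subr_eq0 -normr_le0; apply/ler_addgt0Pl => d d0; rewrite addr0.
have [r1 r10 H1] : exists2 r : R, 0 < r & forall z, `|z - x| < r ->
    `|partial (partial g i) j x - partial (partial g i) j z| < d / 2.
  have /cvgrPdist_lt /(_ (d / 2)) := cc i j x.
  rewrite divr_gt0 // => /(_ isT) /nbhs_ballP[r /= r0 hr].
  by exists r => // z zx; apply: hr; rewrite -ball_normE /= distrC.
have [r2 r20 H2] : exists2 r : R, 0 < r & forall z, `|z - x| < r ->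
    `|partial (partial g j) i x - partial (partial g j) i z| < d / 2.
  have /cvgrPdist_lt /(_ (d / 2)) := cc j i x.
  rewrite divr_gt0 // => /(_ isT) /nbhs_ballP[r /= r0 hr].
  by exists r => // z zx; apply: hr; rewrite -ball_normE /= distrC.
pose h := Num.min r1 r2 / 4.
have h0 : 0 < h by rewrite divr_gt0 // lt_min r10.
have hr1 : 2 * h < r1.
  have : Num.min r1 r2 <= r1 by rewrite ge_min lexx.
  rewrite /h; lra.
have hr2 : 2 * h < r2.
  have : Num.min r1 r2 <= r2 by rewrite ge_min lexx orbT.
  rewrite /h; lra.
have [z1 z1x E1] := key i j h h0; have [z2 z2x E2] := key j i h h0.
have E : partial (partial g i) j z1 = partial (partial g j) i z2.
  have h20 : h ^+ 2 != 0 by rewrite expf_neq0 // gt_eqF.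
  apply: (mulfI h20); rewrite -E1 -E2 [x + h *: e j + _]addrAC; lra.
have := H1 z1 (le_lt_trans z1x hr1); have := H2 z2 (le_lt_trans z2x hr2).
rewrite E; move: (partial (partial g j) i z2) (partial (partial g j) i x) => a b.
move: (partial (partial g i) j x) => c hb hc.
apply: le_trans (ler_distD a c b) _; apply/ltW; rewrite [`|a - b|]distrC.
by rewrite [ltRHS]splitr ltrD.
Qed.

End LineCalculus.

Section Taylor.
Context {R : realType} {m : nat}.
Implicit Types (g : 'rV[R]_m -> R) (x y v : 'rV[R]_m) (c : seq 'I_m -> R).

(** Sum over ordered words of length [l] with one coefficient per word: no multinomial coefficients
    occur, and differentiation removes a letter. *)
Fixpoint hpoly (l : nat) c y : R :=
  if l is l'.+1 then \sum_i y ord0 i * hpoly l' (fun I => c (i :: I)) y else c [::].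

Definition tpoly (k : nat) c y : R := \sum_(l < k.+1) (l`!)%:R^-1 * hpoly l c y.

Definition symmetric_coef (l : nat) c : Prop := forall I i j J,
  size (I ++ i :: j :: J) = l -> c (I ++ i :: j :: J) = c (I ++ j :: i :: J).

Lemma eq_hpoly l c c' y : (forall I, size I = l -> c I = c' I) ->
  hpoly l c y = hpoly l c' y.
Proof.
elim: l c c' => [|l IH] c c' h /=; first exact: h.
by apply: eq_bigr => i _; congr (_ * _); apply: IH => I sI; apply: h; rewrite /= sI.
Qed.

Lemma eq_tpoly k c c' y : (forall I, (size I <= k)%N -> c I = c' I) ->
  tpoly k c y = tpoly k c' y.
Proof.
move=> h; apply: eq_bigr => l _; congr (_ * _); apply: eq_hpoly => I sI.
by apply: h; rewrite sI -ltnS.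
Qed.

(** By the product rule either the first letter is differentiated or, by induction, one of the
    others; symmetry brings the latter to the front, so that all [l] contributions coincide. *)
Lemma hpoly_line_gradient l c : symmetric_coef l c ->
  line_gradient (hpoly l c) (fun i y => l%:R * hpoly l.-1 (fun I => c (i :: I)) y).
Proof.
elim: l c => [|l IH] c sc x v t /=.
  apply: is_derive_eq (is_derive_cst _ _ _) _.
  by rewrite big1 // => i _; rewrite mul0r mulr0.
have sci i : symmetric_coef l (fun I => c (i :: I)).
  by move=> I i' j J h; apply: (sc (i :: I)); rewrite /= h.
have dx i : is_derive t 1 (fun s : R => (x + s *: v) ord0 i) (v ord0 i).
  have -> : (fun s : R => (x + s *: v) ord0 i) = cst (x ord0 i) + (v ord0 i \*: id).
    by apply/funext => s; rewrite !mxE /= mulrC.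
  by apply: is_derive_eq; rewrite add0r; exact: mulr1.
have := is_derive_sum (fun i => is_deriveM (dx i) (IH _ (sci i) x v t)).
set F := \sum_i _.
have -> : F = (fun s : R => \sum_i (x + s *: v) ord0 i * hpoly l (fun I => c (i :: I)) (x + s *: v)).
  by apply/funext => s; rewrite /F fct_sumE.
move=> H; apply: is_derive_eq H _.
set X := x + t *: v; rewrite big_split /=.
have -> : \sum_i X ord0 i *: (\sum_j v ord0 j * (l%:R * hpoly l.-1 (fun I => c (i :: j :: I)) X))
   = \sum_j v ord0 j * (l%:R * hpoly l (fun I => c (j :: I)) X).
  case: l IH sc {sci F} => [|l] _ sc.
    rewrite !big1 // => j _; first by rewrite mul0r mulr0.
    by rewrite big1 ?scaler0 // => k _; rewrite mul0r mulr0.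
  under eq_bigr do rewrite scaler_sumr.
  rewrite exchange_big; apply: eq_bigr => j _ /=.
  rewrite !mulr_sumr; apply: eq_bigr => i _.
  rewrite (@eq_hpoly _ _ (fun I => c (j :: i :: I))) => [|I sI].
    by rewrite [LHS]mulrCA; congr (_ * _); rewrite mulrCA.
  by apply: (sc [::]); rewrite /= sI.
rewrite -big_split /=; apply: eq_bigr => i _.
rewrite -[l.+1%:R]natr1 mulrDl mul1r mulrDr; congr (_ + _).
by rewrite [LHS]mulrC.
Qed.

Lemma tpoly_line_gradient k c : (forall l, (l <= k.+1)%N -> symmetric_coef l c) ->
  line_gradient (tpoly k.+1 c) (fun i => tpoly k (fun I => c (i :: I))).
Proof.
move=> sc x v t.
have h (l : 'I_k.+2) := is_deriveZ ((l`!)%:R^-1 : R)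
   (hpoly_line_gradient (sc l (ltn_ord l)) x v t).
have := is_derive_sum h.
set F := \sum_i _.
have -> : F = (fun s : R => tpoly k.+1 c (x + s *: v)).
  by apply/funext => s; rewrite /F fct_sumE.
move=> H; apply: is_derive_eq H _.
under eq_bigr do rewrite scaler_sumr.
rewrite exchange_big; apply: eq_bigr => i _ /=.
rewrite big_ord_recl /= mul0r mulr0 scaler0 add0r mulr_sumr.
apply: eq_bigr => l _; rewrite [LHS]mulrCA; congr (_ * _).
rewrite /bump /= add1n factS natrM invfM mulrA; congr (_ * _).
by rewrite mulrAC mulVf ?mul1r // pnatr_eq0.
Qed.

Lemma is_CkW k g : is_Ck k.+1 g -> is_Ck k g.
Proof.
elim: k g => [|k IH] g /=; last first.
  by move=> [h1 h2]; split=> // i; apply: IH; exact: h2.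
by move=> [dg _] x; exact: differentiable_continuous.
Qed.

Lemma is_Ck_le k l g : (l <= k)%N -> is_Ck k g -> is_Ck l g.
Proof.
elim: k => [|k IH]; first by rewrite leqn0 => /eqP ->.
rewrite leq_eqVlt => /orP[/eqP -> //|]; rewrite ltnS => /IH h /is_CkW; exact: h.
Qed.

Lemma is_Cp_Ck p k g : le_smoothness k p -> is_Cp p g -> is_Ck k g.
Proof. by case: p => [q|] /= kq h; [exact: is_Ck_le h|exact: h]. Qed.

Fixpoint dword g (I : seq 'I_m) : 'rV[R]_m -> R :=
  if I is i :: I' then dword (partial g i) I' else g.

Definition jet g x : seq 'I_m -> R := fun I => dword g I x.

Lemma dword_cat g I I' : dword g (I ++ I') = dword (dword g I) I'.
Proof. by elim: I g => //= i I IH g; rewrite IH. Qed.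

Lemma is_Ck_dword k g I : is_Ck (size I + k) g -> is_Ck k (dword g I).
Proof. by elim: I g => //= i I IH g [_ h]; apply: IH; exact: h. Qed.

Lemma symmetric_jet k g x l : is_Ck k g -> (l <= k)%N -> symmetric_coef l (jet g x).
Proof.
move=> Ckg lk I i j J sl; rewrite /jet !dword_cat /=; congr (dword _ J x).
apply/funext => y; apply: partialC; apply: is_Ck_dword; apply: is_Ck_le Ckg.
by apply: leq_trans lk; rewrite -sl size_cat leq_add2l.
Qed.

(** The gradient of the remainder consists of the remainders of the partial derivatives at one order
    less, so the mean value inequality on the segment from 0 gains a factor [m * eps] at each step.
    Only the oscillation [w] of the derivatives of order [k] enters, which gives o(eps^k) for a
    merely C^k function. *)
Lemma taylor_bound k g x (eps w : R) : is_Ck k g -> 0 <= eps -> 0 <= w ->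
  (forall I y, size I = k -> (forall i, `|y ord0 i| <= eps) ->
     `|dword g I (x + y) - dword g I x| <= w) ->
  forall y, (forall i, `|y ord0 i| <= eps) ->
    `|g (x + y) - tpoly k (jet g x) y| <= (m%:R * eps) ^+ k * w.
Proof.
move=> + eps0 w0; elim: k g => [|k IH] g Ckg hw y hy.
  rewrite expr0 mul1r /tpoly big_ord_recl big_ord0 /= fact0 invr1 mul1r addr0.
  exact: (hw [::]).
have hg := line_gradient_shift x (line_gradient_partial Ckg.1).
have ht := tpoly_line_gradient (fun l lk => symmetric_jet x Ckg lk).
have hG := line_gradientB hg ht.
have H := @line_gradient_approx _ _ _ _ 0 y (fun=> 0) ((m%:R * eps) ^+ k * w) hG.
have {}H := H _.
have T0 : tpoly k.+1 (jet g x) 0 = g x.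
  rewrite /tpoly big_ord_recl /= fact0 invr1 mul1r big1 ?addr0 //.
  by move=> l _; rewrite big1 ?mulr0 // => i _; rewrite mxE mul0r.
move: H; rewrite addr0 T0 subrr subr0.
rewrite [X in `|_ - X|]big1 ?subr0; last by move=> i _; rewrite mul0r.
move=> H; apply: le_trans (H _) _; last first.
  rewrite exprSr -[leRHS]mulrA [m%:R * eps * w]mulrC [leRHS]mulrA.
  apply: ler_wpM2l; first by rewrite mulr_ge0 // exprn_ge0 // mulr_ge0.
  apply: le_trans (_ : \sum_(i < m) eps <= _); last by rewrite sumr_const card_ord mulr_natl.
  by apply: ler_sum => i _; rewrite mxE subr0; exact: hy.
move=> t i /andP[t0 t1]; rewrite ?subr0 ?add0r ?subr0.
apply: IH; first exact: (Ckg.2 i).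
  by move=> I z sI hz; apply: (hw (i :: I)) => //=; rewrite sI.
move=> j; rewrite mxE normrM (ger0_norm t0).
by apply: le_trans (hy j); rewrite ler_piMl.
Qed.

Lemma polyfun_hpoly (V : finType) l (c : seq 'I_m -> (V -> R) -> R) (y : 'I_m -> V) :
  (forall I, polyfun (c I)) ->
  polyfun (fun e => hpoly l (fun I => c I e) (\row_i e (y i))).
Proof.
elim: l c => [|l IH] c hc /=; first exact: hc.
apply: polyfun_sum => i; apply: polyfunM; last exact: (IH (fun I => c (i :: I))).
by apply: polyfun_ext (polyfun_var (y i)) => e; rewrite mxE.
Qed.

Lemma polyfun_tpoly (V : finType) k (c : seq 'I_m -> (V -> R) -> R) (y : 'I_m -> V) :
  (forall I, polyfun (c I)) ->
  polyfun (fun e => tpoly k (fun I => c I e) (\row_i e (y i))).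
Proof.
move=> hc; apply: polyfun_sum => l; apply: polyfunM; first exact: polyfun_const.
exact: polyfun_hpoly.
Qed.

End Taylor.

(** * Sard's theorem for selections of smooth functions *)

Section Sard.
Context {R : realType} {m' N : nat}.
Let m := m'.+1.
Variable g : 'I_N -> 'rV[R]_m -> R.
Hypothesis Ckg : forall j, is_Ck m (g j).

(** [sigma] lists the branches meeting at [x], with repetitions allowed; repeating an active branch
    keeps the number [N] of functions fixed. *)
Definition critical_config (sigma : 'I_N -> 'I_N) (x : 'rV[R]_m) (v : R) : Prop :=
  (forall j, g (sigma j) x = v) /\
  exists lam : 'I_N -> R, [/\ forall j, 0 <= lam j, \sum_j lam j = 1 &
    forall i, \sum_j lam j * partial (g (sigma j)) i x = 0].

Let W : finType := {bseq m of 'I_m}.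
Let C : finType := ('I_N * W)%type.
(** The Taylor coefficients up to order [m] are the parameters, indexed by words of length at most
    [m]; longer words collapse to the empty one and are never read. *)
Let code (I : seq 'I_m) : W := insubd (nil_bseq m 'I_m) I.
Let codeK I : (size I <= m)%N -> val (code I) = I.
Proof. by move=> sI; rewrite insubdK. Qed.

Let Q (sigma : 'I_N -> 'I_N) (j : 'I_N) (e : C + 'I_m -> R) : R :=
  tpoly m (fun I => e (inl (sigma j, code I))) (\row_i e (inr i)).
Let Gr (sigma : 'I_N -> 'I_N) (j : 'I_N) (i : 'I_m) (e : C + 'I_m -> R) : R :=
  tpoly m' (fun I => e (inl (sigma j, code (i :: I)))) (\row_i e (inr i)).
Let par (x : 'rV[R]_m) : C -> R := fun c => jet (g c.1) x (val c.2).

Let polyQ sigma j : polyfun (Q sigma j).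
Proof. by apply: polyfun_tpoly => I; exact: polyfun_var. Qed.

Let polyGr sigma j i : polyfun (Gr sigma j i).
Proof. by apply: polyfun_tpoly => I; exact: polyfun_var. Qed.

Let rowE p (y : 'rV[R]_m) : (\row_i (@point_env R C m p y) (inr i)) = y.
Proof. by apply/rowP => i; rewrite mxE. Qed.

Let QE sigma j x y : Q sigma j (point_env (par x) y) = tpoly m (jet (g (sigma j)) x) y.
Proof.
rewrite /Q rowE; apply: eq_tpoly => I sI.
by rewrite /= /par /= codeK.
Qed.

Let GrE sigma j i x y :
  Gr sigma j i (point_env (par x) y) = tpoly m' (jet (partial (g (sigma j)) i) x) y.
Proof.
rewrite /Gr rowE; apply: eq_tpoly => I sI.
by rewrite /= /par /= codeK.
Qed.

Let gradQ sigma x : gradient_at (Q sigma) (Gr sigma) (par x).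
Proof.
move=> eps kappa kappa0.
have cG j i : continuous (fun y => Gr sigma j i (point_env (par x) y)).
  by apply: polyfun_continuous => // -[c|k]; [exact: cst_continuous|exact: coord_continuous].
have U (ji : 'I_N * 'I_m) := compact_uniform_continuity (@compact_norm_le R m `|eps|) (cG ji.1 ji.2) kappa0.
have /choice[r hr] : forall ji : 'I_N * 'I_m, exists r : R, 0 < r /\
    forall y y', `|y| <= `|eps| -> `|y' - y| < r ->
    `|Gr sigma ji.1 ji.2 (point_env (par x) y') - Gr sigma ji.1 ji.2 (point_env (par x) y)| < kappa.
  by move=> ji; have [r r0 rP] := U ji; exists r.
have [th th0 thP] := finite_pos_bound (fun ji => (hr ji).1).
exists (th / 2); first by rewrite divr_gt0.
move=> j y y' hy _ hd; rewrite !QE.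
have hl := tpoly_line_gradient (fun l lk => symmetric_jet x (Ckg (sigma j)) lk).
apply: (line_gradient_approx hl) => t i /andP[t0 t1].
have := (hr (j, i)).2 y (y + t *: (y' - y)).
rewrite /= !GrE => H; apply/ltW/H.
  by apply: rV_norm_le => // k; apply: le_trans (hy k) (ler_norm _).
apply: lt_le_trans (thP (j, i)).
rewrite [y + _]addrC addrK normrZ (ger0_norm t0).
apply: le_lt_trans (_ : th / 2 < _); last by lra.
apply: le_trans (ler_piMl _ t1) _ => //.
apply: le_trans (rV_norm_le_sum _) _; apply: le_trans hd.
by apply: ler_sum => k _; rewrite !mxE.
Qed.

Lemma grid_cell (B : R) (D : nat) (x : 'rV[R]_m) : 0 < B -> (0 < D)%N ->
  (forall i, `|x ord0 i| <= B) ->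
  exists t : {ffun 'I_m -> 'I_D}, forall i,
    `|x ord0 i - (- B + (2 * (t i)%:R + 1) * (B / D%:R))| <= B / D%:R.
Proof.
move=> B0 D0 hx; set eps := B / D%:R.
have D0' : 0 < D%:R :> R by rewrite ltr0n.
have eps0 : 0 < eps by rewrite divr_gt0.
have DE : D%:R * eps = B by rewrite /eps mulrC divfK // gt_eqF.
have /choice[t tP] : forall i, exists t : 'I_D,
    `|x ord0 i - (- B + (2 * t%:R + 1) * eps)| <= eps.
  move=> i; have := hx i; rewrite ler_norml => /andP[x1 x2].
  pose u := (x ord0 i + B) / (2 * eps).
  have uE : u * (2 * eps) = x ord0 i + B by rewrite divfK // gt_eqF // mulr_gt0.
  have u0 : 0 <= u by rewrite divr_ge0 //; [lra|rewrite mulr_ge0 // ltW].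
  have /andP[t1 t2] := truncn_itv u0.
  have [uD|uD] := ltnP (Num.truncn u) D.
    exists (Ordinal uD) => /=.
    set T := (Num.truncn u)%:R in t1 *.
    rewrite -natr1 -/T in t2.
    by rewrite ler_norml; apply/andP; split; nra.
  (* The index reaches [D] only at the right endpoint, which belongs to the last cell. *)
  have DD : (D.-1 < D)%N by rewrite prednK.
  exists (Ordinal DD) => /=.
  have uD' : D%:R <= u by apply: le_trans t1; rewrite ler_nat.
  have -> : D.-1%:R = D%:R - 1 :> R by rewrite -subn1 natrB.
  by rewrite ler_norml; apply/andP; split; nra.
by exists [ffun i => t i] => i; rewrite ffunE.
Qed.

(** If every value of the interval were critical, each point of a fine grid in it would be
    near-critical in one of the [D ^ m] cells for some [sigma]. Each pair accounts for a length
    O(eps^m w), where [w] is the oscillation of the derivatives of order [m], so the total is O(w)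
    whatever the cell size. *)
Theorem no_critical_interval (B a b : R) : 0 < B -> a < b ->
  exists2 v, a <= v <= b & forall (x : 'rV[R]_m) sigma, (forall i, `|x ord0 i| <= B) ->
    ~ critical_config sigma x v.
Proof.
move=> B0 ab; apply: contrapT => hex.
have crit v : a <= v <= b -> exists (x : 'rV[R]_m) sigma, (forall i, `|x ord0 i| <= B) /\ critical_config sigma x v.
  move=> hv; apply: contrapT => h; apply: hex; exists v => // x sigma hx hc.
  by apply: h; exists x, sigma.
pose Sg : finType := {ffun 'I_N -> 'I_N}.
have /choice[As AsP] : forall s : Sg, exists A : R, 0 <= A /\ forall p (eps eta1 eta2 kappa : R),
    gradient_at (Q s) (Gr s) p -> 0 <= eps -> 0 <= eta1 -> 0 <= eta2 -> 0 < kappa ->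
    exists2 h0 : R, 0 < h0 & forall h, 0 < h < h0 -> forall a S,
      h * (\sum_(k < S.+1) `[< near_critical_value (Q s) (Gr s) p eps eta1 eta2 (a + k%:R * h) >])%:R
      <= A * (eta1 + eta2 * eps) + kappa.
  move=> s; have [A A0 AP] := near_critical_count (polyQ s) (polyGr s).
  by exists A.
pose A := \sum_s As s.
have A0 : 0 <= A by apply: sumr_ge0 => s _; exact: (AsP s).1.
have AsA s : As s <= A.
  by rewrite /A (bigD1 s) //= lerDl sumr_ge0 // => t _; exact: (AsP t).1.
pose F : R := #|Sg|%:R.
pose L := b - a.
have L0 : 0 < L by rewrite subr_gt0.
(* With [D%:R * eps = B], the sum over cells and selections of [2 * A * eta1] equals [M * w] for
   every [eps]. The constants are then fixed in the order [w], [eps], [kappa], [h], and the losses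
   [M * w] and [n * kappa] are at most [L / 4] each. *)
pose M := F * A * 2 * (m%:R * B) ^+ m.
have M0 : 0 <= M by rewrite !mulr_ge0 // exprn_ge0 // mulr_ge0 // ltW.
pose w := L / (4 * (M + 1)).
have w0 : 0 < w by rewrite divr_gt0 // mulr_gt0 // ltr_wpDl.
have wM : M * w <= L / 4.
  have E : w * (M + 1) = L / 4.
    by rewrite /w invfM mulrA -mulrA mulVf ?mulr1 // gt_eqF // ltr_wpDl.
  nra.
have /choice[r hr] : forall jI : 'I_N * m.-tuple 'I_m, exists r : R, 0 < r /\
    forall y y', `|y| <= B -> `|y' - y| < r ->
    `|dword (g jI.1) jI.2 y' - dword (g jI.1) jI.2 y| < w.
  move=> jI; have cd : continuous (dword (g jI.1) jI.2).
    by apply: (@is_Ck_dword _ _ 0); rewrite size_tuple addn0.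
  have [r r0 rP] := compact_uniform_continuity (@compact_norm_le R m B) cd w0.
  by exists r.
have [r0 r00 hr0] := finite_pos_bound (fun jI => (hr jI).1).
pose D := (Num.truncn (B / r0) + Num.truncn B).+1.
have D0 : 0 < D%:R :> R by rewrite ltr0n.
pose eps := B / D%:R.
have eps0 : 0 < eps by rewrite divr_gt0.
have epsr : eps < r0.
  rewrite /eps ltr_pdivrMr // mulrC -ltr_pdivrMr //.
  apply: lt_le_trans (truncnS_gt _) _; rewrite ler_nat /D ltnS; exact: leq_addr.
have DE : D%:R * eps = B by rewrite /eps mulrC divfK // gt_eqF.
pose eta1 := (m%:R * eps) ^+ m * w; pose eta2 := (m%:R * eps) ^+ m' * w.
have me0 : 0 <= m%:R * eps by rewrite mulr_ge0 // ltW.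
have eta10 : 0 <= eta1 by apply: mulr_ge0; [exact: exprn_ge0|exact: ltW].
have eta20 : 0 <= eta2 by apply: mulr_ge0; [exact: exprn_ge0|exact: ltW].
have eta12 : eta1 + eta2 * eps <= 2 * eta1.
  rewrite mulr_natl mulr2n lerD2l /eta1 /eta2 exprSr.
  rewrite -[leLHS]mulrA -[leRHS]mulrA; apply: ler_wpM2l; first exact: exprn_ge0.
  rewrite [leLHS]mulrC; apply: ler_wpM2r; first exact: ltW.
  by apply: ler_peMl; [exact: ltW|rewrite ler1n].
pose T : finType := {ffun 'I_m -> 'I_D}.
pose cen (t : T) : 'rV[R]_m := \row_i (- B + (2 * (t i)%:R + 1) * eps).
have cenB t : `|cen t| <= B.
  apply: rV_norm_le => [|i]; first exact: ltW.
  rewrite mxE.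
  have tD : (t i)%:R + 1 <= D%:R :> R by rewrite natr1 ler_nat.
  have t0 : 0 <= (t i)%:R :> R by [].
  rewrite ler_norml; apply/andP; split; nra.
have near (x : 'rV[R]_m) v s : (forall i, `|x ord0 i| <= B) -> critical_config s x v ->
    exists ts : T * Sg, near_critical_value (Q ts.2) (Gr ts.2) (par (cen ts.1)) eps eta1 eta2 v.
  move=> hx [gv [lam [l0 l1 lg]]].
  have [t tP] := grid_cell B0 (isT : (0 < D)%N) hx.
  exists (t, [ffun j => s j]) => /=.
  pose y := x - cen t.
  have hy i : `|y ord0 i| <= eps by rewrite !mxE; exact: tP.
  have xE : cen t + y = x by rewrite addrC subrK.
  have hw j I (z : 'rV[R]_m) : size I = m -> (forall i, `|z ord0 i| <= eps) ->
      `|dword (g j) I (cen t + z) - dword (g j) I (cen t)| <= w.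
    move=> sI hz; pose I' : m.-tuple 'I_m := Tuple (introT eqP sI).
    apply/ltW; apply: ((hr (j, I')).2 (cen t) (cen t + z)) => //.
    rewrite [cen t + z]addrC addrK; apply: lt_le_trans (hr0 (j, I')).
    by apply: le_lt_trans epsr; apply: rV_norm_le => //; exact: ltW.
  exists y, lam; split=> //.
  - move=> j; rewrite QE ffunE -(gv j) -{1}xE.
    by apply: taylor_bound => //; [exact: ltW|exact: ltW|exact: hw].
  - move=> i; under eq_bigr do rewrite GrE ffunE.
    rewrite -[X in `|X|]subr0 -[X in _ - X](lg i) -sumrB.
    apply: le_trans (ler_norm_sum _ _ _) _.
    rewrite -[eta2]mul1r -l1 mulr_suml; apply: ler_sum => j _.
    rewrite -mulrBr normrM (ger0_norm (l0 j)) ler_wpM2l // distrC -xE.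
    apply: taylor_bound => //; [exact: (Ckg (s j)).2|exact: ltW|exact: ltW|].
    by move=> I z sI hz; apply: (hw _ (i :: I)) => //=; rewrite sI.
pose n : R := D%:R ^+ m * F.
have n0 : 0 <= n by rewrite mulr_ge0 // exprn_ge0.
have cardTS : #|{: T * Sg}|%:R = n.
  by rewrite card_prod natrM /n card_ffun !card_ord natrX.
pose kappa := L / (4 * (n + 1)).
have kappa0 : 0 < kappa by rewrite divr_gt0 // mulr_gt0 // ltr_wpDl.
have kn : n * kappa <= L / 4.
  have E : kappa * (n + 1) = L / 4.
    by rewrite /kappa invfM mulrA -mulrA mulVf ?mulr1 // gt_eqF // ltr_wpDl.
  nra.
have /choice[hs hsP] : forall ts : T * Sg, exists h0 : R, 0 < h0 /\
    forall h, 0 < h < h0 -> forall a S,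
      h * (\sum_(k < S.+1) `[< near_critical_value (Q ts.2) (Gr ts.2) (par (cen ts.1)) eps eta1 eta2 (a + k%:R * h) >])%:R
      <= A * (eta1 + eta2 * eps) + kappa.
  move=> ts; have [h0 h00 h0P] := (AsP ts.2).2 _ _ _ _ _ (gradQ ts.2 (cen ts.1)) (ltW eps0) eta10 eta20 kappa0.
  exists h0; split=> // h hh a' S; apply: le_trans (h0P h hh a' S) _.
  by rewrite lerD2r ler_wpM2r // addr_ge0 // mulr_ge0 // ltW.
have [h1 h10 h1P] := finite_pos_bound (fun ts => (hsP ts).1).
pose h := h1 / 2.
have h0 : 0 < h by rewrite divr_gt0.
pose S := Num.truncn (L / h).
have /andP[S1 S2] : S%:R <= L / h < S.+1%:R by apply: truncn_itv; rewrite divr_ge0 // ltW.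
have cnt : (S.+1 <= \sum_(ts : T * Sg) \sum_(k < S.+1)
    `[< near_critical_value (Q ts.2) (Gr ts.2) (par (cen ts.1)) eps eta1 eta2 (a + k%:R * h) >])%N.
  rewrite exchange_big -[X in (X <= _)%N]card_ord -sum1_card; apply: leq_sum => k _.
  have [|x [s [hx hc]]] := crit (a + k%:R * h).
    have kS : k%:R <= L / h.
      by apply: le_trans S1; rewrite ler_nat -ltnS.
    have : k%:R * h <= L by rewrite -ler_pdivlMr.
    have : 0 <= k%:R * h by rewrite mulr_ge0 // ltW.
    rewrite /L => ? ?; apply/andP; split; lra.
  have [ts tsP] := near _ _ _ hx hc.
  by rewrite (bigD1 ts) //= asboolT.
have : S.+1%:R * h <= \sum_(ts : T * Sg) (A * (eta1 + eta2 * eps) + kappa).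
  rewrite mulrC; apply: le_trans (_ : h * (\sum_(ts : T * Sg) \sum_(k < S.+1)
    `[< near_critical_value (Q ts.2) (Gr ts.2) (par (cen ts.1)) eps eta1 eta2 (a + k%:R * h) >])%:R <= _).
    by apply: ler_wpM2l; [exact: ltW|rewrite ler_nat].
  rewrite natr_sum mulr_sumr; apply: ler_sum => ts _.
  apply: (hsP ts).2; rewrite h0 /=.
  by apply: lt_le_trans (h1P ts); rewrite /h; lra.
rewrite (_ : \sum_(ts : T * Sg) _ = n * (A * (eta1 + eta2 * eps) + kappa)); last first.
  by rewrite -cardTS sumr_const mulr_natl.
rewrite mulrDr => fin.
have SL : L < S.+1%:R * h by rewrite -ltr_pdivrMr.
have : n * (A * (eta1 + eta2 * eps)) <= M * w.
  apply: le_trans (_ : n * (A * (2 * eta1)) <= _).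
    by rewrite ler_wpM2l // ler_wpM2l.
  rewrite /n /M /eta1 -DE !exprMn.
  set X1 := D%:R ^+ m; set X2 := m%:R ^+ m; set X3 := eps ^+ m.
  by rewrite le_eqVlt; apply/orP; left; apply/eqP; ring.
lra.
Qed.

End Sard.

(** * Descent along averaged inclusions *)

Section Dot.
Context {R : realType} {m : nat}.
Implicit Types u v w : 'rV[R]_m.

Definition dot u v : R := \sum_i u ord0 i * v ord0 i.

Lemma dotDr u v w : dot u (v + w) = dot u v + dot u w.
Proof. by rewrite /dot -big_split; apply: eq_bigr => i _; rewrite mxE mulrDr. Qed.

Lemma dotNr u v : dot u (- v) = - dot u v.
Proof. by rewrite /dot -sumrN; apply: eq_bigr => i _; rewrite mxE mulrN. Qed.

Lemma dotBr u v w : dot u (v - w) = dot u v - dot u w.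
Proof. by rewrite dotDr dotNr. Qed.

Lemma dotZr (k : R) u v : dot u (k *: v) = k * dot u v.
Proof. by rewrite /dot mulr_sumr; apply: eq_bigr => i _; rewrite mxE mulrCA. Qed.

Lemma dot_suml (I : finType) (k : I -> R) (a : I -> 'rV[R]_m) v :
  dot (\sum_i k i *: a i) v = \sum_i k i * dot (a i) v.
Proof.
rewrite /dot; under [RHS]eq_bigr do rewrite mulr_sumr.
rewrite exchange_big /=; apply: eq_bigr => l _.
by rewrite summxE mulr_suml; apply: eq_bigr => i _; rewrite mxE mulrA.
Qed.

Lemma dot_le u v : `|dot u v| <= m%:R * `|u| * `|v|.
Proof.
apply: le_trans (ler_norm_sum _ _ _) _.
apply: le_trans (_ : \sum_(i < m) `|u| * `|v| <= _).
  by apply: ler_sum => i _; rewrite normrM ler_pM // rV_coord_le.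
by rewrite sumr_const card_ord mulr_natl -mulrnAl -[`|u| *+ m]mulr_natl.
Qed.

End Dot.

Section Descent.
Context {R : realType} {m N : nat}.
Variables (a : 'I_N -> 'rV[R]_m) (L c2 : R).
Hypothesis L0 : 0 <= L.
Hypothesis aL : forall j, `|a j| <= L.
Hypothesis c20 : 0 <= c2.

Definition weights (lam : 'I_N -> R) : Prop :=
  (forall j, 0 <= lam j) /\ \sum_j lam j = 1.

Variables (x : R -> 'rV[R]_m) (pc : R -> 'I_N) (F : R -> R).

(** Approximate trajectory whose velocities are minus convex combinations of the [a j]; the slack
    [e] accounts for interpolation by a step function and for the noise. [path_same] compares any
    two times spent in the same piece, whatever happens in between. *)
Record path_ok (e s t : R) (V : {set 'I_N}) : Prop := {
  path_pieces : forall u, s <= u <= t -> pc u \in V ;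
  path_move : forall u u', s <= u -> u <= u' -> u' <= t ->
    exists lam, [/\ weights lam,
      forall j, lam j != 0 -> exists2 w : R, u <= w <= u' & pc w = j &
      `|x u' - x u + (u' - u) *: \sum_j lam j *: a j| <= e] ;
  path_same : forall u u', s <= u <= t -> s <= u' <= t -> pc u = pc u' ->
    `|F u' - F u - dot (a (pc u)) (x u' - x u)| <= e ;
  path_lip : forall u u', s <= u <= t -> s <= u' <= t ->
    `|F u' - F u| <= L * `|u' - u| + e }.

Lemma path_ok_sub e e' s s' t t' V (V' : {set 'I_N}) :
  path_ok e s t V -> e <= e' -> s <= s' -> t' <= t ->
  (forall u, s' <= u <= t' -> pc u \in V') -> path_ok e' s' t' V'.
Proof.
move=> [h1 h2 h3 h4] ee' ss' tt' hV.
have sub u : s' <= u <= t' -> s <= u <= t.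
  by move=> /andP[? ?]; apply/andP; split; [exact: le_trans ss' _|exact: le_trans tt'].
split=> //.
- move=> u u' su uu' ut; have [|//||lam [l1 l2 l3]] := h2 u u'.
  + exact: le_trans su.
  + exact: le_trans tt'.
  + by exists lam; split=> //; exact: le_trans ee'.
- by move=> u u' /sub hu /sub hu' e1; apply: le_trans ee'; exact: h3.
- by move=> u u' /sub hu /sub hu'; apply: le_trans (h4 _ _ hu hu') _; rewrite lerD2l.
Qed.

Lemma norm_weights lam : weights lam -> `|\sum_j lam j *: a j| <= L.
Proof.
move=> [l0 l1]; apply: le_trans (ler_norm_sum _ _ _) _.
rewrite -[L]mul1r -l1 mulr_suml; apply: ler_sum => j _.
by rewrite normrZ ger0_norm // ler_wpM2l.
Qed.

Hypothesis convex_c2 : forall lam, weights lam ->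
  c2 <= dot (\sum_j lam j *: a j) (\sum_j lam j *: a j).

(** [Kt] collects the losses on the two end intervals of length [theta * l], [Kr] the errors of size
    [rho * l]. *)
Let Kt := 2 * L + 2 * m%:R * L ^+ 2.
Let Kr := 3 + 3 * m%:R * L.

(* If every piece is met near both ends of the interval then [F] varies as each
   branch does, and averaging these variations with the weights of the
   displacement gives minus its square. *)
Lemma descent_all_pieces theta rho s l V : 0 < l -> 0 < theta <= 2^-1 -> 0 <= rho ->
  path_ok (rho * l) s (s + l) V ->
  (forall j, j \in V -> exists2 u : R, s <= u <= s + theta * l & pc u = j) ->
  (forall j, j \in V -> exists2 u : R, s + l - theta * l <= u <= s + l & pc u = j) ->
  F (s + l) - F s <= (Kt * theta + Kr * rho - c2) * l.
Proof.
move=> l0 /andP[th0 th1] rho0 [h1 h2 h3 h4] first last.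
have thl : 0 < theta * l by rewrite mulr_gt0.
have thl2 : theta * l <= l by rewrite ler_piMl ?ltW //; lra.
have [lam [[lam0 lam1] lamV lamE]] := h2 s (s + l) (lexx _) (ltW (ltr_pwDr l0 (lexx _))) (lexx _).
set X := x (s + l) - x s in lamE; set A := \sum_j lam j *: a j in lamE.
set e := rho * l in h2 h3 h4 lamE.
have e0 : 0 <= e by rewrite mulr_ge0 // ltW.
have small u u' : s <= u -> u <= u' -> u' <= s + l -> u' - u <= theta * l ->
    `|x u' - x u| <= L * (theta * l) + e.
  move=> su uu' ul d; have [mu [mu1 _ mu2]] := h2 u u' su uu' ul.
  have := ler_normB (x u' - x u + (u' - u) *: (\sum_j mu j *: a j)) ((u' - u) *: (\sum_j mu j *: a j)).
  rewrite addrK normrZ ger0_norm ?subr_ge0 // => H; apply: le_trans H _.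
  rewrite addrC lerD // mulrC ler_pM // ?subr_ge0 //; exact: norm_weights.
have small' u u' : s <= u -> u <= u' -> u' <= s + l -> u' - u <= theta * l ->
    F u' - F u <= L * (theta * l) + e.
  move=> su uu' ul d; apply: le_trans (ler_norm _) _.
  apply: le_trans (h4 _ _ _ _) _.
  - by rewrite su (le_trans uu').
  - by rewrite ul (le_trans su).
  - by rewrite lerD2r ler_wpM2l // ger0_norm ?subr_ge0.
have mL0 : 0 <= m%:R * L by rewrite mulr_ge0.
have Dj j : lam j != 0 ->
    F (s + l) - F s <= dot (a j) X + (2 * (L * (theta * l) + e) + e + 2 * (m%:R * L) * (L * (theta * l) + e)).
  move=> /lamV [w hw wj]; have jV : j \in V by rewrite -wj; exact: h1.
  have [u /andP[u1 u2] uj] := first j jV; have [u' /andP[v1 v2] u'j] := last j jV.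
  have ul : u <= s + l by lra.
  have su' : s <= u' by lra.
  have a1 := small s u (lexx _) u1 ul ltac:(lra).
  have a2 := small u' (s + l) su' v2 (lexx _) ltac:(lra).
  have b1 := small' s u (lexx _) u1 ul ltac:(lra).
  have b2 := small' u' (s + l) su' v2 (lexx _) ltac:(lra).
  have : `|F u' - F u - dot (a (pc u)) (x u' - x u)| <= e.
    by apply: h3; [apply/andP|apply/andP|rewrite uj].
  rewrite uj ler_norml => /andP[_ b3].
  have -> : F (s + l) - F s = (F (s + l) - F u') + (F u' - F u) + (F u - F s) by lra.
  have XE : x u' - x u = X - (x (s + l) - x u') - (x u - x s).
    by apply/rowP => i; rewrite /X !mxE; lra.
  have : dot (a j) (x u' - x u) <= dot (a j) X + 2 * (m%:R * L) * (L * (theta * l) + e).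
    have bd z : `|z| <= L * (theta * l) + e ->
        - dot (a j) z <= (m%:R * L) * (L * (theta * l) + e).
      move=> hz; rewrite lerNl; have := dot_le (a j) z; rewrite ler_norml => /andP[H _].
      apply: le_trans H; rewrite lerN2.
      by rewrite ler_pM // ?mulr_ge0 // ler_wpM2l.
    rewrite XE (dotBr (a j) (X - _)) (dotBr (a j) X).
    move: (bd _ a1) (bd _ a2); clear; lra.
  lra.
have avg : F (s + l) - F s <= dot A X + (2 * (L * (theta * l) + e) + e + 2 * (m%:R * L) * (L * (theta * l) + e)).
  rewrite /A dot_suml; set E := 2 * _ + _ + _.
  rewrite -[leLHS]mul1r -[E]mul1r -lam1 !mulr_suml -big_split /=; apply: ler_sum => j _.
  rewrite -mulrDr; have [->|lj] := eqVneq (lam j) 0; first by rewrite !mul0r.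
  by rewrite ler_wpM2l // Dj.
have AX : dot A X <= - c2 * l + m%:R * L * e.
  have -> : X = (X + (s + l - s) *: A) - l *: A.
    have -> : s + l - s = l by lra.
    by rewrite addrK.
  rewrite dotBr dotZr.
  have := @convex_c2 lam (conj lam0 lam1); rewrite -/A => cA.
  have : dot A (X + (s + l - s) *: A) <= m%:R * L * e.
    apply: le_trans (ler_norm _) _; apply: le_trans (dot_le _ _) _.
    rewrite ler_pM // ?mulr_ge0 // ler_wpM2l //; exact: norm_weights.
  have : c2 * l <= l * dot A A by rewrite mulrC ler_wpM2l // ltW.
  lra.
have -> : (Kt * theta + Kr * rho - c2) * l =
  - c2 * l + m%:R * L * e + (2 * (L * (theta * l) + e) + e + 2 * (m%:R * L) * (L * (theta * l) + e)).
  rewrite /Kt /Kr /e; ring.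
lra.
Qed.

End Descent.

Lemma geometric_small {R : realType} (q B d : R) : 0 <= q < 1 -> 0 < d ->
  exists r : nat, q ^+ r * B <= d.
Proof.
move=> /andP[q0 q1] d0.
have : (fun n => q ^+ n) @ \oo --> (0 : R) by apply: cvg_expr; rewrite ger0_norm.
move=> /cvgrPdist_lt /(_ (d / (`|B| + 1))).
have B1 : 0 < `|B| + 1 by rewrite ltr_wpDl.
rewrite divr_gt0 // => /(_ isT) [r _ /(_ r (leqnn _))] /=.
rewrite sub0r normrN ger0_norm ?exprn_ge0 // ltr_pdivlMr // => h.
exists r; apply: le_trans (ltW h); rewrite ler_wpM2l ?exprn_ge0 //.
by apply: le_trans (ler_norm _) _; rewrite lerDl.
Qed.

Section DescentTheorem.
Context {R : realType} {m N : nat}.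
Variables (a : 'I_N -> 'rV[R]_m) (L c2 : R).
Hypothesis L0 : 0 <= L.
Hypothesis aL : forall j, `|a j| <= L.
Hypothesis c20 : 0 <= c2.
Hypothesis convex_c2 : forall lam, weights lam ->
  c2 <= dot (\sum_j lam j *: a j) (\sum_j lam j *: a j).

(** Induction on the number of pieces. If a piece is missed on the first or last fraction [th] of
    the interval, that part descends by induction and is cut off; otherwise [descent_all_pieces]
    applies. After [r] cuts only the fraction [(1 - th) ^+ r] is left, and there the crude Lipschitz
    bound is affordable. *)
Lemma descent n (d : R) : 0 < d -> exists2 rho : R, 0 < rho &
  forall x pc F s l (V : {set 'I_N}), 0 < l -> (#|V| <= n)%N ->
  path_ok a L x pc F (rho * l) s (s + l) V -> F (s + l) - F s <= (d - c2) * l.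
Proof.
elim: n d => [|n IHn] d d0.
  exists 1 => // x pc F s l V l0; rewrite leqn0 cards_eq0 => /eqP -> [h _ _ _].
  by have := h s; rewrite lexx lerDl (ltW l0) inE => /(_ isT).
pose Kt := 2 * L + 2 * m%:R * L ^+ 2; pose Kr := 3 + 3 * m%:R * L.
have Kt0 : 0 <= Kt by rewrite addr_ge0 // !mulr_ge0 // exprn_ge0.
have Kr0 : 0 < Kr by rewrite ltr_wpDr // !mulr_ge0.
pose d' := d / 2.
have d'0 : 0 < d' by rewrite divr_gt0.
pose th := Num.min 2^-1 (d' / (2 * (Kt + 1))).
have th0 : 0 < th by rewrite lt_min invr_gt0 ltr0n divr_gt0 // mulr_gt0 // ltr_wpDl.
have th1 : th <= 2^-1 by rewrite ge_min lexx.
have thK : Kt * th <= d' / 2.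
  have h : th <= d' / (2 * (Kt + 1)) by rewrite ge_min lexx orbT.
  have h2 : (Kt + 1) * (d' / (2 * (Kt + 1))) = d' / 2.
    by field; rewrite gt_eqF // ltr_wpDl.
  have h3 : (Kt + 1) * th <= d' / 2 by rewrite -h2 ler_wpM2l // addr_ge0.
  have : 0 <= th by exact: ltW.
  lra.
pose rC := d' / (2 * Kr).
have rC0 : 0 < rC by rewrite divr_gt0 // mulr_gt0.
have rCK : Kr * rC = d' / 2 by rewrite /rC; field; rewrite gt_eqF.
have [rI rI0 rIP] := IHn _ d'0.
(* Crude bound for an interval not yet treated: [L + 1] from [path_lip] with tolerance 1, and [c2]
   to offset the descent term of the claim. *)
pose B := L + 1 + c2.
have step r : exists2 rho : R, 0 < rho &
  forall x pc F s l (V : {set 'I_N}), 0 < l -> (#|V| <= n.+1)%N ->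
  path_ok a L x pc F (rho * l) s (s + l) V ->
  F (s + l) - F s <= (d' - c2) * l + (1 - th) ^+ r * B * l.
  elim: r => [|r [rr rr0 IHr]].
    exists 1 => // x pc F s l V l0 _ [_ _ _ h4].
    have := h4 s (s + l); rewrite !lexx !lerDl (ltW l0) => /(_ isT isT) h.
    apply: le_trans (ler_norm _) _; apply: le_trans h _.
    have -> : s + l - s = l by lra.
    rewrite gtr0_norm // expr0 mul1r /B.
    have : 0 <= d' * l by rewrite mulr_ge0 // ltW.
    lra.
  (* Three requirements on the tolerance: the case where all pieces are met, the part cut off, of
     length [th * l], and the rest, of length at least [l / 2]. *)
  pose rho := Num.min (Num.min rC (th * rI)) (rr / 2).
  have rho0 : 0 < rho by rewrite !lt_min rC0 mulr_gt0 //= divr_gt0.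
  have rho1 : rho <= rC by rewrite !ge_min lexx.
  have rho2 : rho <= th * rI by rewrite !ge_min lexx orbT.
  have rho3 : rho <= rr / 2 by rewrite !ge_min lexx !orbT.
  exists rho => // x pc F s l V l0 cV ok.
  have thl0 : 0 < th * l by rewrite mulr_gt0.
  have thl1 : th * l <= l / 2.
    by rewrite [leRHS]mulrC ler_wpM2r // ltW.
  have rest0 : 0 < (1 - th) * l by rewrite mulr_gt0 //; lra.
  have e1 : rho * l <= rI * (th * l).
    have := ler_wpM2r (ltW l0) rho2; lra.
  have e2 : rho * l <= rr * ((1 - th) * l).
    have h := ler_wpM2r (ltW l0) rho3.
    have : rr * (th * l) <= rr * (l / 2) by rewrite ler_wpM2l // ltW.
    lra.
  have okV := path_pieces ok.
  have fin D1 D2 : D1 <= (d' - c2) * (th * l) ->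
     D2 <= (d' - c2) * ((1 - th) * l) + (1 - th) ^+ r * B * ((1 - th) * l) ->
     D1 + D2 <= (d' - c2) * l + (1 - th) ^+ r.+1 * B * l.
    move=> H1 H2; rewrite exprSr.
    have -> : (d' - c2) * l + (1 - th) ^+ r * (1 - th) * B * l =
     (d' - c2) * (th * l) + ((d' - c2) * ((1 - th) * l) + (1 - th) ^+ r * B * ((1 - th) * l)).
      by ring.
    exact: lerD.
  have cD j : j \in V -> (#|V :\ j| <= n)%N.
    by move=> jV; move: cV; rewrite (cardsD1 j) jV.
  have [A|A] := pselect (exists2 j, j \in V & forall u : R, s <= u <= s + th * l -> pc u != j).
    have [j jV jA] := A.
    have -> : F (s + l) - F s = (F (s + th * l) - F s) + (F (s + l) - F (s + th * l)) by lra.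
    apply: fin.
      apply: (rIP x pc F s (th * l) (V :\ j)) => //; first exact: cD.
      apply: path_ok_sub ok _ _ _ _ => //; first by lra.
      move=> u /andP[u1 u2]; rewrite in_setD1 jA ?u1 //= okV // u1 /=; lra.
    have E : s + l = s + th * l + (1 - th) * l by ring.
    rewrite E; apply: (IHr x pc F _ _ V) => //; rewrite -E.
    apply: path_ok_sub ok _ _ _ _ => //; first by lra.
    move=> u /andP[u1 u2]; rewrite okV // u2 andbT; lra.
  have [A'|A'] := pselect (exists2 j, j \in V & forall u : R, s + l - th * l <= u <= s + l -> pc u != j).
    have [j jV jA] := A'.
    have -> : F (s + l) - F s = (F (s + l) - F (s + l - th * l)) + (F (s + l - th * l) - F s) by lra.
    apply: fin.
      have E : s + l = s + l - th * l + th * l by lra.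
      rewrite {1}E; apply: (rIP x pc F _ (th * l) (V :\ j)) => //; first exact: cD.
      rewrite -E; apply: path_ok_sub ok _ _ _ _ => //; first by lra.
      move=> u /andP[u1 u2]; rewrite in_setD1 jA ?u1 //= okV // u2 andbT; lra.
    have E : s + l - th * l = s + (1 - th) * l by ring.
    rewrite E; apply: (IHr x pc F _ _ V) => //; rewrite -E.
    apply: path_ok_sub ok _ _ _ _ => //; first by lra.
    move=> u /andP[u1 u2]; rewrite okV // u1 /=; lra.
  have vis P : ~ (exists2 j, j \in V & forall u : R, P u -> pc u != j) ->
      forall j, j \in V -> exists2 u : R, P u & pc u = j.
    move=> nP j jV; apply: contrapT => nu; apply: nP; exists j => // u Pu.
    by apply/eqP => e; apply: nu; exists u.
  have := descent_all_pieces L0 aL convex_c2 l0 _ (ltW rho0) ok (vis _ A) (vis _ A').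
  rewrite th0 th1 => /(_ isT) H; apply: le_trans H _.
  have B0 : 0 <= (1 - th) ^+ r.+1 * B * l.
    apply: mulr_ge0; last exact: ltW.
    by apply: mulr_ge0; [apply: exprn_ge0; lra|rewrite !addr_ge0].
  apply: le_trans (_ : (d' - c2) * l <= _); last by rewrite lerDl.
  apply: ler_wpM2r; first exact: ltW.
  rewrite lerD2r.
  have := ler_wpM2l (ltW Kr0) rho1; rewrite -/Kt -/Kr; lra.
have [|r hr] := @geometric_small R (1 - th) B d' _ d'0; first by apply/andP; split; lra.
have [rho rho0 rhoP] := step r; exists rho => // x pc F s l V l0 cV ok.
apply: le_trans (rhoP x pc F s l V l0 cV ok) _.
have := ler_wpM2r (ltW l0) hr; rewrite /d'; lra.
Qed.

End DescentTheorem.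

(** * Stochastic noise *)

Section WordExpectation.
Context {R : realType} {n : nat}.
Hypothesis n_gt0 : (0 < n)%N.
Implicit Types (s t : seq 'I_n) (F G : seq 'I_n -> R).

(* Expectation of [F] on words extending [s] by [r] uniform letters. *)
Fixpoint wordE (r : nat) s F : R :=
  if r is r'.+1 then n%:R^-1 * \sum_i wordE r' (rcons s i) F else F s.

Lemma ler_wordE r s F G : (forall t, size t = r -> F (s ++ t) <= G (s ++ t)) ->
  wordE r s F <= wordE r s G.
Proof.
elim: r s => [|r IH] s h /=; first by have := h [::] erefl; rewrite cats0.
rewrite ler_wpM2l ?invr_ge0 //; apply: ler_sum => i _; apply: IH => t st.
by rewrite cat_rcons; apply: h; rewrite /= st.
Qed.

Lemma wordE_const r s (c : R) : wordE r s (fun=> c) = c.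
Proof.
elim: r s => [|r IH] s //=; rewrite (eq_bigr (fun=> c)) // sumr_const card_ord.
by rewrite -[c *+ n]mulr_natl mulrA mulVf ?mul1r // pnatr_eq0 -lt0n.
Qed.

Lemma wordE_add k r s F : wordE (k + r) s F = wordE k s (fun t => wordE r t F).
Proof. by elim: k s => [|k IH] s //=; under eq_bigr do rewrite IH. Qed.

Lemma expR_le_quad (x : R) : `|x| <= 2^-1 -> expR x <= 1 + x + 2 * x ^+ 2.
Proof.
rewrite ler_norml => /andP[x1 x2].
have h : 1 - x <= expR (- x) by exact: expR_ge1Dx.
have x0 : 0 < 1 - x by lra.
have : expR x <= (1 - x)^-1.
  by rewrite -[expR x]invrK -expRN lef_pV2 ?posrE ?expR_gt0.
move=> H; apply: le_trans H _.
rewrite -[leLHS]mul1r ler_pdivrMr //.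
have : 0 <= x ^+ 2 by exact: sqr_ge0.
rewrite expr2; nra.
Qed.

Section Supermartingale.
Variables (y : seq 'I_n -> 'I_n -> R) (b : nat -> R) (k : nat) (lam : R).
Hypothesis y_mean : forall s, \sum_i y s i = 0.
Hypothesis y_bound : forall s i, `|y s i| <= b (size s).
Hypothesis lam_b : forall j, (k <= j)%N -> lam * b j <= 2^-1.
Hypothesis lam0 : 0 <= lam.
Variable i0 : 'I_n.

Definition wsum s : R := \sum_(k <= j < size s) y (take j s) (nth i0 s j).

(** Exponential supermartingale started at time [k]; the factor 2 in the compensator comes from
    [expR_le_quad], applicable because [lam * b j] is at most one half. *)
Definition expmart s : R :=
  expR (lam * wsum s - 2 * lam ^+ 2 * \sum_(k <= j < size s) b j ^+ 2).

Lemma wsum_rcons s i : (k <= size s)%N -> wsum (rcons s i) = wsum s + y s i.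
Proof.
move=> ks; rewrite /wsum size_rcons big_nat_recr //=; congr (_ + _).
  apply: eq_big_nat => j /andP[_ js].
  by rewrite nth_rcons js -cats1 takel_cat // ltnW.
by rewrite nth_rcons ltnn eqxx -cats1 take_size_cat.
Qed.

Lemma expmart_step s : (k <= size s)%N ->
  n%:R^-1 * \sum_i expmart (rcons s i) <= expmart s.
Proof.
move=> ks; set B := b (size s).
have E i : expmart (rcons s i) = expmart s * expR (- (2 * lam ^+ 2 * B ^+ 2)) * expR (lam * y s i).
  rewrite /expmart -!expRD; congr expR; rewrite wsum_rcons // size_rcons big_nat_recr //= -/B.
  by ring.
under eq_bigr do rewrite E.
rewrite -mulr_sumr mulrCA -[leLHS]mulrA -[leRHS]mulr1.
apply: ler_wpM2l; first exact: expR_ge0.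
rewrite mulrC expRN ler_pdivrMr ?expR_gt0 // mul1r.
apply: le_trans (_ : n%:R^-1 * \sum_i (1 + lam * y s i + 2 * lam ^+ 2 * B ^+ 2) <= _).
  rewrite ler_wpM2l ?invr_ge0 //; apply: ler_sum => i _.
  have yb : `|lam * y s i| <= lam * B by rewrite normrM ger0_norm // ler_wpM2l.
  apply: le_trans (expR_le_quad (le_trans yb (lam_b ks))) _.
  rewrite lerD2l -mulrA ler_wpM2l // -exprMn -[leLHS]real_normK ?num_real //.
  by rewrite lerXn2r ?nnegrE // (le_trans _ yb).
rewrite big_split /= big_split /= -mulr_sumr y_mean mulr0 addr0 !sumr_const card_ord.
rewrite -mulrnDl -[(_ + _) *+ n]mulr_natl mulrA.
by rewrite mulVf ?mul1r ?pnatr_eq0 -?lt0n // expR_ge1Dx.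
Qed.

Definition hits (a : R) (l : nat) s : bool :=
  has (fun j => a <= expmart (take j s)) (iota l (size s - l).+1).

(** Ville's inequality, by induction on the horizon: if the level is already reached, the bound is
    at least 1; otherwise the next letter is averaged out by [expmart_step]. *)
Lemma ville r s (a : R) : 0 < a -> (k <= size s)%N ->
  wordE r s (fun t => (hits a (size s) t)%:R) <= expmart s / a.
Proof.
move=> a0; elim: r s => [|r IH] s ks.
  rewrite /= /hits subnn /= take_size orbF.
  have [h|_] := leP a (expmart s); first by rewrite ler_pdivlMr // mul1r.
  by rewrite divr_ge0 ?expR_ge0 // ltW.
have [h|h] := leP a (expmart s).
  apply: le_trans (_ : 1 <= _); last by rewrite ler_pdivlMr // mul1r.
  rewrite -[leRHS](wordE_const r.+1 s); apply: ler_wordE => t _.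
  by case: hits.
rewrite /=; apply: le_trans (_ : n%:R^-1 * \sum_i (expmart (rcons s i) / a) <= _).
  rewrite ler_wpM2l ?invr_ge0 //; apply: ler_sum => i _.
  apply: le_trans (IH (rcons s i) _); last by rewrite size_rcons leqW.
  apply: ler_wordE => t st; rewrite ler_nat.
  rewrite /hits size_rcons cat_rcons.
  have -> : (size (s ++ i :: t) - size s).+1 = (size (s ++ i :: t) - (size s).+1).+2.
    by rewrite size_cat /= addnS -addSn addKn subSn ?leq_addr // addKn.
  by rewrite /= take_size_cat // leNgt h.
by rewrite -mulr_suml mulrA ler_pdivrMr // divfK ?gt_eqF // expmart_step.
Qed.

Lemma maximal_inequality r (d : R) :
  wordE (k + r) [::] (fun t =>
     (has (fun j => d <= wsum (take j t)) (iota k r.+1))%:R) <=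
  expR (- lam * d + 2 * lam ^+ 2 * \sum_(k <= j < k + r) b j ^+ 2).
Proof.
set Sb := \sum_(k <= j < k + r) b j ^+ 2.
(* The full sum [Sb] dominates the compensator at every time of the window, so a single level [a]
   detects [d <= wsum] at all of them. *)
pose a := expR (lam * d - 2 * lam ^+ 2 * Sb).
rewrite wordE_add -[leRHS](wordE_const k [::]); apply: ler_wordE => s sk.
rewrite cat0s.
have -> : expR (- lam * d + 2 * lam ^+ 2 * Sb) = expmart s / a.
  rewrite /expmart /wsum !big_geq ?sk // -expRN -expRD; congr expR; ring.
have ks : (k <= size s)%N by rewrite sk.
apply: le_trans (ville r (expR_gt0 _ : 0 < a) ks).
apply: ler_wordE => t tr; rewrite ler_nat.
rewrite /hits size_cat addKn sk tr.
case: hasP => // -[j]; rewrite mem_iota addnS ltnS => /andP[kj jr] dj.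
suff -> : has (fun j => a <= expmart (take j (s ++ t))) (iota k r.+1) by [].
apply/hasP; exists j; first by rewrite mem_iota addnS ltnS kj.
rewrite /a /expmart ler_expR lerB //; first by rewrite ler_wpM2l.
rewrite ler_wpM2l ?mulr_ge0 ?exprn_ge0 // size_takel; last by rewrite size_cat sk tr.
rewrite /Sb (big_cat_nat kj jr) /= lerDl sumr_ge0 // => ? _; exact: sqr_ge0.
Qed.

End Supermartingale.
End WordExpectation.

(** * Events depending on finitely many random indices *)

Section WordProbability.
Context {R : realType} {n : nat} {d : measure_display} {Omega0 : measurableType d}.
Variables (P0 : probability Omega0 R) (iota : Omega0 -> 'I_n).
Hypothesis iota_meas : forall l, measurable (iota @^-1` [set l]).
Hypothesis iota_unif : forall l, P0 (iota @^-1` [set l]) = (n%:R^-1)%:E.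
Variable P : probability (seq_space Omega0) R.
Hypothesis P_prod : is_product_probability P0 P.
Variable i0 : 'I_n.

Definition word (w : seq_space Omega0) (r : nat) : seq 'I_n := mkseq (fun l => iota (w l)) r.

Let meas_letter k l : measurable [set w : seq_space Omega0 | iota (w k) = l].
Proof.
apply: sub_sigma_algebra; exists k => //.
by exists (iota @^-1` [set l]) => //; rewrite setTI.
Qed.

Let prob_prefix s : P [set w | word w (size s) = s] = ((n%:R^-1) ^+ size s)%:E.
Proof.
have := @P_prod (size s) (fun k => iota @^-1` [set nth i0 s k]) (fun k => iota_meas _).
have -> : [set w : seq_space Omega0 | forall k, (k < size s)%N -> (iota @^-1` [set nth i0 s k]) (w k)] =
    [set w | word w (size s) = s].
  apply/seteqP; split=> w /=.
    move=> h; apply: (@eq_from_nth _ i0); rewrite size_mkseq // => k ks.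
    by rewrite nth_mkseq // h.
  by move=> h k ks; rewrite -[in RHS]h nth_mkseq.
have E : (\prod_(k < size s) P0 (iota @^-1` [set nth i0 s k]) = \prod_(k < size s) (n%:R^-1)%:E)%E.
  by apply: eq_bigr => k _; exact: iota_unif.
move=> ->; rewrite [LHS]E {E}.
elim: (size s) => [|r IH]; first by rewrite big_ord0.
by rewrite big_ord_recr /= IH exprSr.
Qed.

Let meas_prefix s : measurable [set w | word w (size s) = s].
Proof.
have -> : [set w | word w (size s) = s] =
   \bigcap_(k in `I_(size s)) [set w : seq_space Omega0 | iota (w k) = nth i0 s k].
  apply/seteqP; split=> w /=.
    by move=> h k ks /=; rewrite -[in RHS]h nth_mkseq.
  move=> h; apply: (@eq_from_nth _ i0); rewrite size_mkseq // => k ks.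
  by rewrite nth_mkseq // h.
by apply: fin_bigcap_measurable => // k _; exact: meas_letter.
Qed.

Let prob_extend r s (E : pred (seq 'I_n)) :
  measurable [set w | word w (size s) = s /\ E (word w (size s + r))] /\
  P [set w | word w (size s) = s /\ E (word w (size s + r))] =
  ((n%:R^-1) ^+ size s * wordE r s (fun t => (E t)%:R))%:E.
Proof.
elim: r s => [|r IH] s.
  rewrite addn0 /=; case: (boolP (E s)) => Es.
    have -> : [set w | word w (size s) = s /\ E (word w (size s))] = [set w | word w (size s) = s].
      by apply/seteqP; split=> w /= => [[]//|h]; rewrite h.
    by rewrite mulr1; split; [exact: meas_prefix|exact: prob_prefix].
  have -> : [set w | word w (size s) = s /\ E (word w (size s))] = set0.
    by apply/seteqP; split=> w //= -[->]; rewrite (negbTE Es).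
  by rewrite measure0 mulr0.
pose F i := [set w | word w (size (rcons s i)) = rcons s i /\ E (word w (size (rcons s i) + r))].
have -> : [set w | word w (size s) = s /\ E (word w (size s + r.+1))] =
    \big[setU/set0]_(i < n) F i.
  apply/seteqP; split=> w /=.
    move=> [ws wE]; rewrite -bigcup_seq; exists (iota (w (size s))); first exact: mem_index_enum.
    rewrite /F /= size_rcons addSnnS; split=> //.
    by rewrite /word mkseqS -/(word w (size s)) ws.
  rewrite -bigcup_seq => -[i _]; rewrite /F /= size_rcons addSnnS => -[h wE]; split=> //; move: h.
  by rewrite /word mkseqS -/(word w (size s)) => /rcons_inj [].
split; first by apply: bigsetU_measurable => i _; exact: (IH _).1.
rewrite measure_bigsetU_ord //=; last 2 first.
  by move=> i; exact: (IH _).1.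
  apply/trivIsetP => i j _ _ ij; apply/seteqP; split=> w //= -[[h1 _] [h2 _]].
  move: h1 h2; rewrite !size_rcons => -> /rcons_inj[/eqP]; rewrite (negbTE ij) //.
under eq_bigr do rewrite /F (IH _).2 size_rcons.
rewrite sumEFin; congr EFin; rewrite -mulr_sumr exprSr.
by rewrite mulrA.
Qed.

(** An event determined by a finite word is a finite union of cylinders: measurability is automatic,
    and the probability is a finite average to which the bounds on words apply. *)
Lemma word_event r (E : pred (seq 'I_n)) :
  measurable [set w | E (word w r)] /\
  P [set w | E (word w r)] = (wordE r [::] (fun t => (E t)%:R))%:E.
Proof.
have [h1 h2] := prob_extend r [::] E.
have E1 : [set w | word w (size ([::] : seq 'I_n)) = [::] /\ E (word w (size ([::] : seq 'I_n) + r))] = [set w | E (word w r)].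
  by apply/seteqP; split=> w //= -[].
by rewrite E1 in h1 h2; rewrite h2 expr0 mul1r.
Qed.

End WordProbability.

(** * The time scale of accumulated step sizes *)

Section Clock.
Context {R : realType}.
Variable alpha : nat -> R.
Hypothesis alpha_gt0 : forall k, 0 < alpha k.
Hypothesis alpha_sum : (\sum_(0 <= k <oo) (alpha k)%:E = +oo)%E.

Definition clock (k : nat) : R := \sum_(0 <= j < k) alpha j.

Lemma clockS k : clock k.+1 = clock k + alpha k.
Proof. by rewrite /clock big_nat_recr. Qed.

Lemma clock_sub k l : (k <= l)%N -> \sum_(k <= j < l) alpha j = clock l - clock k.
Proof. by move=> kl; rewrite /clock (big_cat_nat (leq0n k) kl) /= addrAC subrr add0r. Qed.

Lemma clock_mono k l : (k <= l)%N -> clock k <= clock l.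
Proof.
move=> kl; rewrite -subr_ge0 -clock_sub // sumr_ge0 // => j _; exact: ltW.
Qed.

Lemma clock_unbounded (M : R) : exists k, M < clock k.
Proof.
apply: contrapT => h.
have hM k : clock k <= M by rewrite leNgt; apply/negP => hk; apply: h; exists k.
suff : (\sum_(0 <= k <oo) (alpha k)%:E <= M%:E)%E by rewrite alpha_sum leye_eq.
apply: lime_le; first by apply: is_cvg_nneseries => k _ _; rewrite lee_fin ltW.
by apply: nearW => k; rewrite sumEFin lee_fin; exact: hM.
Qed.

Lemma clock_window k (T : R) : 0 <= T -> exists r, clock (k + r) - clock k <= T /\
  forall l, (k <= l)%N -> clock l - clock k <= T -> (l <= k + r)%N.
Proof.
move=> T0.
have ex : exists r, T < clock (k + r).+1 - clock k.
  have [l hl] := clock_unbounded (T + clock k); exists l.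
  have := clock_mono (leq_trans (leq_addl k l) (leqnSn _)); lra.
exists (ex_minn ex); case: ex_minnP => r hr rmin; split.
  case: r hr rmin => [|r] hr rmin; first by rewrite addn0 subrr.
  rewrite leNgt; apply/negP => h; have := rmin r; rewrite -addnS h => /(_ isT).
  by rewrite ltnn.
move=> l kl hl; rewrite leqNgt; apply/negP => lr.
have := clock_mono lr; lra.
Qed.

End Clock.

(** * Almost sure smallness of the noise *)

Section Noise.
Context {R : realType} {m n : nat} {d : measure_display} {Omega0 : measurableType d}.
Hypothesis n_gt0 : (0 < n)%N.
Variables (P0 : probability Omega0 R) (io : Omega0 -> 'I_n).
Hypothesis iota_meas : forall l, measurable (io @^-1` [set l]).
Hypothesis iota_unif : forall l, P0 (io @^-1` [set l]) = (n%:R^-1)%:E.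
Variable P : probability (seq_space Omega0) R.
Hypothesis P_prod : is_product_probability P0 P.
Variable G : 'I_n -> 'rV[R]_m -> 'rV[R]_m.
Hypothesis G_bounded : forall M : R, exists B : R, forall i x, `|x| <= M -> `|G i x| <= B.
Variables (x0 : 'rV[R]_m) (alpha : nat -> R).
Hypothesis alpha_gt0 : forall k, 0 < alpha k.
Hypothesis alpha_o : alpha =o_\oo (fun k : nat => (ln k%:R)^-1).
Hypothesis alpha_sum : (\sum_(0 <= k <oo) (alpha k)%:E = +oo)%E.

Let i0 : 'I_n := Ordinal n_gt0.

Definition mean_field x : 'rV[R]_m := n%:R^-1 *: \sum_i G i x.

Definition noise (i : nat -> 'I_n) j : 'rV[R]_m :=
  let x := iterates G alpha x0 i j in G (i j) x - mean_field x.

Lemma eq_iterates (i i' : nat -> 'I_n) k : (forall l, (l < k)%N -> i l = i' l) ->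
  iterates G alpha x0 i k = iterates G alpha x0 i' k.
Proof.
elim: k => [//|k IH] h /=; rewrite IH ?h // => l lk; apply: h; exact: ltnW.
Qed.

Let xs (s : seq 'I_n) := iterates G alpha x0 (nth i0 s) (size s).

Let sum_letter x c : \sum_i (G i x - mean_field x) ord0 c = 0.
Proof.
under eq_bigr do rewrite !mxE.
rewrite sumrB sumr_const card_ord -[(_ * _) *+ n]mulr_natl.
by rewrite mulrA mulfV ?mul1r ?summxE ?subrr // pnatr_eq0 -lt0n.
Qed.

Section OneEvent.
Variables (M T dd : nat) (c : 'I_m) (sg : bool).
Let del : R := dd.+1%:R^-1.

(** The increment is set to 0 when the current iterate is outside the ball of radius [M]: the mean
    remains zero, and the size is bounded by a deterministic multiple of [alpha]. On paths that stay
    in the ball it is the actual scaled noise coordinate, with sign given by [sg]. *)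
Let y (s : seq 'I_n) (i : 'I_n) : R :=
  if `|xs s| <= M%:R then (-1) ^+ sg * (alpha (size s) * (G i (xs s) - mean_field (xs s)) ord0 c) else 0.

Let y_mean s : \sum_i y s i = 0.
Proof.
rewrite /y; case: (`|xs s| <= M%:R); last by rewrite big1.
by under eq_bigr do rewrite mulrA; rewrite -mulr_sumr sum_letter mulr0.
Qed.

Let bad (r : nat) (k : nat) : set (seq_space Omega0) :=
  [set w | has (fun j => del <= wsum y k i0 (take j (word io w (k + r)))) (iota k r.+1)].

Let bound : exists2 B : R, 0 < B & forall s i, `|y s i| <= alpha (size s) * B.
Proof.
have [B hB] := G_bounded M%:R.
exists (2 * `|B| + 1) => [|s i]; first by rewrite ltr_wpDl // mulr_ge0.
rewrite /y; case: ifP => xM; last first.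
  by rewrite normr0 mulr_ge0 // ?ltW // ltr_wpDl // mulr_ge0.
rewrite !normrM normrX normrN1 expr1n mul1r (gtr0_norm (alpha_gt0 _)).
rewrite ler_wpM2l ?ltW //; apply: le_lt_trans (rV_coord_le _ _) _.
have hG j : `|G j (xs s)| <= `|B| by apply: le_trans (hB j _ xM) (ler_norm _).
have hm : `|mean_field (xs s)| <= `|B|.
  rewrite normrZ ger0_norm ?invr_ge0 // mulrC ler_pdivrMr ?ltr0n //.
  apply: le_trans (ler_norm_sum _ _ _) _.
  apply: le_trans (_ : \sum_(i < n) `|B| <= _); first by apply: ler_sum => j _.
  by rewrite sumr_const card_ord mulr_natr.
apply: le_lt_trans (ler_normB _ _) _; have := hG i; lra.
Qed.

Let r_ (k : nat) : nat := xget 0%N [set r | clock alpha (k + r) - clock alpha k <= T%:R /\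
  forall l, (k <= l)%N -> clock alpha l - clock alpha k <= T%:R -> (l <= k + r)%N].

Let r_P k : clock alpha (k + r_ k) - clock alpha k <= T%:R /\
  forall l, (k <= l)%N -> clock alpha l - clock alpha k <= T%:R -> (l <= k + r_ k)%N.
Proof.
have [r rP] := clock_window alpha_gt0 alpha_sum k (ler0n R T).
by rewrite /r_; case: xgetP => [z _ //|/(_ r)].
Qed.

Let bad_prob : exists K0, forall k, (K0 <= k)%N ->
  (P (bad (r_ k) k) <= ((k%:R ^+ 2)^-1)%:E)%E.
Proof.
have [B B0 yB] := bound.
have del0 : 0 < del by rewrite invr_gt0.
pose T' : R := T%:R.
have T0 : 0 <= T' by [].
(* [c0] will be the value of [lam * (e0 / ln k%:R)]. The first term of its denominator ensures that
   [lam * (alpha j * B)] is at most one half, the second keeps the compensator below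
   [lam * (del / 2)]. *)
pose c0 := (2 * B + 4 * B ^+ 2 * T' / del)^-1.
have den0 : 0 < 2 * B + 4 * B ^+ 2 * T' / del.
  apply: ltr_wpDr; last by rewrite mulr_gt0.
  by apply: divr_ge0; [rewrite mulr_ge0 // mulr_ge0 // exprn_ge0 // ltW|exact: ltW].
have c00 : 0 < c0 by rewrite invr_gt0.
have c0E : c0 * (2 * B) + c0 * (4 * B ^+ 2 * T' / del) = 1.
  by rewrite -mulrDr mulVf // gt_eqF.
have c01 : c0 * B <= 2^-1.
  have : 0 <= c0 * (4 * B ^+ 2 * T' / del).
    apply: mulr_ge0; first exact: ltW.
    by apply: divr_ge0; [rewrite mulr_ge0 // mulr_ge0 // exprn_ge0 // ltW|exact: ltW].
  lra.
have c02 : 2 * c0 * B ^+ 2 * T' <= del / 2.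
  have E : c0 * (4 * B ^+ 2 * T' / del) * del = 4 * c0 * B ^+ 2 * T'.
    by field; rewrite gt_eqF.
  have : c0 * (4 * B ^+ 2 * T' / del) <= 1.
    have : 0 <= c0 * (2 * B) by apply: mulr_ge0; [exact: ltW|rewrite mulr_ge0 // ltW].
    lra.
  move=> /(ler_wpM2r (ltW del0)); rewrite E; lra.
(* This makes [lam] equal to [4 * ln k%:R / del], so that [lam * (del / 2)] is [2 * ln k%:R] and the
   exponential bound is k^(-2). *)
pose e0 := c0 * del / 4.
have e00 : 0 < e0 by rewrite divr_gt0 // mulr_gt0.
have [K0 _ hK0] : \forall k \near \oo, `|alpha k| <= e0 * `|(ln k%:R)^-1|.
  by move/eqoP : alpha_o; apply.
exists (maxn K0 2) => k; rewrite geq_max => /andP[K0k k2].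
have k_gt0 : (0 < k)%N by exact: leq_trans k2.
have lnk0 : 0 < ln k%:R :> R by rewrite ln_gt0 // ltr1n.
pose lam := c0 / e0 * ln k%:R.
have lam0 : 0 <= lam by apply: mulr_ge0; [apply: divr_ge0|]; exact: ltW.
have ak j : (k <= j)%N -> alpha j <= e0 / ln k%:R.
  move=> kj; have := hK0 j (leq_trans K0k kj) => /=.
  rewrite gtr0_norm // => h; apply: le_trans h _.
  have lnj : ln k%:R <= ln j%:R :> R.
    by rewrite ler_ln ?posrE ?ltr0n // ?ler_nat // (leq_trans k_gt0 kj).
  have lnj0 := lt_le_trans lnk0 lnj.
  by rewrite gtr0_norm ?invr_gt0 // ler_pM2l // lef_pV2.
have lamE : lam * (e0 / ln k%:R) = c0.
  by rewrite /lam; field; rewrite !gt_eqF.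
have lam_b j : (k <= j)%N -> lam * (alpha j * B) <= 2^-1.
  move=> kj; apply: le_trans c01; rewrite mulrA; apply: ler_wpM2r; first exact: ltW.
  by rewrite -lamE ler_wpM2l // ak.
have [_ ->] := word_event iota_meas iota_unif P_prod i0 (k + r_ k)
  (fun t => has (fun j => del <= wsum y k i0 (take j t)) (iota k (r_ k).+1)).
rewrite lee_fin.
apply: le_trans (maximal_inequality n_gt0 y_mean yB lam_b lam0 i0 (r_ k) del) _.
have sumb : \sum_(k <= j < k + r_ k) (alpha j * B) ^+ 2 <= B ^+ 2 * (e0 / ln k%:R) * T'.
  apply: le_trans (_ : \sum_(k <= j < k + r_ k) (B ^+ 2 * (e0 / ln k%:R)) * alpha j <= _).
    rewrite big_nat_cond [leRHS]big_nat_cond; apply: ler_sum => j; rewrite andbT => /andP[kj _].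
    rewrite exprMn mulrC -[leRHS]mulrA; apply: ler_wpM2l; first exact: sqr_ge0.
    by rewrite expr2; apply: ler_wpM2r; [exact: ltW|exact: ak].
  rewrite -mulr_sumr clock_sub ?leq_addr //; apply: ler_wpM2l; last exact: (r_P k).1.
  by apply: mulr_ge0; [exact: sqr_ge0|apply: divr_ge0; exact: ltW].
have -> : (k%:R ^+ 2)^-1 = expR (- (2 * ln k%:R)) :> R.
  by rewrite expRN mulrC expRM_natr lnK // posrE ltr0n ltnW.
rewrite ler_expR.
have : 2 * lam ^+ 2 * (\sum_(k <= j < k + r_ k) (alpha j * B) ^+ 2) <= lam * (del / 2).
  apply: le_trans (_ : 2 * lam ^+ 2 * (B ^+ 2 * (e0 / ln k%:R) * T') <= _).
    by rewrite ler_wpM2l // mulr_ge0 // exprn_ge0.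
  have -> : 2 * lam ^+ 2 * (B ^+ 2 * (e0 / ln k%:R) * T') =
    lam * (2 * (lam * (e0 / ln k%:R)) * B ^+ 2 * T') by ring.
  by rewrite lamE ler_wpM2l.
have : lam * (del / 2) = 2 * ln k%:R.
  by rewrite /lam /e0; field; rewrite !gt_eqF.
lra.
Qed.

Let bad_finitely : {ae P, forall w, exists K, forall k, (K <= k)%N -> ~ bad (r_ k) k w}.
Proof.
have [K0 hK0] := bad_prob.
pose F k : set (seq_space Omega0) := if (maxn K0 1 <= k)%N then bad (r_ k) k else set0.
have mF k : measurable (F k).
  by rewrite /F; case: ifP => // _; exact: (word_event iota_meas iota_unif P_prod i0 (k + r_ k)
  (fun t => has (fun j => del <= wsum y k i0 (take j t)) (iota k (r_ k).+1))).1.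
(* k^(-2) is at most twice a telescoping difference, which gives the summability required by
   Borel-Cantelli. *)
have PF k : (0 < k)%N -> (P (F k) <= (2 * (k%:R^-1 - k.+1%:R^-1))%:E)%E.
  move=> k_gt0; rewrite /F; case: ifPn => [|_].
    rewrite geq_max => /andP[k0 k1]; apply: le_trans (hK0 k k0) _; rewrite lee_fin.
    have k1' : 1 <= k%:R :> R by rewrite ler1n.
    rewrite -[k.+1%:R]natr1; set q := k%:R in k1' *.
    have -> : 2 * (q^-1 - (q + 1)^-1) = 2 * q / (q + 1) * (q ^+ 2)^-1.
      by field; rewrite !gt_eqF //; lra.
    rewrite -[leLHS]mul1r ler_wpM2r ?invr_ge0 ?sqr_ge0 //.
    by rewrite ler_pdivlMr; lra.
  rewrite measure0 lee_fin mulr_ge0 // subr_ge0.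
  by rewrite lef_pV2 ?posrE ?ltr0n // ler_nat.
have sumF : (\sum_(k <oo) P (F k) < +oo)%E.
  apply: (@le_lt_trans _ _ 2%:E); last by rewrite ltry.
  apply: lime_le; first by apply: is_cvg_nneseries => k _ _; exact: measure_ge0.
  apply: nearW => k.
  have : (\sum_(0 <= i < k) P (F i) <= (2 * (- k%:R^-1 + 1))%:E)%E.
    case: k => [|k]; first by rewrite big_nil lee_fin invr0; lra.
    elim: k => [|k IH].
      rewrite big_nat1 /F; have -> : (maxn K0 1 <= 0)%N = false by rewrite geq_max andbF.
      by rewrite measure0 lee_fin invr1; lra.
    rewrite big_nat_recr //=; apply: le_trans (leeD IH (PF k.+1 isT)) _.
    by rewrite -EFinD lee_fin; move: (k.+1%:R^-1) (k.+2%:R^-1) => p q; lra.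
  move=> H; apply: le_trans H _; rewrite lee_fin.
  have : 0 <= k%:R^-1 :> R by rewrite invr_ge0.
  lra.
have L0 := lim_sup_set_cvg0 mF sumF.
have mL : measurable (lim_sup_set F).
  by apply: bigcap_measurable => // k _; apply: bigcup_measurable => j _.
exists (lim_sup_set F); split=> // w /= hw k _.
apply: contrapT => H; apply: hw; exists (maxn k (maxn K0 1)) => j.
rewrite geq_max => /andP[kj Kj] bj; apply: H; exists j => //=.
by rewrite /F Kj.
Qed.

Lemma noise_one_side : {ae P, forall w,
  let i := fun l => io (w l) in
  (forall k, `|iterates G alpha x0 i k| <= M%:R) ->
  exists K, forall k l, (K <= k)%N -> (k <= l)%N -> clock alpha l - clock alpha k <= T%:R ->
  (-1) ^+ sg * \sum_(k <= j < l) alpha j * noise i j ord0 c < del}.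
Proof.
apply: filterS bad_finitely => w [K hK] i xM; exists K => k l Kk kl lT.
rewrite ltNge; apply/negP => hd; apply: (hK k Kk); apply/hasP; exists l.
  by rewrite mem_iota kl /= addnS ltnS (r_P k).2.
have lr := (r_P k).2 l kl lT.
have -> : take l (word io w (k + r_ k)) = word io w l.
  by rewrite /word /mkseq -map_take take_iota (minn_idPl lr).
apply: le_trans hd _; rewrite /wsum size_mkseq mulr_sumr le_eqVlt; apply/orP; left; apply/eqP.
apply: eq_big_nat => j /andP[kj jl].
have xE : xs (word io w j) = iterates G alpha x0 i j.
  rewrite /xs size_mkseq; apply: eq_iterates => q qj.
  by rewrite nth_mkseq.
have -> : take j (word io w l) = word io w j.
  by rewrite /word /mkseq -map_take take_iota (minn_idPl (ltnW jl)).
by rewrite /y xE xM size_mkseq nth_mkseq.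
Qed.

End OneEvent.

(** The radius [M] depends on the path, so it is quantified inside the almost sure event: the null
    sets of [noise_one_side] are united over the countably many [M], [T], [dd] and the finitely many
    coordinates and signs. *)
Theorem noise_ae : {ae P, forall w,
  let i := fun l => io (w l) in
  forall M T dd : nat, (forall k, `|iterates G alpha x0 i k| <= M%:R) ->
  exists K, forall k l, (K <= k)%N -> (k <= l)%N -> clock alpha l - clock alpha k <= T%:R ->
  `|\sum_(k <= j < l) alpha j *: noise i j| <= dd.+1%:R^-1}.
Proof.
have H : {ae P, forall w, forall M T dd (cs : 'I_m * bool),
  let i := fun l => io (w l) in
  (forall k, `|iterates G alpha x0 i k| <= M%:R) ->
  exists K, forall k l, (K <= k)%N -> (k <= l)%N -> clock alpha l - clock alpha k <= T%:R ->
  (-1) ^+ cs.2 * \sum_(k <= j < l) alpha j * noise i j ord0 cs.1 < dd.+1%:R^-1}.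
  apply: ae_foralln => M; apply: ae_foralln => T; apply: ae_foralln => dd.
  by apply: filter_forall => -[c sg]; exact: noise_one_side.
apply: (@filterS _ _ (ae_filter_ringOfSetsType P) _ _ _ H) => w {}H i M T dd xM.
have /choice[K KP] : forall cs : 'I_m * bool, exists K, forall k l, (K <= k)%N -> (k <= l)%N ->
  clock alpha l - clock alpha k <= T%:R ->
  (-1) ^+ cs.2 * \sum_(k <= j < l) alpha j * noise i j ord0 cs.1 < dd.+1%:R^-1.
  by move=> cs; exact: H.
exists (\max_cs K cs)%N => k l Kk kl lT.
apply: rV_norm_le => // c.
have -> : (\sum_(k <= j < l) alpha j *: noise i j) ord0 c = \sum_(k <= j < l) alpha j * noise i j ord0 c.
  by rewrite summxE; apply: eq_bigr => j _; rewrite mxE.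
have h (b : bool) : (-1) ^+ b * (\sum_(k <= j < l) alpha j * noise i j ord0 c) < dd.+1%:R^-1.
  by apply: (KP (c, b)) => //; apply: leq_trans Kk; exact: leq_bigmax.
have := h true; have := h false; rewrite expr0 expr1 ler_norml.
move: (dd.+1%:R^-1) (\sum_(k <= j < l) _) => p q h1 h2; apply/andP; split; lra.
Qed.

End Noise.

(** * Convergence of the perturbed dynamics *)

Section Sequences.
Context {R : realType} {m : nat}.

Definition is_cluster (u : nat -> 'rV[R]_m) (y : 'rV[R]_m) : Prop :=
  forall (e : R) K, 0 < e -> exists2 k, (K <= k)%N & `|u k - y| < e.

Lemma accumulation_exists (u : nat -> 'rV[R]_m) (M : R) : (forall k, `|u k| <= M) ->
  exists2 y, `|y| <= M & is_cluster u y.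
Proof.
move=> uM.
have uF : (u @ \oo) [set x | `|x| <= M] by exists 0%N => // k _; exact: uM.
have [y [yM cy]] := @compact_norm_le R m M (u @ \oo) _ uF.
exists y => // e K e0.
have [||k [[n Kn <-] kb]] := cy (u @` [set n | (K <= n)%N]) (ball y e).
- by exists K => // n Kn; exists n.
- exact: nbhsx_ballx.
- by exists n => //; rewrite distrC -ball_normE in kb *.
Qed.

(** The limit is the inferior limit, built as the supremum of the eventual lower bounds. *)
Lemma cvg_no_oscillation (u : nat -> R) (M : R) : (forall k, `|u k| <= M) ->
  (forall a b, a < b -> (forall K, exists2 k, (K <= k)%N & u k <= a) ->
     (forall K, exists2 k, (K <= k)%N & b <= u k) -> False) ->
  cvg (u @ \oo).
Proof.
move=> uM osc.
pose S := [set v | exists K, forall k, (K <= k)%N -> v <= u k].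
have ub : has_ubound S.
  exists M => v [K /(_ K (leqnn _)) vK]; apply: le_trans vK _.
  by apply: le_trans (uM K); exact: ler_norm.
have S0 : S !=set0.
  exists (- M), 0%N => k _; have := uM k; rewrite ler_norml => /andP[].
  by [].
have hS : has_sup S by split.
apply/cvg_ex; exists (sup S); apply/cvgrPdist_lt => e e0.
have [v [K1 vK1] hv] := sup_adherent e0 hS.
have [K2 hK2] : exists K, forall k, (K <= k)%N -> u k < sup S + e.
  apply: contrapT => h.
  apply: (osc (sup S + e / 2) (sup S + e)); first by lra.
    move=> K; apply: contrapT => hK.
    have : S (sup S + e / 2).
      exists K => k Kk; rewrite leNgt; apply/negP => hk; apply: hK; exists k => //; exact: ltW.
    by move=> /(ub_le_sup ub); lra.
  move=> K; apply: contrapT => hK; apply: h; exists K => k Kk.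
  by rewrite ltNge; apply/negP => hk; apply: hK; exists k.
exists (maxn K1 K2) => // k; rewrite /= geq_max => /andP[/vK1 h1 /hK2 h2].
rewrite ltr_norml; apply/andP; split; lra.
Qed.

End Sequences.

(** * Continuous selections of Lipschitz functions *)

Section Selections.
Context {R : realType} {N : nat}.

(** Up to the last time [t1] at which [phi] agrees with the branch [j] active at [a], the bound for
    [psi j] is enough; after [t1] the branch [j] no longer occurs, and the induction on the number
    of branches applies. *)
Lemma lipschitz_selection (phi : R -> R) (psi : 'I_N -> R -> R) (L : R) n :
  continuous phi -> 0 <= L ->
  forall (V : {set 'I_N}) (a b : R), (#|V| <= n)%N -> a <= b ->
  (forall t, a <= t <= b -> exists2 k, k \in V & phi t = psi k t) ->
  (forall k s t, a <= s <= b -> a <= t <= b -> `|psi k t - psi k s| <= L * `|t - s|) ->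
  `|phi b - phi a| <= L * (b - a).
Proof.
move=> cphi L0; elim: n => [|n IH] V a b.
  rewrite leqn0 cards_eq0 => /eqP -> ab h _.
  by have [|k] := h a; rewrite ?lexx ?inE.
move=> cV ab hV hL.
have phi_near t e : 0 < e -> exists2 r, 0 < r & forall s, `|s - t| < r -> `|phi s - phi t| < e.
  move=> e0; have /cvgrPdist_lt /(_ _ e0) /nbhs_ballP[r /= r0 hr] := cphi t.
  by exists r => // s st; rewrite distrC; apply: hr; rewrite -ball_normE /= distrC.
have [j jV ja] := hV a (introT andP (conj (lexx _) ab)).
pose S := [set t | a <= t <= b /\ phi t = psi j t].
have Sa : S a by split=> //; rewrite lexx.
have ubS : has_ubound S by exists b => t [/andP[]].
have hS : has_sup S by split=> //; exists a.
pose t1 := sup S.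
have at1 : a <= t1 by exact: ub_le_sup.
have t1b : t1 <= b by apply: ge_sup; [exists a|move=> t [/andP[]]].
have abt1 : a <= t1 <= b by rewrite at1.
have St1 : phi t1 = psi j t1.
  apply/eqP; rewrite -subr_eq0 -normr_le0; apply/ler_addgt0Pl => e e0; rewrite addr0.
  have [r r0 hr] := phi_near t1 (e / 2) ltac:(lra).
  pose r' := Num.min r (e / (2 * (L + 1))).
  have r'0 : 0 < r' by rewrite lt_min r0 divr_gt0 // mulr_gt0 // ltr_wpDl.
  have [t [tab tE] ht] := sup_adherent r'0 hS.
  have tt1 : t <= t1 by exact: ub_le_sup.
  rewrite -/t1 in ht.
  have d : `|t - t1| < r' by rewrite ltr_norml; apply/andP; split; lra.
  have h1 : `|phi t - phi t1| < e / 2.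
    by apply: hr; apply: lt_le_trans d _; rewrite ge_min lexx.
  have h2 := hL j t t1 tab abt1.
  have h3 : L * `|t1 - t| <= e / 2.
    rewrite distrC; apply: le_trans (_ : L * (e / (2 * (L + 1))) <= _).
      by rewrite ler_wpM2l // ltW // (lt_le_trans d) // ge_min lexx orbT.
    have -> : L * (e / (2 * (L + 1))) = (L / (L + 1)) * (e / 2).
      by field; rewrite gt_eqF // ltr_wpDl.
    rewrite ler_piMl //; first by lra.
    by rewrite ler_pdivrMr ?ltr_wpDl //; lra.
  have := ler_normB (phi t - phi t1) (psi j t - psi j t1).
  have -> : phi t - phi t1 - (psi j t - psi j t1) = - (phi t1 - psi j t1) by rewrite tE; lra.
  rewrite normrN [`|psi j t - _|]distrC; lra.
have first : `|phi t1 - phi a| <= L * (t1 - a).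
  rewrite St1 ja; have := hL j a t1; rewrite lexx ab abt1 => /(_ isT isT).
  by rewrite [`|t1 - a|]ger0_norm ?subr_ge0.
suff second : `|phi b - phi t1| <= L * (b - t1).
  have := ler_distD (phi t1) (phi b) (phi a); lra.
have [t1b'|t1b'] := ltP t1 b; last first.
  have -> : t1 = b by apply/eqP; rewrite eq_le t1b.
  by rewrite !subrr normr0 mulr0.
apply/ler_addgt0Pl => e e0.
have [r r0 hr] := phi_near t1 e e0.
(* The induction starts strictly after [t1], because [j] still occurs at [t1]; continuity of [phi]
   pays for the gap. *)
pose t := t1 + Num.min (r / 2) (b - t1).
have t1t : t1 < t by rewrite ltrDl lt_min divr_gt0 // subr_gt0.
have tb : t <= b.
  by rewrite -lerBrDl ge_min lexx orbT.
have tr : `|phi t - phi t1| < e.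
  apply: hr; rewrite /t addrC addKr gtr0_norm; last by rewrite lt_min divr_gt0 // subr_gt0.
  by rewrite gt_min; apply/orP; left; lra.
have : `|phi b - phi t| <= L * (b - t).
  apply: (IH (V :\ j)) => //.
  - by move: cV; rewrite (cardsD1 j) jV.
  - move=> s /andP[ts sb]; have [|k kV kE] := hV s; first by rewrite sb andbT; lra.
    exists k => //; rewrite in_setD1 kV andbT; apply/eqP => kj.
    have : S s by split; [rewrite sb andbT; lra|rewrite -kj].
    by move=> /(ub_le_sup ubS); rewrite -/t1; lra.
  - move=> k s s' /andP[? ?] /andP[? ?]; apply: hL; apply/andP; split; lra.
have := ler_distD (phi t) (phi b) (phi t1).
have : L * (b - t) <= L * (b - t1) by rewrite ler_wpM2l //; lra.
lra.
Qed.

End Selections.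

Section Kappa.
Context {R : realType}.
Variable alpha : nat -> R.
Hypothesis alpha_gt0 : forall k, 0 < alpha k.
Hypothesis alpha_sum : (\sum_(0 <= k <oo) (alpha k)%:E = +oo)%E.

Lemma kappa_exists (t : R) : exists k, t < clock alpha k.+1.
Proof.
have [k hk] := clock_unbounded alpha_gt0 alpha_sum t; exists k.
by apply: lt_le_trans hk _; exact: clock_mono.
Qed.

Definition kappa (t : R) : nat := ex_minn (kappa_exists t).

Lemma kappaP t : 0 <= t -> clock alpha (kappa t) <= t < clock alpha (kappa t).+1.
Proof.
move=> t0; rewrite /kappa; case: ex_minnP => k hk kmin; rewrite hk andbT.
case: k hk kmin => [|k] hk kmin; first by rewrite /clock big_geq.
by rewrite leNgt; apply/negP => /kmin; rewrite ltnn.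
Qed.

Lemma kappa_unique t k : clock alpha k <= t -> t < clock alpha k.+1 -> kappa t = k.
Proof.
move=> h1 h2; rewrite /kappa; case: ex_minnP => q hq qmin.
apply/eqP; rewrite eqn_leq qmin //= leqNgt; apply/negP => qk.
have := clock_mono alpha_gt0 qk; lra.
Qed.

Lemma kappa_clock k : kappa (clock alpha k) = k.
Proof. by apply: kappa_unique => //; rewrite clockS ltrDl. Qed.

Lemma kappa_mono s t : s <= t -> (kappa s <= kappa t)%N.
Proof.
move=> st; rewrite /kappa; case: ex_minnP => q hq qmin; case: ex_minnP => q' hq' _.
by apply: qmin; exact: le_lt_trans hq'.
Qed.

End Kappa.

(** * Deterministic analysis of a trajectory with small noise *)

Section Dynamics.
Context {R : realType} {m' N : nat}.
Let m := m'.+1.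
Variables (g : 'I_N -> 'rV[R]_m -> R) (Cl : 'I_N -> set 'rV[R]_m).
Variables (f : 'rV[R]_m -> R) (pc : 'rV[R]_m -> 'I_N).
Hypothesis Ckg : forall k, is_Ck m (g k).
Hypothesis Cl_closed : forall k, closed (Cl k).
Hypothesis Cl_pc : forall y, Cl (pc y) y.
Hypothesis Cl_eq : forall k y, Cl k y -> f y = g k y.
Hypothesis f_cont : continuous f.

Definition critical (y : 'rV[R]_m) : Prop := exists lam : 'I_N -> R,
  [/\ weights lam, forall k, lam k != 0 -> Cl k y &
      \sum_k lam k *: gradient (g k) y = 0].

Let line_g k : line_gradient (g k) (partial (g k)).
Proof. by apply: line_gradient_partial; have [] := Ckg k. Qed.

Let partial_cont k i : continuous (partial (g k) i).
Proof. by have := is_Ck_le (isT : (1 <= m)%N) (Ckg k); move=> [_]; apply. Qed.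

Lemma gradient_bound (M : R) : exists2 L : R, 0 <= L &
  forall k (y : 'rV[R]_m), `|y| <= M -> `|gradient (g k) y| <= L.
Proof.
have /choice[B BP] : forall ki : 'I_N * 'I_m, exists B : R, forall y, `|y| <= M -> `|partial (g ki.1) ki.2 y| <= B.
  by move=> [k i]; exact: bounded_on_ball.
exists (\sum_ki `|B ki|); first exact: sumr_ge0.
move=> k y yM; apply: rV_norm_le => [|i]; first exact: sumr_ge0.
apply: le_trans (BP (k, i) y yM) _; apply: le_trans (ler_norm _) _.
by rewrite (bigD1 (k, i)) //= lerDl sumr_ge0.
Qed.

Lemma branch_lipschitz (M L : R) k y z :
  (forall k (y : 'rV[R]_m), `|y| <= M -> `|gradient (g k) y| <= L) -> `|y| <= M -> `|z| <= M ->
  `|g k z - g k y| <= L * \sum_i `|z ord0 i - y ord0 i|.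
Proof.
move=> hL yM zM.
have := @line_gradient_approx _ _ _ _ y z (fun=> 0) L (line_g k).
rewrite big1 ?subr0 => [|i _]; last by rewrite mul0r.
apply=> t i t01; rewrite subr0; apply: le_trans (hL k (y + t *: (z - y)) _).
  exact: (rV_coord_le (gradient (g k) _)).
have := @segment_ball R m y z 0 M t t01; rewrite !subr0; exact.
Qed.

(** Along a segment of the ball [f] is a continuous selection of the branches, which are uniformly
    Lipschitz there. *)
Lemma f_lipschitz (M : R) : exists2 L : R, 0 <= L &
  forall y z : 'rV[R]_m, `|y| <= M -> `|z| <= M -> `|f z - f y| <= L * `|z - y|.
Proof.
have [L L0 hL] := gradient_bound M.
exists (L * m%:R) => [|y z yM zM]; first by rewrite mulr_ge0.
pose pt (t : R) := y + t *: (z - y).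
have ptM t : 0 <= t <= 1 -> `|pt t| <= M.
  by move=> t01; have := @segment_ball R m y z 0 M t t01; rewrite !subr0; exact.
have cphi : continuous (fun t => f (pt t)).
  move=> t; apply: continuous_comp; last exact: f_cont.
  apply: (@cvgD _ _ _ _ _ (fun=> y)); first exact: cvg_cst.
  exact: scalel_continuous.
have := @lipschitz_selection R N (fun t => f (pt t)) (fun k t => g k (pt t)) (L * m%:R * `|z - y|) N _ _ (finset (@predT 'I_N)) 0 1.
rewrite (leq_trans (max_card _)) ?card_ord // ler01 /pt scale1r scale0r addr0 [y + _]addrC subrK subr0 mulr1.
apply=> //.
- by rewrite !mulr_ge0.
- by move=> t _; exists (pc (pt t)); rewrite ?inE //; apply: Cl_eq; exact: Cl_pc.
- move=> k s t s01 t01; apply: le_trans (branch_lipschitz k hL (ptM s s01) (ptM t t01)) _.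
  rewrite -!mulrA ler_wpM2l //; apply: le_trans (_ : \sum_(i < m) `|t - s| * `|z - y| <= _).
    apply: ler_sum => i _; rewrite !mxE.
    have -> : y ord0 i + t * (z ord0 i - y ord0 i) - (y ord0 i + s * (z ord0 i - y ord0 i)) = (t - s) * (z ord0 i - y ord0 i) by ring.
    rewrite normrM ler_wpM2l //; have := rV_coord_le (z - y) i; rewrite !mxE; exact.
  by rewrite sumr_const card_ord -[_ *+ m]mulr_natl [`|t - s| * _]mulrC.
Qed.

Lemma dot_eq0 (v : 'rV[R]_m) : dot v v = 0 -> v = 0.
Proof.
move=> h; apply/rowP => i; rewrite mxE; apply/eqP.
have := h; rewrite /dot => /eqP; rewrite psumr_eq0 => [/allP /(_ i)|j _].
  by rewrite mem_index_enum /= -expr2 sqrf_eq0 => /(_ isT).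
by rewrite -expr2 sqr_ge0.
Qed.

Lemma dot_ge0 (v : 'rV[R]_m) : 0 <= dot v v.
Proof. by apply: sumr_ge0 => i _; rewrite -expr2 sqr_ge0. Qed.

Lemma simplex_min (a : 'I_N -> 'rV[R]_m) (k0 : 'I_N) :
  (forall lam, weights lam -> \sum_k lam k *: a k <> 0) ->
  exists2 c2 : R, 0 < c2 & forall lam, weights lam ->
    c2 <= dot (\sum_k lam k *: a k) (\sum_k lam k *: a k).
Proof.
move=> na.
pose S := [set z : 'rV[R]_N | weights (fun k => z ord0 k)].
pose h (z : 'rV[R]_N) := dot (\sum_k z ord0 k *: a k) (\sum_k z ord0 k *: a k).
have coordE (z : 'rV[R]_N) i : (\sum_k z ord0 k *: a k) ord0 i = \sum_k z ord0 k * a k ord0 i.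
  by rewrite summxE; apply: eq_bigr => k _; rewrite mxE.
have ch : continuous h.
  have pT : polyfun (fun e : 'I_N -> R => \sum_i (\sum_k e k * a k ord0 i) * (\sum_k e k * a k ord0 i)).
    apply: polyfun_sum => i; apply: polyfunM; apply: polyfun_sum => k;
      by apply: polyfunM; [exact: polyfun_var|exact: polyfun_const].
  have -> : h = fun z : 'rV[R]_N => (fun e : 'I_N -> R => \sum_i (\sum_k e k * a k ord0 i) * (\sum_k e k * a k ord0 i)) (fun k => z ord0 k).
    by apply/funext => z; apply: eq_bigr => i _; rewrite coordE.
  by apply: (polyfun_continuous pT) => k; exact: coord_continuous.
have cS : compact S.
  apply: bounded_closed_compact.
    exists 1; split; first exact: num_real.
    move=> M M1 z [z0 z1]; apply: rV_norm_le => [|k]; first by lra.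
    rewrite ger0_norm //; apply: le_trans (ltW M1); rewrite -z1 (bigD1 k) //= lerDl.
    by apply: sumr_ge0.
  have -> : S = (\bigcap_(k in [set: 'I_N]) [set z : 'rV[R]_N | 0 <= z ord0 k]) `&` [set z : 'rV[R]_N | \sum_k z ord0 k = 1].
    by apply/seteqP; split=> z [h1 h2]; split=> // k; [move=> _|]; exact: h1.
  apply: closedI.
    apply: closed_bigI => k _.
    apply: (@closed_comp _ _ (fun z : 'rV[R]_N => z ord0 k) [set t | 0 <= t]); last exact: closed_ge.
    by move=> z _; exact: coord_continuous.
  have pT : polyfun (fun e : 'I_N -> R => \sum_k e k) by apply: polyfun_sum => k; exact: polyfun_var.
  apply: (@closed_comp _ _ (fun z : 'rV[R]_N => \sum_k z ord0 k) [set t | t = 1]); last exact: closed_eq.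
  by move=> z _; apply: (polyfun_continuous pT) => k; exact: coord_continuous.
have neS : S !=set0.
  exists (delta_mx ord0 k0); split=> [k|].
    by rewrite mxE.
  rewrite (bigD1 k0) //= mxE !eqxx big1 ?addr0 // => k kk0.
  by rewrite mxE eqxx (negbTE kk0).
have [z0 z0S hz0] := EVT_min_rV neS cS (continuous_subspaceT ch).
rewrite inE in z0S.
exists (h z0).
  rewrite lt_neqAle dot_ge0 andbT eq_sym; apply/eqP => /dot_eq0.
  exact: na.
move=> lam hl.
have lE k : (\row_k lam k) ord0 k = lam k by rewrite mxE.
have := hz0 (\row_k lam k); rewrite /h inE.
have -> : \sum_k (\row_k lam k) ord0 k *: a k = \sum_k lam k *: a k.
  by apply: eq_bigr => k _; rewrite lE.
by apply; split=> [k|]; [rewrite lE; exact: hl.1|under eq_bigr do rewrite lE; exact: hl.2].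
Qed.

(* Inactive branches, which are not met near [y], are given the gradient of an
   active one so that no convex combination vanishes. *)
Definition frozen (y : 'rV[R]_m) (k : 'I_N) : 'rV[R]_m :=
  if `[< Cl k y >] then gradient (g k) y else gradient (g (pc y)) y.

(** Moving the weights of the inactive branches to [pc y] would turn a vanishing combination of
    frozen gradients into a certificate that [y] is critical. *)
Lemma frozen_neq0 y lam : ~ critical y -> weights lam -> \sum_k lam k *: frozen y k <> 0.
Proof.
move=> nc [l0 l1] e; apply: nc.
pose s := \sum_(k | ~~ `[< Cl k y >]) lam k.
have s0 : 0 <= s by apply: sumr_ge0.
pose mu k := (if `[< Cl k y >] then lam k else 0) + (if k == pc y then s else 0).
have sumD (V : lmodType R) (F : 'I_N -> V) : \sum_k mu k *: F k =
    \sum_(k | `[< Cl k y >]) lam k *: F k + s *: F (pc y).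
  under eq_bigr do rewrite scalerDl.
  rewrite big_split /=; congr (_ + _).
    by rewrite [RHS]big_mkcond; apply: eq_bigr => k _; case: ifP => // _; rewrite scale0r.
  rewrite (bigD1 (pc y)) //= eqxx [X in _ + X]big1 ?addr0 // => k kp.
  by rewrite (negbTE kp) scale0r.
exists mu; split.
- split=> [k|].
    by rewrite addr_ge0 //; case: ifP.
  have := sumD R^o (fun=> 1).
  rewrite (eq_bigr mu) => [->|k _]; last by rewrite [LHS]mulr1.
  rewrite [s *: _]mulr1 /s (eq_bigr lam) => [|k _]; last by rewrite [LHS]mulr1.
  by rewrite -l1 [RHS](bigID (fun k => `[< Cl k y >])).
- move=> k; rewrite /mu; case: (asboolP (Cl k y)) => // nC.
  rewrite add0r; case: (eqVneq k (pc y)) => [->|_]; first by move=> _; exact: Cl_pc.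
  by rewrite eqxx.
- rewrite sumD -[RHS]e [RHS](bigID (fun k => `[< Cl k y >])) /=; congr (_ + _).
    by apply: eq_bigr => k hk; rewrite /frozen hk.
  rewrite /s scaler_suml; apply: eq_bigr => k hk.
  by rewrite /frozen (negbTE hk).
Qed.

Lemma frozen_radius (y : 'rV[R]_m) (e : R) : 0 < e -> exists2 r : R, 0 < r &
  forall k z, `|z - y| < r -> (Cl k z -> Cl k y) /\
    (Cl k y -> forall i, `|partial (g k) i z - frozen y k ord0 i| <= e).
Proof.
move=> e0.
have /choice[r1 r1P] : forall k, exists r : R, 0 < r /\ forall z, `|z - y| < r -> Cl k z -> Cl k y.
  move=> k; have [ck|nck] := pselect (Cl k y); first by exists 1; split.
  have /nbhs_ballP[r /= r0 hr] : nbhs y (~` Cl k).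
    by apply: open_nbhs_nbhs; split=> //; exact: closed_openC.
  exists r; split=> // z zy ckz; exfalso; apply: (hr z) ckz.
  by rewrite -ball_normE /= distrC.
have /choice[r2 r2P] : forall ki : 'I_N * 'I_m, exists r : R, 0 < r /\
    forall z, `|z - y| < r -> `|partial (g ki.1) ki.2 z - partial (g ki.1) ki.2 y| <= e.
  move=> [k i] /=; have /cvgrPdist_lt /(_ _ e0) /nbhs_ballP[r /= r0 hr] := @partial_cont k i y.
  exists r; split=> // z zy; apply/ltW; rewrite distrC; apply: hr.
  by rewrite -ball_normE /= distrC.
have [s1 s10 s1P] := finite_pos_bound (fun k => (r1P k).1).
have [s2 s20 s2P] := finite_pos_bound (fun ki => (r2P ki).1).
exists (Num.min s1 s2); first by rewrite lt_min s10.
move=> k z; rewrite lt_min => /andP[z1 z2]; split.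
  by apply: (r1P k).2; exact: lt_le_trans z1 (s1P k).
move=> cky i; rewrite /frozen asboolT //.
by apply: (r2P (k, i)).2; exact: lt_le_trans z2 (s2P (k, i)).
Qed.

Section Sequence.
Variables (X xi : nat -> 'rV[R]_m) (alpha : nat -> R) (M : R).
Hypothesis alpha_gt0 : forall k, 0 < alpha k.
Hypothesis alpha_sum : (\sum_(0 <= k <oo) (alpha k)%:E = +oo)%E.
Hypothesis alpha_small : forall e, 0 < e -> exists K, forall k, (K <= k)%N -> alpha k <= e.
Hypothesis X_step : forall k,
  X k.+1 = X k - alpha k *: (gradient (g (pc (X k))) (X k) + xi k).
Hypothesis X_bound : forall k, `|X k| <= M.
Hypothesis noise_small : forall T e : R, 0 < e -> exists K, forall k l,
  (K <= k)%N -> (k <= l)%N -> clock alpha l - clock alpha k <= T ->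
  `|\sum_(k <= j < l) alpha j *: xi j| <= e.

Let grd j := gradient (g (pc (X j))) (X j).
Let kap := kappa alpha_gt0 alpha_sum.
Let Xt (u : R) := X (kap u).

Lemma displacement p q : (p <= q)%N -> X q - X p =
  - (\sum_(p <= j < q) alpha j *: grd j) - \sum_(p <= j < q) alpha j *: xi j.
Proof.
elim: q => [|q IH].
  by rewrite leqn0 => /eqP ->; rewrite !big_geq // subrr oppr0 addr0.
rewrite leq_eqVlt => /orP[/eqP ->|pq]; first by rewrite !big_geq // subrr oppr0 addr0.
rewrite !big_nat_recr //= X_step addrAC IH // -/(grd q) scalerDr !opprD.
by apply/rowP => i; rewrite !mxE; ring.
Qed.

Lemma clock_ge0 k : 0 <= clock alpha k.
Proof. by apply: sumr_ge0 => j _; exact: ltW. Qed.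

Lemma displacement_le (Lg : R) p q : (p <= q)%N ->
  (forall k (y : 'rV[R]_m), `|y| <= M -> `|gradient (g k) y| <= Lg) ->
  `|X q - X p| <= Lg * (clock alpha q - clock alpha p) + `|\sum_(p <= j < q) alpha j *: xi j|.
Proof.
move=> pq hL; rewrite displacement // -opprD normrN.
apply: le_trans (ler_normD _ _) _; rewrite lerD2r.
apply: le_trans (ler_norm_sum _ _ _) _; rewrite -clock_sub // mulr_sumr.
apply: ler_sum => j _; rewrite normrZ gtr0_norm // mulrC; apply: ler_wpM2r; [exact: ltW|exact: hL].
Qed.

Lemma step_small (e : R) : 0 < e -> exists K, forall k, (K <= k)%N -> `|X k.+1 - X k| <= e.
Proof.
move=> e0; have [Lg Lg0 hLg] := gradient_bound M.
have e20 : 0 < e / 2 by rewrite divr_gt0.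
have d0 : 0 < e / 2 / (Lg + 1) by rewrite divr_gt0 // ltr_wpDl.
have [Ka hKa] := alpha_small d0; have [Kn hKn] := noise_small (e / 2 / (Lg + 1)) e20.
exists (maxn Ka Kn) => k; rewrite geq_max => /andP[kKa kKn].
have ce : clock alpha k.+1 - clock alpha k <= e / 2 / (Lg + 1).
  by rewrite clockS addrAC subrr add0r; exact: hKa.
apply: le_trans (displacement_le (leqnSn k) hLg) _.
rewrite [leRHS]splitr; apply: lerD; last exact: hKn.
apply: le_trans (ler_wpM2l Lg0 ce) _.
rewrite mulrCA ler_piMr ?(ltW e20) // ler_pdivrMr ?ltr_wpDl //; lra.
Qed.

Lemma local_descent y : ~ critical y -> `|y| <= M -> exists r c : R, [/\ 0 < r, 0 < c &
  forall l, 0 < l < r -> exists K, forall t, clock alpha K <= t -> `|Xt t - y| < r ->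
  f (Xt (t + l)) - f (Xt t) <= - c * l].
Proof.
move=> nc yM.
have [Lg Lg0 hLg] := gradient_bound M.
have [Lf Lf0 hLf] := f_lipschitz M.
have [c2 c20 hc2] := simplex_min (pc y) (fun lam => frozen_neq0 nc).
(* [Lg] bounds the gradients and [Lf * Lg] the variation of [f] per unit of time; one constant
   serves for both. *)
pose L1 := Lg + Lf * Lg.
have L10 : 0 <= L1 by rewrite addr_ge0 // mulr_ge0.
have aL k : `|frozen y k| <= L1.
  apply: le_trans (_ : Lg <= _); last by rewrite lerDl mulr_ge0.
  by rewrite /frozen; case: ifP => _; exact: hLg.
have d0 : 0 < c2 / 2 by rewrite divr_gt0.
have [rho rho0 desc] := descent L10 aL (ltW c20) hc2 N d0.
(* Room for two errors: [2 * l * rho1] from freezing the gradients over a clock time of at most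
   [2 * l], and [rho1] times a displacement of at most [(2 * Lg + 2) * l] in each coordinate. *)
pose rho1 := rho / (8 + m%:R * (2 * Lg + 2)).
have den0 : 0 < 8 + m%:R * (2 * Lg + 2) by rewrite ltr_wpDr // mulr_ge0 // addr_ge0 // mulr_ge0.
have rho10 : 0 < rho1 by rewrite divr_gt0.
have rho1E : rho1 * 8 + rho1 * (m%:R * (2 * Lg + 2)) = rho.
  by rewrite -mulrDr divfK // gt_eqF.
have rho1a : 0 <= rho1 * (m%:R * (2 * Lg + 2)).
  by apply: mulr_ge0; [exact: ltW|rewrite mulr_ge0 // addr_ge0 // mulr_ge0].
have [r' r'0 hr'] := frozen_radius y rho10.
(* A trajectory starting within [r] of [y] moves by at most [(2 * Lg + 2) * l] during a time
   [l < r], so it stays within [r']. *)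
pose r := r' / (2 * Lg + 4).
have r0 : 0 < r by rewrite divr_gt0 // ltr_wpDl // mulr_ge0.
have rE : r * (2 * Lg + 4) = r' by rewrite divfK // gt_eqF // ltr_wpDl // mulr_ge0.
exists r, (c2 / 2); split=> // l /andP[l0 lr].
have rl0 : 0 < rho * l by rewrite mulr_gt0.
pose e1 := Num.min l (rho * l / (4 * (L1 + 1))).
pose e2 := Num.min l (rho * l / (4 * (Lf + 1))).
have e10 : 0 < e1 by rewrite lt_min l0 divr_gt0 // mulr_gt0 // ltr_wpDl.
have e20 : 0 < e2 by rewrite lt_min l0 divr_gt0 // mulr_gt0 // ltr_wpDl.
have e1l : e1 <= l by rewrite ge_min lexx.
have e2l : e2 <= l by rewrite ge_min lexx.
have small (A e : R) : 0 <= A -> 0 <= e -> e <= rho * l / (4 * (A + 1)) -> A * e <= rho * l / 4 /\ e <= rho * l / 4.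
  move=> A0 e0 he; have : (A + 1) * e <= rho * l / 4.
    have -> : rho * l / 4 = (A + 1) * (rho * l / (4 * (A + 1))).
      by field; rewrite gt_eqF // ltr_wpDl.
    by rewrite ler_wpM2l // addr_ge0.
  rewrite mulrDl mul1r; have : 0 <= A * e by rewrite mulr_ge0.
  by move=> ? ?; split; lra.
have [L1e1 _] : L1 * e1 <= rho * l / 4 /\ e1 <= rho * l / 4.
  by apply: small => //; [exact: ltW|rewrite ge_min lexx orbT].
have [Lfe2 e2r] : Lf * e2 <= rho * l / 4 /\ e2 <= rho * l / 4.
  by apply: small => //; [exact: ltW|rewrite ge_min lexx orbT].
have [Ka hKa] := alpha_small e10; have [Kn hKn] := noise_small (2 * l) e20.
exists (maxn Ka Kn) => t Kt ty.
have t0 : 0 <= t by apply: le_trans Kt; exact: clock_ge0.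
have kapK u : t <= u -> (maxn Ka Kn <= kap u)%N.
  move=> tu; rewrite -(kappa_clock alpha_gt0 alpha_sum (maxn Ka Kn)).
  by apply: kappa_mono; exact: le_trans tu.
have al u : t <= u -> alpha (kap u) <= e1.
  by move=> /kapK; rewrite geq_max => /andP[/hKa].
have kP u : t <= u -> clock alpha (kap u) <= u < clock alpha (kap u) + alpha (kap u).
  by move=> tu; rewrite -clockS; apply: kappaP; exact: le_trans tu.
have pq u v : u <= v -> (kap u <= kap v)%N by exact: kappa_mono.
have clk u v : t <= u -> u <= v ->
    `|(v - u) - (clock alpha (kap v) - clock alpha (kap u))| <= e1.
  move=> tu uv; have /andP[a1 a2] := kP u tu; have /andP[b1 b2] := kP v (le_trans tu uv).
  have := al u tu; have := al v (le_trans tu uv) => c1 c3.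
  rewrite ler_norml; apply/andP; split; lra.
have noise u v : t <= u -> u <= v -> v <= t + l ->
    `|\sum_(kap u <= j < kap v) alpha j *: xi j| <= e2.
  move=> tu uv vl; apply: hKn; last 1 first.
  - by have := clk u v tu uv; rewrite ler_norml => /andP[h1 h2]; lra.
  - by have := kapK u tu; rewrite geq_max => /andP[].
  - exact: pq.
have move1 u v : t <= u -> u <= v -> v <= t + l ->
    `|Xt v - Xt u| <= Lg * (v - u) + Lg * e1 + e2.
  move=> tu uv vl; apply: le_trans (displacement_le (pq _ _ uv) hLg) _.
  apply: lerD; last exact: noise.
  rewrite -mulrDr ler_wpM2l //.
  by have := clk u v tu uv; rewrite ler_norml => /andP[h1 h2]; lra.
have move2 u v : t <= u -> u <= v -> v <= t + l -> `|Xt v - Xt u| <= (2 * Lg + 2) * l.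
  move=> tu uv vl; apply: le_trans (move1 u v tu uv vl) _.
  have : Lg * (v - u) <= Lg * l by rewrite ler_wpM2l //; lra.
  have : Lg * e1 <= Lg * l by rewrite ler_wpM2l.
  lra.
have near u : t <= u -> u <= t + l -> `|Xt u - y| < r'.
  move=> tu ul; have h := move2 t u (lexx _) tu ul.
  apply: le_lt_trans (ler_distD (Xt t) _ _) _.
  have : (2 * Lg + 2) * l <= (2 * Lg + 2) * r by rewrite ler_wpM2l ?(ltW lr) // addr_ge0 // mulr_ge0.
  rewrite -rE; move: h ty; set A := `|Xt u - Xt t|; set B := `|Xt t - y|; lra.
pose pt u := pc (Xt u); pose Ft u := f (Xt u).
have act u : t <= u -> u <= t + l -> Cl (pt u) y.
  by move=> tu ul; apply: (hr' _ _ (near u tu ul)).1; exact: Cl_pc.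
have frz u : t <= u -> u <= t + l -> `|frozen y (pt u) - grd (kap u)| <= rho1.
  move=> tu ul; rewrite distrC; apply: rV_norm_le => [|i]; first exact: ltW.
  by rewrite mxE [X in _ + X]mxE; exact: (hr' _ _ (near u tu ul)).2 (act u tu ul) i.
suff ok : path_ok (frozen y) L1 Xt pt Ft (rho * l) t (t + l) (finset (@predT 'I_N)).
  have := desc Xt pt Ft t l (finset (@predT 'I_N)) l0.
  rewrite (leq_trans (max_card _)) ?card_ord // => /(_ isT ok) H.
  apply: le_trans H _; lra.
split.
- by move=> u _; rewrite inE.
(* If no step is made between the two times, the weight sits on the current piece; otherwise the
   weights are the fractions of clock time spent in each piece. *)
- move=> u v tu uv vl; have := pq u v uv; rewrite leq_eqVlt => /orP[/eqP e|pq'].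
    exists (fun k => (k == pt u)%:R); split.
    + split=> [k|]; first by [].
      by rewrite (bigD1 (pt u)) //= eqxx big1 ?addr0 // => k /negbTE ->.
    + move=> k; case: (eqVneq k (pt u)) => [->|_]; last by rewrite eqxx.
      by move=> _; exists u => //; rewrite lexx.
    + have -> : Xt v - Xt u = 0 by rewrite /Xt e subrr.
      rewrite add0r (bigD1 (pt u)) //= eqxx scale1r big1 ?addr0; last first.
        by move=> k /negbTE ->; rewrite scale0r.
      have := clk u v tu uv; rewrite e subrr subr0 => h.
      rewrite normrZ; apply: le_trans (ler_pM _ _ h (aL (pt u))) _ => //.
      rewrite mulrC; lra.
  set p := kap u in pq' *; set q := kap v in pq' *.
  have sub j : (p <= j < q)%N -> exists2 w, u <= w <= v & kap w = j.
    (* The maximum matters for [j = p], a step that begins no later than [u]. *)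
    move=> /andP[pj jq]; exists (Num.max u (clock alpha j)).
      rewrite le_max lexx /= ge_max uv /=.
      have /andP[h _] := kP v (le_trans tu uv); apply: le_trans h.
      by apply: (clock_mono alpha_gt0); exact: ltnW.
    apply: kappa_unique; first by rewrite le_max lexx orbT.
    rewrite gt_max clockS ltrDl alpha_gt0 andbT -clockS.
    have /andP[_ h] := kP u tu; apply: lt_le_trans h _.
    by rewrite -clockS; exact: clock_mono.
  pose S := clock alpha q - clock alpha p.
  have S0 : 0 < S.
    by rewrite subr_gt0; apply: lt_le_trans (clock_mono alpha_gt0 pq'); rewrite clockS ltrDl.
  have SE : \sum_(p <= j < q) alpha j = S by rewrite clock_sub // ltnW.
  pose lam k := S^-1 * \sum_(p <= j < q) (if pc (X j) == k then alpha j else 0).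
  have sumlam (V : lmodType R) (F : 'I_N -> V) :
      \sum_k lam k *: F k = S^-1 *: \sum_(p <= j < q) alpha j *: F (pc (X j)).
    rewrite /lam; under eq_bigr do rewrite -scalerA scaler_suml.
    rewrite -scaler_sumr exchange_big /=; congr (_ *: _); apply: eq_bigr => j _.
    rewrite (bigD1 (pc (X j))) //= eqxx big1 ?addr0 // => k kj.
    by rewrite eq_sym (negbTE kj) scale0r.
  have wl : weights lam.
    split=> [k|].
      apply: mulr_ge0; first by rewrite invr_ge0 ltW.
      apply: sumr_ge0 => j _.
      by case: ifP => // _; exact: ltW.
    have := sumlam R^o (fun=> 1); rewrite (eq_bigr lam) => [->|k _]; last by rewrite [LHS]mulr1.
    rewrite (eq_bigr alpha) => [|j _]; last by rewrite [LHS]mulr1.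
    by rewrite SE [LHS]mulVf // gt_eqF.
  exists lam; split=> //.
  + move=> k lk; apply: contrapT => nv; move/eqP: lk; apply.
    rewrite /lam big_nat_cond big1 ?mulr0 // => j; rewrite andbT => jpq.
    case: eqP => // jk; exfalso; apply: nv; have [w wuv wj] := sub j jpq.
    by exists w => //; rewrite /pt /Xt wj.
  + set Al := \sum_k lam k *: frozen y k.
    have -> : Xt v - Xt u + (v - u) *: Al =
       (\sum_(p <= j < q) alpha j *: (frozen y (pc (X j)) - grd j)) -
       (\sum_(p <= j < q) alpha j *: xi j) + ((v - u) - S) *: Al.
      have -> : Xt v - Xt u = X q - X p by [].
      rewrite (displacement (ltnW pq')).
      have -> : \sum_(p <= j < q) alpha j *: (frozen y (pc (X j)) - grd j) =
         S *: Al - \sum_(p <= j < q) alpha j *: grd j.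
        rewrite /Al sumlam scalerA mulfV ?gt_eqF // scale1r -sumrB.
        by apply: eq_bigr => j _; rewrite scalerBr.
      set Y1 := \sum_(p <= j < q) _; set Y2 := \sum_(p <= j < q) _.
      by apply/rowP => i; rewrite !mxE; ring.
    have b1 : `|\sum_(p <= j < q) alpha j *: (frozen y (pc (X j)) - grd j)| <= S * rho1.
      apply: le_trans (ler_norm_sum _ _ _) _; rewrite -SE mulr_suml.
      rewrite big_nat_cond [leRHS]big_nat_cond; apply: ler_sum => j; rewrite andbT => jpq.
      rewrite normrZ gtr0_norm //; apply: ler_wpM2l; first exact: ltW.
      have [w /andP[uw wv] wj] := sub j jpq.
      have := frz w (le_trans tu uw) (le_trans wv vl).
      by rewrite /pt /Xt wj.
    have b2 : `|((v - u) - S) *: Al| <= e1 * L1.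
      rewrite normrZ; apply: ler_pM => //; first exact: clk.
      exact: norm_weights.
    have b3 := noise u v tu uv vl.
    have Sl : S <= 2 * l by have := clk u v tu uv; rewrite ler_norml => /andP[h1 h2]; rewrite /S; lra.
    apply: le_trans (ler_normD _ _) _; apply: le_trans (lerD (ler_normB _ _) b2) _.
    apply: le_trans (lerD (lerD b1 b3) (lexx _)) _.
    have Sr : S * rho1 <= 2 * l * rho1 by rewrite ler_wpM2r // ltW.
    have rr : l * (rho1 * 8) <= l * rho by rewrite ler_wpM2l ?(ltW l0) //; lra.
    lra.
- move=> u v /andP[tu ul] /andP[tv vl] e.
  have mv : `|Xt v - Xt u| <= (2 * Lg + 2) * l.
    have [uv|vu] := leP u v; first exact: move2.
    by rewrite distrC; apply: move2 => //; exact: ltW.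
  have -> : Ft v = g (pt u) (Xt v) by rewrite e; apply: Cl_eq; exact: Cl_pc.
  have -> : Ft u = g (pt u) (Xt u) by apply: Cl_eq; exact: Cl_pc.
  have := @line_gradient_approx _ _ _ _ (Xt u) (Xt v) (frozen y (pt u) ord0) rho1 (line_g (pt u)).
  move=> H; have {}H := H _.
  have -> : dot (frozen y (pt u)) (Xt v - Xt u) = \sum_i frozen y (pt u) ord0 i * (Xt v ord0 i - Xt u ord0 i).
    by apply: eq_bigr => i _; rewrite !mxE.
  apply: le_trans (H _) _.
    move=> s i s01; apply: (hr' _ _ _).2 (act u tu ul) i.
    pose r2 := Num.max `|Xt u - y| `|Xt v - y|.
    apply: le_lt_trans (@segment_ball R m (Xt u) (Xt v) y r2 s s01 _ _) _.
    - by rewrite le_max lexx.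
    - by rewrite le_max lexx orbT.
    - by rewrite gt_max; apply/andP; split; exact: near.
  have : \sum_i `|Xt v ord0 i - Xt u ord0 i| <= m%:R * ((2 * Lg + 2) * l).
    apply: le_trans (_ : m%:R * `|Xt v - Xt u| <= _); last by rewrite ler_wpM2l.
    apply: le_trans (sum_coord_le (Xt v - Xt u)).
    by apply: ler_sum => i _; rewrite !mxE.
  move=> /(ler_wpM2l (ltW rho10)) H2; apply: le_trans H2 _.
  have -> : rho1 * (m%:R * ((2 * Lg + 2) * l)) = rho1 * (m%:R * (2 * Lg + 2)) * l by ring.
  by apply: ler_wpM2r; [exact: ltW|lra].
- move=> u v /andP[tu ul] /andP[tv vl].
  have mv : `|Xt v - Xt u| <= Lg * `|v - u| + Lg * e1 + e2.
    have [uv|vu] := leP u v; first by rewrite ger0_norm ?subr_ge0 //; exact: move1.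
    by rewrite distrC [`|v - u|]distrC gtr0_norm ?subr_gt0 //; apply: move1 => //; exact: ltW.
  apply: le_trans (hLf _ _ (X_bound _) (X_bound _)) _.
  apply: le_trans (ler_wpM2l Lf0 mv) _.
  have h1 : 0 <= Lg * `|v - u| by rewrite mulr_ge0.
  have h2 : 0 <= Lg * e1 by rewrite mulr_ge0 // ltW.
  rewrite /L1 in L1e1 *; set w := `|v - u| in h1 *; nra.
Qed.

(** Inactive branches have zero weight and are replaced by [pc y], so that all selected branches
    take the value [f y]. *)
Lemma critical_config_of (y : 'rV[R]_m) : critical y ->
  exists sigma, critical_config g sigma y (f y).
Proof.
move=> [lam [[l0 l1] lC l2]].
exists (fun k => if `[< Cl k y >] then k else pc y); split.
  by move=> k; case: asboolP => h; apply/esym/Cl_eq => //; exact: Cl_pc.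
exists lam; split=> // i.
have : (\sum_k lam k *: gradient (g k) y) ord0 i = 0 by rewrite l2 mxE.
rewrite summxE => E; rewrite -[RHS]E; apply: eq_bigr => k _; rewrite mxE.
have [->|lk] := eqVneq (lam k) 0; first by rewrite !mul0r.
by rewrite asboolT //; exact: lC.
Qed.

Let kap_clock k : kap (clock alpha k) = k.
Proof. exact: kappa_clock. Qed.

Lemma values_cvg : cvg (f (X k) @[k --> \oo]).
Proof.
have [B hB] := @bounded_on_ball R m f M f_cont.
apply: (@cvg_no_oscillation R (fun k => f (X k)) B) => [k|a b ab ioa iob]; first exact: hB.
have [Lg Lg0 hLg] := gradient_bound M.
have [Lf Lf0 hLf] := f_lipschitz M.
pose a' := a + (b - a) / 3; pose b' := a + (b - a) / 3 * 2.
have [||v /andP[va vb] nv] := @no_critical_interval R m' N g Ckg (`|M| + 1) a' b'.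
- by rewrite ltr_wpDl.
- rewrite /a' /b'; lra.
have {}va : a < v by rewrite /a' in va; lra.
have {}vb : v < b by rewrite /b' in vb; lra.
pose Z := [set y : 'rV[R]_m | `|y| <= M /\ f y = v].
have cZ : compact Z.
  apply: (@compact_closedI _ [set y : 'rV[R]_m | `|y| <= M] [set y | f y = v]); first exact: compact_norm_le.
  by apply: (@closed_comp _ _ f [set x | x = v]) => [y _|]; [exact: f_cont|exact: closed_eq].
have Znc y : Z y -> ~ critical y.
  move=> [yM yv] /critical_config_of[sigma]; rewrite yv; apply: nv => i.
  apply: le_trans (rV_coord_le _ _) _; apply: le_trans yM _.
  by apply: le_trans (ler_norm _) _; rewrite lerDl.
pose Pr (l : R) y := exists K, forall t, clock alpha K <= t -> `|Xt t - y| < l ->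
  f (Xt (t + l)) < f (Xt t).
have [|r0 r00 hr0] := @compact_uniform_radius R m Z Pr cZ.
  move=> y Zy; have [r [c [r1 c1 hrc]]] := local_descent (Znc y Zy) Zy.1.
  exists (r / 2); first by rewrite divr_gt0.
  move=> z l zy /andP[l0 lr].
  have [|K hK] := hrc l; first by rewrite l0; lra.
  exists K => t Kt tz; have := hK t Kt.
  have -> : `|Xt t - y| < r.
    apply: le_lt_trans (ler_distD z _ _) _.
    by move: tz zy; set A := `|Xt t - z|; set A' := `|z - y|; lra.
  have : 0 < c * l by rewrite mulr_gt0.
  by move=> h /(_ isT); rewrite mulNr; lra.
pose gap := (b - v) / 4.
have gap0 : 0 < gap by rewrite divr_gt0 // subr_gt0.
have scale A : 0 <= A -> 0 < gap / (A + 1) /\ A * (gap / (A + 1)) <= gap.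
  move=> A0; have A1 : 0 < A + 1 by rewrite ltr_wpDl.
  split; first by rewrite divr_gt0.
  by rewrite mulrCA ler_piMr ?(ltW gap0) // ler_pdivrMr //; lra.
have LL0 : 0 <= Lf * Lg by rewrite mulr_ge0.
have [q10 q1] := scale _ LL0; have [q20 q2] := scale _ Lf0.
(* Short enough for the uniform descent on the level set, and for [f] to rise by at most
   [2 * gap < b - v] within time [l]. *)
pose l := Num.min (r0 / 2) (gap / (Lf * Lg + 1)).
have l0 : 0 < l by rewrite lt_min q10 divr_gt0.
have lr0 : l < r0 by apply: le_lt_trans (_ : r0 / 2 < _); [rewrite ge_min lexx|lra].
have Ll : Lf * Lg * l <= gap.
  by apply: le_trans q1; rewrite ler_wpM2l // ge_min lexx orbT.
have [K1 hK1] := noise_small l q20.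
(* [k] is the last index before [e] with value at most [v]. A lower value after time [l] is
   impossible: either the index then reached is at most [e], where the values exceed [v], or [e]
   itself is reached within time [l], too soon for a rise to [b]. *)
have up n : exists k, [/\ (n <= k)%N, f (X k) <= v, v < f (X k.+1) &
    ~ f (Xt (clock alpha k + l)) < f (Xt (clock alpha k))].
  have [p pn pa] := ioa (maxn n K1); have [e ep eb] := iob p.
  pose Q k := (p <= k <= e)%N && (f (X k) <= v).
  have exQ : exists k, Q k by exists p; rewrite /Q leqnn ep /=; lra.
  have Qe k : Q k -> (k <= e)%N by case/andP=> /andP[].
  case: (ex_maxnP exQ Qe) => k /andP[/andP[pk ke] kv] kmax.
  have ke' : (k < e)%N.
    rewrite ltn_neqAle ke andbT; apply/eqP => E; rewrite E in kv; lra.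
  have aft j : (k < j <= e)%N -> v < f (X j).
    move=> /andP[kj je]; rewrite ltNge; apply/negP => jv.
    have := kmax j; rewrite /Q je (leq_trans pk (ltnW kj)) jv => /(_ isT).
    by rewrite leqNgt kj.
  move: pn; rewrite geq_max => /andP[pn pK1].
  exists k; split=> //; first exact: leq_trans pk.
    by apply: aft; rewrite leqnn ke'.
  rewrite /Xt kap_clock => hlt.
  set q := kap (clock alpha k + l) in hlt.
  have qk : (k < q)%N.
    rewrite ltn_neqAle; apply/andP; split; first by apply/eqP => E; rewrite -E ltxx in hlt.
    by rewrite -{1}(kap_clock k); apply: kappa_mono; rewrite lerDl ltW.
  have [qe|qe] := leqP q e; first by have := aft q; rewrite qk qe => /(_ isT); lra.
  have ce : clock alpha e - clock alpha k <= l.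
    have := clock_mono alpha_gt0 (ltnW qe).
    have /andP[h _] := kappaP alpha_gt0 alpha_sum (addr_ge0 (clock_ge0 k) (ltW l0)).
    rewrite -/kap -/q in h; lra.
  have h1 := displacement_le ke hLg.
  have h2 := hK1 k e (leq_trans pK1 pk) ke ce.
  have h3 := hLf _ _ (X_bound k) (X_bound e).
  have h4 : Lf * `|X e - X k| <= Lf * (Lg * l + gap / (Lf + 1)).
    apply: ler_wpM2l => //; apply: le_trans h1 _; apply: lerD => //.
    by rewrite ler_wpM2l.
  have h5 : f (X e) - f (X k) <= gap + gap.
    apply: le_trans (ler_norm _) _; apply: le_trans h3 _; apply: le_trans h4 _.
    by rewrite mulrDr mulrA lerD.
  rewrite /gap in h5; lra.
have /choice[ks ksP] := up.
have [y yM yacc] := @accumulation_exists R m (fun n => X (ks n)) M (fun n => X_bound _).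
(* The values at [k] and [k.+1] lie on the two sides of [v], and the steps vanish. *)
have yv : f y = v.
  apply/eqP; rewrite -subr_eq0 -normr_le0; apply/ler_addgt0Pl => e e0; rewrite addr0.
  pose e' := e / 3 / (Lf + 1).
  have e'0 : 0 < e' by rewrite !divr_gt0 // ltr_wpDl.
  have e'E : Lf * e' <= e / 3.
    rewrite /e' mulrCA ler_piMr // ?divr_ge0 // ?(ltW e0) //.
    by rewrite ler_pdivrMr ?ltr_wpDl //; lra.
  pose e'' := e' / (Lg + 1).
  have e''0 : 0 < e'' by rewrite divr_gt0 // ltr_wpDl.
  have e''E : Lg * e'' <= e'.
    rewrite /e'' mulrCA ler_piMr ?(ltW e'0) //.
    by rewrite ler_pdivrMr ?ltr_wpDl //; lra.
  have [Ka hKa] := alpha_small e''0; have [Kn hKn] := noise_small e'' e'0.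
  have [n nK ny] := yacc e' (maxn Ka Kn) e'0.
  have [kn kv kv1 _] := ksP n; set k := ks n in kn kv kv1 ny.
  have := leq_trans nK kn; rewrite geq_max => /andP[kKa kKn].
  have ce : clock alpha k.+1 - clock alpha k <= e''.
    by rewrite clockS addrAC subrr add0r; exact: hKa.
  have h1 := displacement_le (leqnSn k) hLg.
  have h2 := hKn k k.+1 kKn (leqnSn k) ce.
  have h3 := hLf _ _ (X_bound k) (X_bound k.+1).
  have h4 : Lf * `|X k.+1 - X k| <= Lf * (e' + e').
    apply: ler_wpM2l => //; apply: le_trans h1 _; apply: lerD => //.
    by apply: le_trans e''E; rewrite ler_wpM2l.
  have h5 := hLf _ _ (X_bound k) yM.
  have h6 : Lf * `|y - X k| <= Lf * e' by rewrite ler_wpM2l // distrC ltW.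
  have := le_trans h3 h4; have := le_trans h5 h6; rewrite !ler_norml mulrDr.
  move=> /andP[a1 a2] /andP[a3 a4]; apply/andP; split; lra.
have [K hK] := hr0 y l (conj yM yv) (introT andP (conj l0 lr0)).
have [n nK ny] := yacc l K l0; have [kn _ _ H] := ksP n.
apply: H; apply: hK; last by rewrite /Xt kap_clock.
by apply: clock_mono => //; exact: leq_trans kn.
Qed.

(** Near a non-critical [y], each late visit would be followed by a drop of [f] by the fixed amount
    [c * (r / 2)], against the convergence of the values. *)
Lemma accumulation_critical y : is_cluster X y -> critical y.
Proof.
move=> yacc; apply: contrapT => nc.
have yM : `|y| <= M.
  rewrite leNgt; apply/negP => My.
  have [|k _ kd] := yacc (`|y| - M) 0%N; first by rewrite subr_gt0.
  have := ler_normB (X k) (X k - y); rewrite opprB addrCA subrr addr0.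
  by have := X_bound k; move: kd; set A := `|X k - y|; lra.
have [r [c [r0 c0 hrc]]] := local_descent nc yM.
have [|K hK] := hrc (r / 2); first by rewrite divr_gt0 //; lra.
have /cvg_ex[/= F hF] := values_cvg.
pose e := c * (r / 2) / 4.
have e0 : 0 < e by rewrite divr_gt0 // mulr_gt0 // divr_gt0.
have /cvgrPdist_lt /(_ _ e0) [K2 _ hK2] := hF.
have [k kK ky] := yacc r (maxn K K2) r0.
move: kK; rewrite geq_max => /andP[kK kK2].
have := hK (clock alpha k) (clock_mono alpha_gt0 kK); rewrite /Xt kap_clock => /(_ ky).
set q := kap _.
have qk : (k <= q)%N.
  by rewrite -{1}(kap_clock k); apply: kappa_mono; rewrite lerDl divr_ge0 // ltW.
have := hK2 k kK2; have := hK2 q (leq_trans kK2 qk); rewrite /= !ltr_norml.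
move: e0; rewrite /e mulNr; set w := c * (r / 2) => e0 /andP[a1 a2] /andP[a3 a4]; lra.
Qed.

End Sequence.
End Dynamics.

(** * Smoothness and gradients of averages *)

Section Smoothness.
Context {R : realType} {m : nat}.
Implicit Types (g h : 'rV[R]_m -> R).

Lemma gradient_cst (c : R) x : gradient (fun=> c) x = 0 :> 'rV[R]_m.
Proof. by apply/rowP => i; rewrite !mxE derive_cst. Qed.

Lemma gradientD g h x : differentiable g x -> differentiable h x ->
  gradient (fun x => g x + h x) x = gradient g x + gradient h x.
Proof.
move=> dg dh; apply/rowP => i; rewrite !mxE.
by rewrite -deriveD; [|exact: diff_derivable|exact: diff_derivable].
Qed.

Lemma gradientZ (c : R) g x : differentiable g x ->
  gradient (fun x => c * g x) x = c *: gradient g x.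
Proof.
move=> dg; apply/rowP => i; rewrite !mxE.
by apply: deriveZ; exact: diff_derivable.
Qed.

Lemma is_Ck_cst k (c : R) : is_Ck k ((fun=> c) : 'rV[R]_m -> R).
Proof.
elim: k c => [|k IH] c /=; first exact: cst_continuous.
split=> [x|i]; first exact: differentiable_cst.
have -> : (fun x : 'rV[R]_m => gradient (fun=> c) x ord0 i) = fun=> 0.
  by apply/funext => x; rewrite gradient_cst mxE.
exact: IH.
Qed.

Lemma is_CkD k g h : is_Ck k g -> is_Ck k h -> is_Ck k (fun x => g x + h x).
Proof.
elim: k g h => [|k IH] g h /=; first by move=> cg ch x; exact: (cvgD (cg x) (ch x)).
move=> [dg Cg] [dh Ch]; split=> [x|i]; first exact: differentiableD.
have -> : (fun x => gradient (fun x => g x + h x) x ord0 i) =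
    (fun x => gradient g x ord0 i + gradient h x ord0 i).
  by apply/funext => x; rewrite gradientD // [LHS]mxE.
exact: IH.
Qed.

Lemma is_CkZ k (c : R) g : is_Ck k g -> is_Ck k (fun x => c * g x).
Proof.
elim: k g => [|k IH] g /=.
  by move=> cg x; exact: (cvgM (cvg_cst _) (cg x)).
move=> [dg Cg]; split=> [x|i]; first exact: (@differentiableZ _ _ _ g c).
have -> : (fun x => gradient (fun x => c * g x) x ord0 i) =
    (fun x => c * gradient g x ord0 i).
  by apply/funext => x; rewrite gradientZ // [LHS]mxE.
exact: IH.
Qed.

Lemma is_Ck_sum k (I : Type) (r : seq I) (F : I -> 'rV[R]_m -> R) :
  (forall i, is_Ck k (F i)) -> is_Ck k (fun x => \sum_(i <- r) F i x).
Proof.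
move=> CF; elim: r => [|i r IH].
  have -> : (fun x => \sum_(i <- [::]) F i x) = fun=> 0 by apply/funext => x; rewrite big_nil.
  exact: is_Ck_cst.
have -> : (fun x => \sum_(j <- i :: r) F j x) = fun x => F i x + \sum_(j <- r) F j x.
  by apply/funext => x; rewrite big_cons.
exact: is_CkD.
Qed.

Lemma gradient_sum (I : Type) (r : seq I) (F : I -> 'rV[R]_m -> R) x :
  (forall i, is_Ck 1 (F i)) ->
  gradient (fun x => \sum_(i <- r) F i x) x = \sum_(i <- r) gradient (F i) x.
Proof.
move=> CF; elim: r => [|i r IH].
  have -> : (fun x => \sum_(i <- [::]) F i x) = fun=> 0 by apply/funext => y; rewrite big_nil.
  by rewrite big_nil gradient_cst.
have -> : (fun x => \sum_(j <- i :: r) F j x) = fun x => F i x + \sum_(j <- r) F j x.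
  by apply/funext => y; rewrite big_cons.
rewrite gradientD ?big_cons ?IH //; first by have [] := CF i.
by have [] := is_Ck_sum r CF.
Qed.

Lemma is_Ck_average k n (F : 'I_n -> 'rV[R]_m -> R) :
  (forall i, is_Ck k (F i)) -> is_Ck k (average F).
Proof. by move=> CF; apply: is_CkZ; exact: is_Ck_sum. Qed.

Lemma gradient_average n (F : 'I_n -> 'rV[R]_m -> R) x : (forall i, is_Ck 1 (F i)) ->
  gradient (average F) x = n%:R^-1 *: \sum_i gradient (F i) x.
Proof.
move=> CF; rewrite /average gradientZ; last by have [] := is_Ck_sum (index_enum 'I_n) CF.
by rewrite gradient_sum.
Qed.

End Smoothness.

Section ConvexHull.
Context {R : realType} {m : nat}.

(** Induction from binary convexity, the tail being normalised by its total weight. Zero weights are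
    skipped because [a k] is known to lie in [A] only for nonzero ones. *)
Lemma convex_combination (A : set 'rV[R]_m) (I : eqType) (r : seq I) (lam : I -> R)
    (a : I -> 'rV[R]_m) : @convex_set R 'rV[R]_m A -> (forall k, 0 <= lam k) ->
  (forall k, lam k != 0 -> A (a k)) -> 0 < \sum_(k <- r) lam k ->
  A ((\sum_(k <- r) lam k)^-1 *: \sum_(k <- r) lam k *: a k).
Proof.
move=> cA l0 lA; elim: r => [|k r IH]; first by rewrite big_nil ltxx.
rewrite !big_cons; set S := \sum_(j <- r) lam j; set V := \sum_(j <- r) lam j *: a j.
have S0 : 0 <= S by apply: sumr_ge0.
have [k0|k0] := eqVneq (lam k) 0.
  by rewrite k0 scale0r !add0r; exact: IH.
have lk : 0 < lam k by rewrite lt_neqAle eq_sym k0 l0.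
have [S00|S1] := eqVneq S 0.
  have -> : V = 0.
    rewrite /V big_seq big1 // => j jr.
    have : \sum_(j <- r) lam j == 0 by rewrite -/S S00.
    by rewrite psumr_eq0 // => /allP /(_ j jr) /eqP ->; rewrite scale0r.
  move=> _; rewrite S00 !addr0 scalerA mulVf ?gt_eqF // scale1r; exact: lA.
have S2 : 0 < S by rewrite lt_neqAle eq_sym S1.
move=> T0; have {}IH := IH S2.
have t0 : 0 <= lam k / (lam k + S) by rewrite divr_ge0 // ltW.
have t1 : lam k / (lam k + S) <= 1 by rewrite ler_pdivrMr // mul1r lerDl.
have := cA (a k) (S^-1 *: V) (Itv01 t0 t1).
rewrite !inE => /(_ (lA _ k0) IH).
set B := conv _ _ _; suff -> : B = (lam k + S)^-1 *: (lam k *: a k + V) by [].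
have -> : B = (lam k / (lam k + S)) *: a k + (1 - lam k / (lam k + S)) *: (S^-1 *: V) by [].
rewrite scalerDr !scalerA; congr (_ *: _ + _ *: _); first by rewrite mulrC.
by field; rewrite S1 gt_eqF.
Qed.

End ConvexHull.

(** * Limit points of a bounded sequence *)

Section LimitSet.
Context {R : realType} {m : nat}.
Variables (u : nat -> 'rV[R]_m) (M : R).
Hypothesis uM : forall k, `|u k| <= M.

Lemma limit_pointsP y : limit_points u y <-> is_cluster u y.
Proof.
split=> [[phi phi_mono cvy] e K e0|acc].
  have /cvgrPdist_lt /(_ _ e0) [n _ hn] := cvy.
  have phi_ge k : (k <= phi k)%N.
    elim: k => [//|k IH]; apply: leq_ltn_trans IH _; exact: phi_mono.
  exists (phi (maxn n K)); first by apply: leq_trans (phi_ge _); exact: leq_maxr.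
  by rewrite distrC; apply: hn; exact: leq_maxl.
have /choice[sel selP] : forall nK : nat * nat, exists k, (nK.2 <= k)%N /\
    `|u k - y| < nK.1.+1%:R^-1.
  by move=> [n K]; have [|k] := acc n.+1%:R^-1 K; [rewrite invr_gt0|exists k].
pose phi := fix phi n := if n is n'.+1 then sel (n, (phi n').+1) else sel (0, 0)%N.
exists phi.
  have step n : (phi n < phi n.+1)%N by exact: (selP (n.+1, (phi n).+1)).1.
  by apply: homo_ltn => // ? ? ?; exact: ltn_trans.
apply/cvgrPdist_lt => e e0.
have [n hn] : exists n : nat, n.+1%:R^-1 < e.
  exists (Num.truncn e^-1); rewrite invf_plt ?posrE ?ltr0n //; exact: truncnS_gt.
exists n => // k /= nk; rewrite distrC.
have h : `|u (phi k) - y| < k.+1%:R^-1.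
  by case: k {nk} => [|k]; [exact: (selP (0, 0)%N).2|exact: (selP (k.+1, (phi k).+1)).2].
apply: lt_trans h _; apply: le_lt_trans hn.
by rewrite lef_pV2 ?posrE ?ltr0n // ler_nat.
Qed.

Lemma is_cluster_sub (ks : nat -> nat) y : (forall n, (n <= ks n)%N) ->
  is_cluster (fun n => u (ks n)) y -> is_cluster u y.
Proof.
move=> ksn acc e K e0; have [n Kn ny] := acc e K e0.
by exists (ks n) => //; exact: leq_trans (ksn n).
Qed.

Lemma is_cluster_norm y : is_cluster u y -> `|y| <= M.
Proof.
move=> yacc; rewrite leNgt; apply/negP => My.
have [|k _ kd] := yacc (`|y| - M) 0%N; first by rewrite subr_gt0.
have := ler_normB (u k) (u k - y); rewrite opprB addrCA subrr addr0.
by have := uM k; move: kd; set A := `|u k - y|; lra.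
Qed.

Lemma closed_is_cluster : closed [set y | is_cluster u y].
Proof.
move=> y cy e K e0.
have e20 : 0 < e / 2 by rewrite divr_gt0.
have [z [zacc zy]] := cy (ball y (e / 2)) (nbhsx_ballx _ _ e20).
have [k Kk kz] := zacc (e / 2) K e20; exists k => //.
apply: le_lt_trans (ler_distD z _ _) _; rewrite [ltRHS]splitr ltrD //.
by rewrite distrC -ball_normE in zy *.
Qed.

Lemma enorm_le (v : 'rV[R]_m) : enorm v <= m%:R * `|v|.
Proof.
apply: le_trans (sum_coord_le v).
have S0 : 0 <= \sum_i `|v ord0 i| by exact: sumr_ge0.
rewrite -[leRHS]ger0_norm // -sqrtr_sqr ler_wsqrtr //.
rewrite expr2 mulr_suml; apply: ler_sum => i _.
rewrite -[leLHS]ger0_norm ?sqr_ge0 // normrX expr2 ler_wpM2l //.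
by rewrite (bigD1 i) //= lerDl sumr_ge0.
Qed.

(** Otherwise a subsequence staying at distance at least [e] would have a cluster point, which lies
    in [S]. The passage from the sup norm to the Euclidean norm costs the factor [m]. *)
Lemma dist_cvg0 (S : set 'rV[R]_m) : (forall y, is_cluster u y -> S y) ->
  edist_set (u k) S @[k --> \oo] --> 0%E.
Proof.
move=> accS.
have d0 k : (0 <= edist_set (u k) S)%E.
  by apply: le_ereal_inf_tmp => _ [y _ <-]; rewrite lee_fin sqrtr_ge0.
have small e : 0 < e -> \forall k \near \oo, (edist_set (u k) S < e%:E)%E.
  move=> e0; apply: contrapT => h.
  have /choice[ks ksP] : forall n, exists k, (n <= k)%N /\ ~ (edist_set (u k) S < e%:E)%E.
    move=> n; apply: contrapT => hn; apply: h; exists n => // k /= nk.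
    by apply: contrapT => hk; apply: hn; exists k.
  have [y yM yacc] := accumulation_exists (fun n => uM (ks n)).
  have d1 : 0 < e / (m%:R + 1) by rewrite divr_gt0 // ltr_wpDl.
  have [n _ ny] := yacc _ 0%N d1.
  apply: (ksP n).2; apply: (@le_lt_trans _ _ (enorm (u (ks n) - y))%:E).
    apply: ereal_inf_lbound; exists y => //; apply: accS.
    by apply: is_cluster_sub yacc => k; exact: (ksP k).1.
  rewrite lte_fin; apply: le_lt_trans (enorm_le _) _.
  apply: le_lt_trans (_ : m%:R * (e / (m%:R + 1)) < _).
    by rewrite ler_wpM2l // ltW.
  by rewrite mulrCA gtr_pMr // ltr_pdivrMr ?ltr_wpDl //; lra.
move=> A /= nA.
have /nbhs_ballP [e /= e0 hA] : nbhs (0 : R) (fun r => A r%:E) by exact: nA.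
apply: filterS (small e e0) => k hk /=; move: (d0 k) hk.
case: (edist_set (u k) S) => [r| |] //; rewrite lee_fin lte_fin => r0 re.
by apply: (hA r); rewrite -ball_normE /= sub0r normrN ger0_norm.
Qed.

Hypothesis steps : forall e, 0 < e -> exists K, forall k, (K <= k)%N -> `|u k.+1 - u k| <= e.

(** A proper nonempty relatively clopen part [B] would be left infinitely often by the sequence. The
    iterates just after an exit from the tube of width [dl / 3] around [B] have a cluster point
    within [dl] of [B]; it then belongs to [B], yet iterates outside the tube come arbitrarily close
    to it. *)
Lemma connected_limit_points : connected (limit_points u).
Proof.
have -> : limit_points u = [set y | is_cluster u y].
  by apply/seteqP; split=> y /limit_pointsP.
set A := [set y | is_cluster u y].
move=> B [b0 Bb0] [C1 oC1 B1] [C2 cC2 B2].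
apply/seteqP; split=> [y|z Az]; first by rewrite B1 => -[].
apply: contrapT => nBz.
have cB : compact B.
  apply: (subclosed_compact _ (@compact_norm_le R m M)).
    by rewrite B2; apply: closedI => //; exact: closed_is_cluster.
  by move=> y; rewrite B1 => -[/is_cluster_norm].
have [|d d0 hd] := @compact_uniform_radius R m B (fun s y => forall z, `|z - y| < s -> C1 z) cB.
  move=> y; rewrite B1 => -[_ C1y].
  have /nbhs_ballP[r /= r0 hr] : nbhs y C1 by exact: open_nbhs_nbhs.
  exists (r / 2); first by rewrite divr_gt0.
  move=> y' s y'y /andP[_ sr] z' z'y'; apply: hr; rewrite -ball_normE /= distrC.
  apply: le_lt_trans (ler_distD y' _ _) _; rewrite [ltRHS]splitr ltrD //.
  exact: lt_trans sr.
pose dl := d / 2.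
have dl0 : 0 < dl by rewrite divr_gt0.
have hdl b y : B b -> `|y - b| < dl -> C1 y.
  by move=> Bb; apply: (hd b dl Bb); rewrite dl0 /=; rewrite /dl; lra.
(* The three errors add up to less than [dl]: the distance to [B] before the exit, one step, and the
   distance to the cluster point. *)
pose near k := `[< exists2 b, B b & `|u k - b| < dl / 3 >].
have d30 : 0 < dl / 3 by rewrite divr_gt0.
have Ab0 : is_cluster u b0 by move: Bb0; rewrite B1 => -[].
have far k : `|u k - z| < dl / 3 -> ~~ near k.
  move=> kz; apply/asboolP => -[b Bb kb]; apply: nBz; rewrite B1; split=> //.
  apply: (hdl b) => //; apply: le_lt_trans (ler_distD (u k) _ _) _.
  rewrite distrC; move: kz kb; set p := `|u k - z|; set q := `|u k - b|; lra.
have [K hK] := steps d30.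
have trans n : exists k, [/\ (n <= k)%N, near k, ~~ near k.+1 & (K <= k)%N].
  have [p pn pb] := Ab0 (dl / 3) (maxn n K) d30.
  have [e ep ez] := Az (dl / 3) p d30.
  have np : near p by apply/asboolP; exists b0.
  have ex : exists j, (p <= j)%N && ~~ near j by exists e; rewrite ep far.
  case: (ex_minnP ex) => j /andP[pj nj] jmin.
  have pj' : (p < j)%N.
    rewrite ltn_neqAle pj andbT; apply/eqP => E; by rewrite -E np in nj.
  have jE : j = j.-1.+1 by rewrite prednK // (leq_trans _ pj').
  have pj1 : (p <= j.-1)%N by rewrite -ltnS -jE.
  move: pn; rewrite geq_max => /andP[pn pK].
  exists j.-1; split; rewrite -?jE //.
  - exact: leq_trans pj1.
  - apply: contraT => nj1; have := jmin j.-1; rewrite pj1 nj1 => /(_ isT).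
    by rewrite {1}jE ltnn.
  - exact: leq_trans pj1.
have /choice[ks ksP] := trans.
have [y yM yacc] := accumulation_exists (fun n => uM (ks n).+1).
have Ay : A y.
  apply: is_cluster_sub yacc => n; have [h _ _ _] := ksP n; exact: leqW.
have [n _ ny] := yacc (dl / 3) 0%N d30.
have [_ /asboolP[b Bb kb] /asboolP nn Kk] := ksP n.
apply: nn; exists y => //; rewrite B1; split=> //; apply: (hdl b) => //.
have st := hK _ Kk.
apply: le_lt_trans (ler_distD (u (ks n).+1) _ _) _.
rewrite [`|y - _|]distrC.
have := ler_distD (u (ks n)) (u (ks n).+1) b.
move: ny kb st; set p := `|_ - y|; set q := `|u (ks n) - b|; set w := `|u (ks n).+1 - u (ks n)|.
set v := `|u (ks n).+1 - b|; lra.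
Qed.

End LimitSet.

(** * The common refinement *)

Section Refinement.
Context {R : realType} {m' n : nat}.
Let m := m'.+1.
Variables (p : smoothness) (f : 'I_n -> 'rV[R]_m -> R) (J : 'I_n -> nat).
Unset Implicit Arguments.
Variables (Pc : forall i, 'I_(J i) -> set 'rV[R]_m) (fs : forall i, 'I_(J i) -> 'rV[R]_m -> R).
Set Implicit Arguments.
Hypothesis le_mp : le_smoothness m p.
Hypothesis f_cont : forall i, continuous (f i).
Hypothesis f_repr : forall i, is_representation p (f i) (Pc i) (fs i).

(** All multi-indices are kept; those with an empty piece have an empty closure and are never
    active. *)
Let Jt : finType := {dffun forall i : 'I_n, 'I_(J i)}.
Definition ref_index (k : 'I_#|Jt|) (i : 'I_n) : 'I_(J i) := (enum_val k : Jt) i.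
Definition ref_branch (k : 'I_#|Jt|) : 'rV[R]_m -> R := refined_branch fs (ref_index k).
Definition ref_closure (k : 'I_#|Jt|) : set 'rV[R]_m := closure (refined_piece Pc (ref_index k)).

Let fs_Ck i j : is_Ck m (fs i j).
Proof. by apply: is_Cp_Ck le_mp _; exact: (repr_smooth (f_repr i)). Qed.

Let fs_C1 i j : is_Ck 1 (fs i j).
Proof. exact: (is_Ck_le (isT : (1 <= m)%N) (fs_Ck j)). Qed.

Lemma ref_branch_Ck k : is_Ck m (ref_branch k).
Proof. by apply: is_Ck_average => i; exact: fs_Ck. Qed.

Lemma average_cont : continuous (average f).
Proof. by apply: (@is_Ck_average _ _ 0) => i; exact: f_cont. Qed.

Let piece_of x i : exists j, Pc i j x.
Proof.
have [cov _ _] := repr_partition (f_repr i).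
have : cover setT (Pc i) x by rewrite cov.
by move=> [j _ h]; exists j.
Qed.

Definition ref_piece (x : 'rV[R]_m) : 'I_#|Jt| :=
  enum_rank ([ffun i => projT1 (cid (piece_of x i))] : Jt).

Let ref_pieceP x i : Pc i (ref_index (ref_piece x) i) x.
Proof.
rewrite /ref_index /ref_piece enum_rankK ffunE; exact: projT2 (cid (piece_of x i)).
Qed.

Lemma ref_closure_piece x : ref_closure (ref_piece x) x.
Proof. by apply: subset_closure => i _; exact: ref_pieceP. Qed.

(** Equality holds on the piece and is a closed condition between continuous functions. *)
Lemma ref_closure_eq k x : ref_closure k x -> average f x = ref_branch k x.
Proof.
pose E := [set x | average f x - ref_branch k x = 0].
have cE : closed E.
  apply: (@closed_comp _ _ (fun x => average f x - ref_branch k x) [set t | t = 0]); last exact: closed_eq.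
  move=> y _; apply: (cvgB (@average_cont y)).
  exact: (is_Ck_le (leq0n m) (ref_branch_Ck k) y).
have sub : refined_piece Pc (ref_index k) `<=` E.
  move=> y hy; rewrite /E /= /ref_branch /refined_branch /average -mulrBr -sumrB big1 ?mulr0 // => i _.
  by rewrite (repr_eq (f_repr i) (hy i I)) subrr.
move=> hx; have : E x by apply: cE; exact: closureS hx.
by rewrite /E /= => /eqP; rewrite subr_eq0 => /eqP.
Qed.

Lemma piecewise_gradientE x i :
  piecewise_gradient (Pc i) (fs i) x = gradient (fs i (ref_index (ref_piece x) i)) x.
Proof.
rewrite /piecewise_gradient; case: pickP => [j|/(_ (ref_index (ref_piece x) i))]; last first.
  by rewrite mem_set //; exact: ref_pieceP.
rewrite inE => jx; have [_ /trivIsetP tr _] := repr_partition (f_repr i).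
have [->//|ne] := eqVneq j (ref_index (ref_piece x) i).
have := tr _ _ I I ne => /seteqP[/(_ x) + _]; case; split=> //; exact: ref_pieceP.
Qed.

Lemma mean_fieldE x : mean_field (fun i => piecewise_gradient (Pc i) (fs i)) x =
  gradient (ref_branch (ref_piece x)) x.
Proof.
rewrite /mean_field /ref_branch /refined_branch gradient_average; last by move=> i; exact: fs_C1.
by congr (_ *: _); apply: eq_bigr => i _; rewrite piecewise_gradientE.
Qed.

Lemma piecewise_gradient_bounded (M : R) :
  exists B : R, forall i x, `|x| <= M -> `|piecewise_gradient (Pc i) (fs i) x| <= B.
Proof.
have /choice[B BP] : forall i, exists B : R, forall j (x : 'rV[R]_m), `|x| <= M -> `|gradient (fs i j) x| <= B.
  move=> i; have [B _ hB] := @gradient_bound R m' (J i) (fs i) (@fs_Ck i) M.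
  by exists B.
exists (\sum_i `|B i|) => i x xM; rewrite piecewise_gradientE.
apply: le_trans (BP i _ _ xM) _; apply: le_trans (ler_norm _) _.
by rewrite (bigD1 i) //= lerDl sumr_ge0.
Qed.

Lemma critical_hull y : critical ref_branch ref_closure y ->
  convex_hull (closure_active_gradient Pc fs y) 0.
Proof.
move=> [lam [[l0 l1] lC <-]] A [cA DA].
have := @convex_combination R m A _ (index_enum 'I_#|Jt|) lam (fun k => gradient (ref_branch k) y) cA l0.
rewrite l1 invr1 scale1r; apply=> // k /lC h; apply: DA.
by exists (ref_index k).
Qed.

End Refinement.

(** * Vanishing step sizes and assembly of the almost sure statements *)

Lemma littleo_log_small {R : realType} (alpha : nat -> R) :
  (forall k, 0 < alpha k) -> alpha =o_\oo (fun k : nat => (ln k%:R)^-1) ->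
  forall e : R, 0 < e -> exists K, forall k, (K <= k)%N -> alpha k <= e.
Proof.
move=> alpha_gt0 alpha_o e e0.
have ln2 : 0 < ln 2 :> R by rewrite ln_gt0 // ltr1n.
have [K _ hK] : \forall k \near \oo, `|alpha k| <= (e * ln 2) * `|(ln k%:R)^-1|.
  by move/eqoP : alpha_o; apply; rewrite mulr_gt0.
exists (maxn K 2) => k; rewrite geq_max => /andP[Kk k2].
have := hK k Kk => /=; rewrite gtr0_norm // => h; apply: le_trans h _.
have lnk : ln 2 <= ln k%:R :> R.
  by rewrite ler_ln ?posrE ?ltr0n // ?ler_nat // (leq_trans _ k2).
have lnk0 := lt_le_trans ln2 lnk.
by rewrite gtr0_norm ?invr_gt0 // -mulrA ger_pMr // ler_pdivrMr // mul1r.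
Qed.

Theorem theorem4p2 (R : realType) (m n : nat) (p : smoothness)
  (m_gt0 : (0 < m)%N) (n_gt0 : (0 < n)%N) (le_mp : le_smoothness m p)
  (f : 'I_n -> 'rV[R]_m -> R)
  (J : 'I_n -> nat)
  (Pc : forall i, 'I_(J i) -> set 'rV[R]_m)
  (fs : forall i, 'I_(J i) -> 'rV[R]_m -> R)
  (f_cont : forall i, continuous (f i))
  (f_repr : forall i, is_representation p (f i) (Pc i) (fs i))
  (f_bounded_below : has_lbound (range (average f)))
  (d : measure_display) (Omega0 : measurableType d) (P0 : probability Omega0 R)
  (iota : Omega0 -> 'I_n)
  (iota_meas : forall l, measurable (iota @^-1` [set l]))
  (iota_unif : forall l, P0 (iota @^-1` [set l]) = (n%:R^-1)%:E)
  (P : probability (seq_space Omega0) R)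
  (P_prod : is_product_probability P0 P)
  (x0 : 'rV[R]_m)
  (alpha : nat -> R)
  (alpha_gt0 : forall k, 0 < alpha k)
  (alpha_o : alpha =o_\oo (fun k : nat => (ln k%:R)^-1))
  (alpha_sum : (\sum_(0 <= k <oo) (alpha k)%:E = +oo)%E) :
  let G := fun i => piecewise_gradient (Pc i) (fs i) in
  let x := fun (w : seq_space Omega0) (k : nat) =>
    iterates G alpha x0 (fun l => iota (w l)) k in
  let D := closure_active_gradient Pc fs in
  {ae P, forall w, bounded_set (range (x w))} ->
  {ae P, forall w,
     edist_set (x w k) [set y | convex_hull (D y) 0] @[k --> \oo] --> 0%E /\
     cvg (average f (x w k) @[k --> \oo])} /\
  {ae P, forall w, connected (limit_points (x w))}.
Proof.
case: m m_gt0 le_mp f Pc fs f_cont f_repr f_bounded_below x0 => [//|m'] _ le_mp f Pc fs f_cont f_repr _ x0.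
move=> G x D x_bounded.
have G_bounded := piecewise_gradient_bounded le_mp f_repr.
have noise_w := noise_ae n_gt0 iota_meas iota_unif P_prod G_bounded x0 alpha_gt0 alpha_o alpha_sum.
suff main : {ae P, forall w, (edist_set (x w k) [set y | convex_hull (D y) 0] @[k --> \oo] --> 0%E /\
     cvg (average f (x w k) @[k --> \oo])) /\ connected (limit_points (x w))}.
  by split; apply: filterS main => w [].
apply: filterS2 x_bounded noise_w => w /= xb nw.
have [M xM] : exists M : nat, forall k, `|x w k| <= M%:R.
  have [B [_ hB]] := xb.
  exists (Num.truncn (B + 1)).+1 => k; apply: hB; last by exists k.
  by apply: lt_le_trans (ltW (truncnS_gt _)); lra.
pose xi := noise G x0 alpha (fun l => iota (w l)).
have alpha_small := littleo_log_small alpha_gt0 alpha_o.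
(* The mean of the random direction over the index is the gradient of the refined branch active at
   the iterate; [xi] is the deviation from it. *)
have X_step k : x w k.+1 = x w k - alpha k *:
    (gradient (ref_branch fs (ref_piece f_repr (x w k))) (x w k) + xi k).
  rewrite -(mean_fieldE le_mp) /xi /noise addrCA subrr addr0; exact: erefl.
have xi_small (T e : R) : 0 < e -> exists K, forall k l, (K <= k)%N -> (k <= l)%N ->
    clock alpha l - clock alpha k <= T -> `|\sum_(k <= j < l) alpha j *: xi j| <= e.
  move=> e0; have [K hK] := nw M (Num.truncn T).+1 (Num.truncn e^-1) xM.
  exists K => k l Kk kl kT; apply: le_trans (hK _ _ Kk kl _) _.
    by apply: le_trans kT _; apply: ltW; exact: truncnS_gt.
  by rewrite invf_ple ?posrE ?ltr0n //; apply: ltW; exact: truncnS_gt.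
have Ck := ref_branch_Ck le_mp f_repr.
have Cl_closed k : closed (ref_closure Pc k) by exact: closed_closure.
have Cl_pc := ref_closure_piece f_repr.
have Cl_eq := ref_closure_eq le_mp f_cont f_repr.
have fc := average_cont f_cont.
split; first split.
- apply: (dist_cvg0 xM) => y yacc; apply: critical_hull.
  exact: (accumulation_critical Ck Cl_closed Cl_pc Cl_eq fc alpha_gt0 alpha_sum alpha_small X_step xM xi_small yacc).
- exact: (values_cvg Ck Cl_closed Cl_pc Cl_eq fc alpha_gt0 alpha_sum alpha_small X_step xM xi_small).
- apply: (connected_limit_points xM).
  exact: (step_small Ck alpha_gt0 alpha_small X_step xM xi_small).
Qed.
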